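(* Let $N\ge 1$ be an integer. Then $$\mathcal M(\mathrm{bmo}(\mathbb T^N),\mathrm{BMO}(\mathbb T^N))=L^\infty(\mathbb T^N)\cap \mathrm{LMO}(\mathbb T^N).$$
   Context: Pointwise multipliers: for spaces of functions $X,Y$, $\mathcal M(X,Y)=\{\phi:\ \phi f\in Y \text{ for all } f\in X\}$. Little BMO: $\mathrm{bmo}(\mathbb T^N)$ is the set of $b\in L^2(\mathbb T^N)$ with $\sup_R \frac1{|R|}\int_R|b-m_Rb|\,dt<\infty$, the supremum being over all rectangles $R\subset\mathbb T^N$ (products of $N$ intervals of $\mathbb T$), where $m_Rb=\frac1{|R|}\int_R b\,dt$ and $|\cdot|$ is Lebesgue measure. Haar notation: identify $\mathbb T$ with $[0,1)$. $\mathcal D$ is the set of all dyadic subintervals of $[0,1)$ (including $[0,1)$ itself), and $\mathcal D^N$ the set of dyadic rectangles $R=I_1\times\cdots\times I_N$, $I_j\in\mathcal D$. $h_I=|I|^{-1/2}(\chi_{I^+}-\chi_{I^-})$, where $I^+,I^-$ are the right and left halves of $I$; $h_R(t_1,\dots,t_N)=h_{I_1}(t_1)\cdots h_{I_N}(t_N)$; $f_R=\langle f,h_R\rangle$. Dyadic product BMO: for $f\in L^2(\mathbb T^N)$, $\|f\|_{\mathrm{BMO}^d(\mathbb T^N)}^2=\sup_{\Omega}\frac1{|\Omega|}\sum_{R\in\mathcal D^N,\,R\subseteq\Omega}|f_R|^2$, the supremum over all nonempty open $\Omega\subseteq\mathbb T^N$; $f\in\mathrm{BMO}^d(\mathbb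 T^N)$ means that this is finite (only the Haar coefficients $f_R$ matter, i.e. $f$ is identified with its projection on the closed span of $\{h_R\}_{R\in\mathcal D^N}$). Dyadic LMO: for $\vec j=(j_1,\dots,j_N)\in\mathbb N_0^N$ let $Q_{\vec j}\phi=\sum \phi_R h_R$, the sum over all $R=I_1\times\cdots\times I_N\in\mathcal D^N$ with $|I_l|\le 2^{-j_l}$ for $l=1,\dots,N$. Then $\phi\in L^2(\mathbb T^N)$ belongs to $\mathrm{LMO}^d(\mathbb T^N)$ if there is $C>0$ with $\|Q_{\vec j}\phi\|_{\mathrm{BMO}^d(\mathbb T^N)}\le \frac{C}{j_1+\cdots+j_N+N}$ for all $\vec j\in\mathbb N_0^N$. Translated grids: for $\alpha\in[0,1)^N$, $\mathrm{BMO}^{d,\alpha}(\mathbb T^N)$ and $\mathrm{LMO}^{d,\alpha}(\mathbb T^N)$ are defined in the same way using the grid $\mathcal D^N$ translated by $\alpha$ (modulo 1) and the correspondingly translated Haar functions; equivalently $f\in \mathrm{BMO}^{d,\alpha}$ (resp. $\mathrm{LMO}^{d,\alpha}$) iff $f(\cdot+\alpha)\in\mathrm{BMO}^d$ (resp. $\mathrm{LMO}^d$). $\mathrm{LMO}(\mathbb T^N)=\bigcap_{\alpha\in[0,1)^N}\mathrm{LMO}^{d,\alpha}(\mathbb T^N)$. $\mathrm{BMO}(\mathbb T^N)$ denotes the product BMO space of Chang and Fefferman, which is taken in the form $\mathrm{BMO}(\mathbb T^N)=\bigcap_{\alpha\in[0,1)^N}\mathrm{BMO}^{d,\alpha}(\mathbb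 T^N)$. *)

(* Defs.v *)
From HB Require Import structures.
From mathcomp Require Import all_boot all_order all_algebra.
From mathcomp Require Import complex.
From mathcomp Require Import all_classical all_reals all_analysis.

Set Implicit Arguments.
Unset Strict Implicit.
Unset Printing Implicit Defensive.
Import Order.TTheory GRing.Theory Num.Theory.
Import numFieldNormedType.Exports.

Local Open Scope classical_set_scope.
Local Open Scope ring_scope.
Local Open Scope complex_scope.

(* The torus T^N is R^N / Z^N: a function on T^N is a function on R^N invariant
   under translation by integer vectors, a subset of T^N is a subset of R^N
   with the same invariance, and the Lebesgue measure of T^N is the uniform
   probability on the unit cube. Elements of L^2, bmo, BMO, ... are Borel
   representatives; each of these spaces is closed under a.e. equality of such
   functions. Functions are complex-valued. *)

Definition rvec (R : realType) (N : nat) := N.-tuple (measurableTypeR R).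
HB.instance Definition _ (R : realType) (N : nat) :=
  Measurable.on (rvec R N).

Section torus_measure.
Context (R : realType).

Definition cons_rvec (N : nat) (p : measurableTypeR R * rvec R N) :
  rvec R N.+1 := [tuple of p.1 :: p.2].

Lemma measurable_cons_rvec (N : nat) :
  measurable_fun [set: measurableTypeR R * rvec R N] (@cons_rvec N).
Proof. exact: measurable_cons. Qed.

HB.instance Definition _ (N : nat) :=
  isMeasurableFun.Build _ _ _ _ (@cons_rvec N) (@measurable_cons_rvec N).

Fixpoint torus_measure (N : nat) : probability (rvec R N) R :=
  match N with
  | 0 => \d_ ([tuple] : rvec R 0)
  | N'.+1 => distribution (uniform_prob (@ltr01 R) \x torus_measure N')%E
               (@cons_rvec N')
  end.

End torus_measure.

Section spaces.
Context (R : realType) (N : nat).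
Local Notation mu := (torus_measure R N).
Local Notation cfun := (rvec R N -> R[i]).

Definition shift (a x : rvec R N) : rvec R N :=
  [tuple (tnth x i + tnth a i)%R | i < N].

Definition translate (a : rvec R N) (f : cfun) : cfun := f \o shift a.

Definition int_rvec (k : N.-tuple int) : rvec R N := [tuple (tnth k i)%:~R | i < N].

Definition torus_fun (f : cfun) : Prop :=
  [/\ forall k x, f (shift (int_rvec k) x) = f x,
      measurable_fun setT (fun x => complex.Re (f x)) &
      measurable_fun setT (fun x => complex.Im (f x))].

Definition cabs (z : R[i]) : R := ComplexField.Normc.normc z.

Definition cintegral (D : set (rvec R N)) (f : cfun) : R[i] :=
  (\int[mu]_(x in D) complex.Re (f x)) +i* (\int[mu]_(x in D) complex.Im (f x)).

Definition Lp_torus (p : \bar R) : set cfun :=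
  [set f | torus_fun f /\ ('N[mu]_p[(fun x => (cabs (f x))%:E)] < +oo)%E].

Definition multipliers (X Y : set cfun) : set cfun :=
  [set phi | forall f, X f -> Y (fun x => phi x * f x)].

(* The half-open arc of T from a to b, for a < b <= a + 1; the full circle if
   b = a + 1. Including or excluding end points only changes a null set. *)
Definition arc (a b : R) : set R := [set x | exists k : int, a <= x + k%:~R < b].

Definition rectangles : set (set (rvec R N)) :=
  [set Q | exists a b : rvec R N,
    (forall i, tnth a i < tnth b i <= tnth a i + 1) /\
    Q = [set x | forall i, arc (tnth a i) (tnth b i) (tnth x i)]].

Definition vol (A : set (rvec R N)) : R := fine (mu A).

Definition mean (Q : set (rvec R N)) (b : cfun) : R[i] :=
  ((vol Q)^-1)%:C * cintegral Q b.

Definition little_bmo : set cfun :=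
  [set b | Lp_torus 2%:E b /\
    (ereal_sup [set ((vol Q)^-1)%:E *
         \int[mu]_(t in Q) (cabs (b t - mean Q b))%:E | Q in rectangles]
       < +oo)%E].

(* The dyadic interval [k 2^-j, (k+1) 2^-j) is indexed by j and k < 2^j. *)
Definition dyadic := {j : nat & 'I_(2 ^ j)}.

Definition dlen (I : dyadic) : R := 2^-1 ^+ tag I.
Definition dleft (I : dyadic) : R := (tagged I)%:R * dlen I.
Definition dmid (I : dyadic) : R := dleft I + dlen I / 2.
Definition dright (I : dyadic) : R := dleft I + dlen I.

Definition haar1 (I : dyadic) (t : R) : R :=
  (Num.sqrt (dlen I))^-1 *
  (\1_(`[dmid I, dright I[) t - \1_(`[dleft I, dmid I[) t).

Definition dyadic_rect := N.-tuple dyadic.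

Definition rect_set (Q : dyadic_rect) : set (rvec R N) :=
  [set x | forall i, `[dleft (tnth Q i), dright (tnth Q i)[%classic (tnth x i)].

Definition haar (Q : dyadic_rect) (x : rvec R N) : R :=
  \prod_(i < N) haar1 (tnth Q i) (tnth x i).

Definition haar_coef (f : cfun) (Q : dyadic_rect) : R[i] :=
  cintegral setT (fun x => f x * (haar Q x)%:C).

(* Tuples carry no topology in the library: openness in R^N is read off row
   vectors. *)
Definition torus_open (Omega : set (rvec R N)) : Prop :=
  (forall k x, Omega (shift (int_rvec k) x) <-> Omega x) /\
  open [set v : 'rV[R]_N | Omega [tuple v ord0 i | i < N]].

(* An element of the closed span of the orthonormal Haar functions is given by
   the family c of its Haar coefficients, and the dyadic BMO norm is a function
   of that family. *)
Definition BMOd_norm (c : dyadic_rect -> R[i]) : \bar R :=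
  sqrte (ereal_sup [set ((vol Omega)^-1)%:E *
      \esum_(Q in [set Q | rect_set Q `<=` Omega]) ((cabs (c Q)) ^+ 2)%:E
    | Omega in [set Omega | torus_open Omega /\ Omega !=set0]])%E.

Definition BMOd : set cfun :=
  [set f | Lp_torus 2%:E f /\ (BMOd_norm (haar_coef f) < +oo)%E].

(* Q_j applied to the Haar series with coefficients c. *)
Definition haar_proj (j : N.-tuple nat) (c : dyadic_rect -> R[i]) :
    dyadic_rect -> R[i] :=
  fun Q => if [forall l, dlen (tnth Q l) <= 2^-1 ^+ tnth j l] then c Q else 0.

Definition LMOd : set cfun :=
  [set phi | Lp_torus 2%:E phi /\
    exists2 C : R, 0 < C & forall j : N.-tuple nat,
      (BMOd_norm (haar_proj j (haar_coef phi))
        <= (C / (\sum_(l < N) tnth j l + N)%:R)%:E)%E].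

Definition unit_cube : set (rvec R N) := [set a | forall i, 0 <= tnth a i < 1].

Definition product_BMO : set cfun :=
  \bigcap_(a in unit_cube) [set f | BMOd (translate a f)].

Definition LMO : set cfun :=
  \bigcap_(a in unit_cube) [set f | LMOd (translate a f)].

End spaces.

Arguments Lp_torus R N p : clear implicits.
Arguments little_bmo R N : clear implicits.
Arguments product_BMO R N : clear implicits.
Arguments LMO R N : clear implicits.

(* Main.v *)
(* Everything is read off finite families F of dyadic rectangles: a function is
   in dyadic BMO iff the sum over F of its squared Haar coefficients is at most
   C |union of F|, since an open set is exhausted by finite families and, in the
   other direction, a finite union of rectangles is approximated from outside by
   open sets. As bmo is translation invariant, only the standard grid matters.

   Bounded LMO functions are multipliers: for |union of F| about 2^-k, truncate b
   at height T of order k. By the John-Nirenberg inequality the error is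
   negligible in L^2. The Haar coefficients of phi times the truncated b split
   into an oscillation part, bounded through a Carleson embedding (Bellman
   function on each fiber, induction on N), and m_Q(b) phi_Q, where |m_Q(b)| <= T
   is compensated by the factor 1/k^2 that LMO gives for sets of measure 2^-k.

   Multipliers are bounded and in LMO: a gliding hump argument makes the
   multiplier estimate uniform over families of nonnegative test functions with
   bounded bmo norm. Testing on 1 + |R|^(1/2) h_R bounds the means of phi over
   all rectangles R; testing on logarithms of the l-th variable peaked at an
   interval J of length 2^-n, equal to n + 1 on J, yields the decay of the
   coefficients of phi over rectangles whose l-th side has length at most 2^-n. *)

Require Import Defs.
From HB Require Import structures.
From mathcomp Require Import all_boot all_order all_algebra.
From mathcomp Require Import complex ring lra zify.
From mathcomp Require Import all_classical all_reals all_analysis.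
From mathcomp Require Import measurable_realfun ess_sup_inf.

Set Implicit Arguments.
Unset Strict Implicit.
Unset Printing Implicit Defensive.
Import Order.TTheory GRing.Theory Num.Theory.
Import numFieldNormedType.Exports.

Local Open Scope classical_set_scope.
Local Open Scope ring_scope.

(** * Dyadic trees in dimension one *)

(** The obstacle is that Q may be far smaller than the union of F, so the measure of the union does
    not control the mean of b over Q. Truncation bounds all these means at once, and the error is
    absorbed by Bessel's inequality, which ignores the shape of F. Oscillation over rectangles of
    every eccentricity restricts to lines; this is why one-parameter estimates can be iterated over
    the variables. All estimates are first proved on a grid of 2^m cells per side, for arbitrary
    functions of cell indices and with constants independent of m. Discretization does not commute
    with products: phi is therefore replaced by its conditional expectation on cells, for which it
    does, and m tends to infinity by weak convergence. In the converse, the gliding hump takes the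
    place of a closed graph theorem: test functions are nonnegative, so partial sums increase and
    monotone convergence produces the limit, whose membership in bmo is checked rectangle by
    rectangle. *)

Section dyadic_tree.
Context (R : realType).
Implicit Types (d k : nat) (f g b : nat -> R) (t : nat -> nat -> R) (P : nat -> nat -> Prop).

(* A node (d, k) is the block of the 2^d consecutive cells k 2^d, ...,
   (k+1) 2^d - 1; avg is the mean over it, and tsum sums t over the
   descendants of positive height weighted by relative length. *)
Fixpoint avg d k f : R :=
  if d is d'.+1 then (avg d' k.*2 f + avg d' k.*2.+1 f) / 2 else f k.

Fixpoint tsum d k t : R :=
  if d is d'.+1 then t d k + (tsum d' k.*2 t + tsum d' k.*2.+1 t) / 2 else 0.

Fixpoint allnode P d k : Prop :=
  P d k /\ (if d is d'.+1 then allnode P d' k.*2 /\ allnode P d' k.*2.+1 else True).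

(** This is the Haar coefficient divided by |I|^(1/2), so that Parseval holds with averages. At
    height 0 the value is junk, which [tsum] never reads. *)
Definition hdiff d k f : R := (avg d.-1 k.*2.+1 f - avg d.-1 k.*2 f) / 2.

Definition node_osc d k b : Prop := avg d k (fun x => `|b x - avg d k b|) <= 1.

Lemma eq_avg d k f g : f =1 g -> avg d k f = avg d k g.
Proof. by move=> fg; elim: d k => [|d IH] k //=; rewrite !IH. Qed.

Lemma avgD d k f g : avg d k (fun x => f x + g x) = avg d k f + avg d k g.
Proof. by elim: d k => [|d IH] k //=; rewrite !IH; field. Qed.

Lemma avgZ d k (a : R) f : avg d k (fun x => a * f x) = a * avg d k f.
Proof. by elim: d k => [|d IH] k //=; rewrite !IH; field. Qed.

Lemma avg_cst d k (a : R) : avg d k (fun=> a) = a.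
Proof. by elim: d k => [|d IH] k //=; rewrite !IH; field. Qed.

Lemma le_avg d k f g : (forall x, f x <= g x) -> avg d k f <= avg d k g.
Proof.
move=> fg; elim: d k => [|d IH] k //=.
by rewrite ler_pM2r ?invr_gt0// lerD.
Qed.

Lemma avgB d k f g : avg d k (fun x => f x - g x) = avg d k f - avg d k g.
Proof.
rewrite (eq_avg _ _ (g := fun x => f x + (-1) * g x)); last by move=> x; rewrite mulN1r.
by rewrite avgD avgZ mulN1r.
Qed.

Lemma avgBc d k f (a : R) : avg d k (fun x => f x - a) = avg d k f - a.
Proof. by rewrite avgB avg_cst. Qed.

Lemma ler_norm_avg d k f : `|avg d k f| <= avg d k (fun x => `|f x|).
Proof.
rewrite ler_norml; apply/andP; split.
  by rewrite -mulN1r -avgZ; apply: le_avg => x; rewrite mulN1r lerNl -normrN ler_norm.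
by apply: le_avg => x; exact: ler_norm.
Qed.

Lemma avg_ge0 d k f : (forall x, 0 <= f x) -> 0 <= avg d k f.
Proof. by move=> f0; rewrite -(avg_cst d k 0) le_avg. Qed.

Lemma eq_tsum d k t t' : t =2 t' -> tsum d k t = tsum d k t'.
Proof. by move=> e; elim: d k => [|d IH] k //=; rewrite e !IH. Qed.

Lemma tsumD d k t t' : tsum d k (fun x y => t x y + t' x y) = tsum d k t + tsum d k t'.
Proof. by elim: d k => [|d IH] k //=; rewrite ?addr0// !IH; field. Qed.

Lemma tsumZ d k (a : R) t : tsum d k (fun x y => a * t x y) = a * tsum d k t.
Proof. by elim: d k => [|d IH] k //=; rewrite ?mulr0// !IH; field. Qed.

Lemma le_tsum d k t t' : (forall x y, t x y <= t' x y) -> tsum d k t <= tsum d k t'.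
Proof.
move=> tt; elim: d k => [|d IH] k //=.
by rewrite lerD// ler_pM2r ?invr_gt0// lerD.
Qed.

Lemma tsum_ge0 d k t : (forall x y, 0 <= t x y) -> 0 <= tsum d k t.
Proof.
move=> t0; elim: d k => [|d IH] k //=.
by rewrite addr_ge0// divr_ge0// addr_ge0.
Qed.

Lemma allnodeW P d k : allnode P d k -> P d k.
Proof. by case: d => [|d] []. Qed.

Lemma allnode_impl P P' d k :
  (forall d' k', allnode P d' k' -> P' d' k') -> allnode P d k -> allnode P' d k.
Proof.
move=> PP; elim: d k => [|d IH] k /= H; first by split=> //; exact: PP.
split; first exact: PP.
by case: H => _ [H1 H2]; split; exact: IH.
Qed.

Lemma bessel_tree d k f :
  tsum d k (fun e l => hdiff e l f ^+ 2) + avg d k f ^+ 2 = avg d k (fun x => f x ^+ 2).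
Proof.
elim: d k => [|d IH] k /=; first by rewrite add0r.
by rewrite -!IH /hdiff /=; field.
Qed.

Lemma tsum_hdiff d k f : tsum d k (fun e l => hdiff e l f ^+ 2) <= avg d k (fun x => f x ^+ 2).
Proof. by rewrite -bessel_tree lerDl sqr_ge0. Qed.

(** Turns a Carleson condition on the squared differences of b into a bound for the variance of b
    over every node. *)
Lemma hdiff_var d k b : tsum d k (fun e l => hdiff e l b ^+ 2) =
  avg d k (fun x => (b x - avg d k b) ^+ 2).
Proof.
set a := avg d k b.
rewrite (eq_avg _ _ (g := fun x => b x ^+ 2 + ((- 2 * a) * b x + a ^+ 2))); last by move=> x; ring.
by rewrite avgD avgD avgZ avg_cst -bessel_tree -/a; ring.
Qed.

(** The derivative of 1/(1+s) is at most -1/4 on [0, 1]. *)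
Lemma inv_drop (s c : R) : 0 <= s -> 0 <= c -> c + s <= 1 ->
  1 / (1 + (c + s)) <= 1 / (1 + s) - c / 4.
Proof.
move=> s0 c0 le1; rewrite -subr_ge0.
have -> : 1 / (1 + s) - c / 4 - 1 / (1 + (c + s)) =
  c * (4 - (1 + s) * (1 + (c + s))) / (4 * (1 + s) * (1 + (c + s))).
  by field; rewrite -!(rwP andP); repeat split; rewrite lt0r_neq0//; lra.
have h1 : 0 <= 1 + s by lra.
have h2 : 0 <= 1 + (c + s) by lra.
have h3 : (1 + s) * (1 + (c + s)) <= 2 * 2 by apply: ler_pM => //; lra.
by rewrite divr_ge0 ?mulr_ge0//; lra.
Qed.

(* Joint convexity of x^2/(1+a), with the gain coming from the jump of a. *)
Lemma carleson_step (x y a b c : R) : 0 <= a -> 0 <= b -> 0 <= c -> c + (a + b) / 2 <= 1 ->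
  ((x + y) / 2) ^+ 2 / (1 + (c + (a + b) / 2)) + c * ((x + y) / 2) ^+ 2 / 4
   <= (x ^+ 2 / (1 + a) + y ^+ 2 / (1 + b)) / 2.
Proof.
move=> a0 b0 c0 le1.
set s := (a + b) / 2; set u := (x + y) / 2.
have s0 : 0 <= s by rewrite /s; lra.
have cvx : u ^+ 2 / (1 + s) <= (x ^+ 2 / (1 + a) + y ^+ 2 / (1 + b)) / 2.
  rewrite -subr_ge0.
  have -> : (x ^+ 2 / (1 + a) + y ^+ 2 / (1 + b)) / 2 - u ^+ 2 / (1 + s) =
    (x * (1 + b) - y * (1 + a)) ^+ 2 / (4 * (1 + a) * (1 + b) * (1 + s)).
    rewrite /u /s; field.
    by rewrite -!(rwP andP); repeat split; rewrite lt0r_neq0//; lra.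
  by rewrite divr_ge0 ?sqr_ge0// !mulr_ge0//; lra.
apply: le_trans cvx.
have := inv_drop s0 c0 le1; have := sqr_ge0 u.
by rewrite !div1r; nra.
Qed.

Lemma carleson_ratio_ge0 (M : R) b d k : 0 < M ->
  0 <= tsum d k (fun e l => hdiff e l b ^+ 2) / M.
Proof. by move=> M0; apply: divr_ge0 (ltW M0); apply: tsum_ge0 => *; exact: sqr_ge0. Qed.

(** Bellman induction. With A the mass below the node divided by M, at most 1 by hypothesis,
    x^2/(1+A) loses c x^2/4 at a jump c of A, and the factor 4M turns this loss into the new
    summand. The subtracted term makes the induction close. *)
Lemma carleson_tree (M : R) b f d k : 0 < M ->
  allnode (fun e l => tsum e l (fun e l => hdiff e l b ^+ 2) <= M) d k ->
  tsum d k (fun e l => hdiff e l b ^+ 2 * avg e l f ^+ 2) <=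
   4 * M * (avg d k (fun x => f x ^+ 2) -
      avg d k f ^+ 2 / (1 + tsum d k (fun e l => hdiff e l b ^+ 2) / M)).
Proof.
move=> M0; elim: d k => [|d IH] k /=.
  by move=> _; rewrite mul0r addr0 invr1 mulr1 subrr mulr0.
move=> [H [/[dup] Ha /IH {}Hx /[dup] Hb /IH {IH}Hy]].
move: Hx Hy => {}/=.
set A := tsum d k.*2 _; set B := tsum d k.*2.+1 _.
set p := tsum d k.*2 _; set q := tsum d k.*2.+1 _.
move=> Hx Hy.
have p0 : 0 <= p / M by exact: carleson_ratio_ge0.
have q0 : 0 <= q / M by exact: carleson_ratio_ge0.
set D := hdiff _ _ b ^+ 2 in H *.
have D0 : 0 <= D / M by rewrite divr_ge0 ?sqr_ge0// ltW.
have e : (D + (p + q) / 2) / M = D / M + (p / M + q / M) / 2 by field; rewrite gt_eqF.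
have le1 : D / M + (p / M + q / M) / 2 <= 1 by rewrite -e ler_pdivrMr// mul1r.
have := carleson_step (avg d k.*2 f) (avg d k.*2.+1 f) p0 q0 D0 le1.
rewrite e.
set Z := _ ^+ 2 / _; set X := _ / (1 + p / M) in Hx *; set Y := _ / (1 + q / M) in Hy *.
set W := (_ / 2) ^+ 2.
move=> H4.
have DM : D = M * (D / M) by field; rewrite gt_eqF.
rewrite [in X in X <= _]DM.
set D' := D / M in H4 *.
have : M * (Z + D' * W / 4) <= M * ((X + Y) / 2) by rewrite ler_pM2l.
move: Hx Hy; clear; lra.
Qed.

Lemma carleson_tree_le (M : R) b f d k : 0 < M ->
  allnode (fun e l => tsum e l (fun e l => hdiff e l b ^+ 2) <= M) d k ->
  tsum d k (fun e l => hdiff e l b ^+ 2 * avg e l f ^+ 2) <= 4 * M * avg d k (fun x => f x ^+ 2).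
Proof.
move=> M0 H; apply: le_trans (carleson_tree f M0 H) _.
rewrite ler_pM2l ?mulr_gt0// gerBl divr_ge0 ?sqr_ge0// addr_ge0//.
exact: carleson_ratio_ge0.
Qed.

(** Unrolling [pcovS] presents this covariance as the [tsum] of the products of Haar differences of
    b and f; its own differences [pdiff] are the terms of the adjoint paraproduct. *)
Definition pcov b f d k : R := avg d k (fun x => f x * (b x - avg d k b)).

Lemma pcovE b f d k : pcov b f d k = avg d k (fun x => f x * b x) - avg d k b * avg d k f.
Proof.
rewrite /pcov (eq_avg _ _ (g := fun x => f x * b x - avg d k b * f x)); last by move=> x; ring.
by rewrite avgB avgZ.
Qed.

Lemma pcovS b f d k : pcov b f d.+1 k =
  (pcov b f d k.*2 + pcov b f d k.*2.+1) / 2 + hdiff d.+1 k b * hdiff d.+1 k f.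
Proof. by rewrite !pcovE /hdiff /=; field. Qed.

Definition pdiff b f d k : R := (pcov b f d.-1 k.*2.+1 - pcov b f d.-1 k.*2) / 2.

(** The cross term is split by AM-GM with weight a. As D^2 = 4aM, the remainder is at most 16 M E^2,
    and the term in D^2 E^2 adds 2 M E^2. If a = 0 then D = 0 and there is no cross term. *)
Lemma dual_step (M q D E w a : R) : 0 < M -> 1 <= w <= 2 -> a <= 1 / 4 -> 0 <= a ->
  D ^+ 2 = M * (4 * a) ->
  (w - a) * (q + D * E) ^+ 2 <= w * q ^+ 2 + 18 * M * E ^+ 2.
Proof.
move=> M0 /andP[w0 w2] aw a0 DM.
have E0 := sqr_ge0 E; have q0 := sqr_ge0 q.
have ME : 0 <= M * E ^+ 2 by apply: mulr_ge0 => //; exact: ltW.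
have h1 : (w - a) * (D ^+ 2 * E ^+ 2) <= 2 * M * E ^+ 2.
  rewrite DM; have -> : (w - a) * (M * (4 * a) * E ^+ 2) = ((w - a) * (4 * a)) * (M * E ^+ 2) by ring.
  by rewrite -[2 * M * _]mulrA ler_wpM2r//; nra.
have h2 : 2 * (w - a) * (q * (D * E)) <= a * q ^+ 2 + 16 * M * E ^+ 2.
  have [a00|a00] := eqVneq a 0.
    have D0 : D = 0 by apply/eqP; rewrite -sqrf_eq0 DM a00 !mulr0.
    rewrite D0 mul0r !mulr0 a00 mul0r add0r; apply: mulr_ge0 => //; lra.
  have ap : 0 < a by rewrite lt_def a00.
  have h3 : 0 <= (a * q - (w - a) * (D * E)) ^+ 2 by exact: sqr_ge0.
  have h4 : ((w - a) * (D * E)) ^+ 2 <= a * (16 * M * E ^+ 2).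
    have -> : ((w - a) * (D * E)) ^+ 2 = (w - a) ^+ 2 * (D ^+ 2 * E ^+ 2) by ring.
    rewrite DM.
    have -> : (w - a) ^+ 2 * (M * (4 * a) * E ^+ 2) = ((w - a) ^+ 2 * 4) * (a * (M * E ^+ 2)) by ring.
    have -> : a * (16 * M * E ^+ 2) = 16 * (a * (M * E ^+ 2)) by ring.
    have aME : 0 <= a * (M * E ^+ 2) by apply: mulr_ge0.
    by rewrite ler_wpM2r//; nra.
  rewrite -(ler_pM2l ap); move: h3 h4; clear; set u := (w - a) * (D * E).
  have -> : a * (2 * (w - a) * (q * (D * E))) = 2 * (a * q) * u by rewrite /u; ring.
  nra.
have -> : (w - a) * (q + D * E) ^+ 2 = (w - a) * q ^+ 2 + 2 * (w - a) * (q * (D * E))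
  + (w - a) * (D ^+ 2 * E ^+ 2) by ring.
move: h1 h2; clear; lra.
Qed.

(* The Bellman function (1 + 1/(1+A)) p^2 of the adjoint paraproduct. *)
Lemma dual_carleson_tree (M : R) b f d k : 0 < M ->
  allnode (fun e l => tsum e l (fun e l => hdiff e l b ^+ 2) <= M) d k ->
  tsum d k (fun e l => pdiff b f e l ^+ 2) +
    (1 + 1 / (1 + tsum d k (fun e l => hdiff e l b ^+ 2) / M)) * pcov b f d k ^+ 2 <=
   18 * M * tsum d k (fun e l => hdiff e l f ^+ 2).
Proof.
move=> M0; elim: d k => [|d IH] k /=.
  by move=> _; rewrite /pcov /= subrr !mulr0 expr0n /= mulr0 addr0.
move=> [H [/IH {}Hx /IH {IH}Hy]].
rewrite pcovS.
set A := tsum d k.*2 _ in Hx *; set B := tsum d k.*2.+1 _ in Hy *.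
set p := tsum d k.*2 _ in Hx H *; set q := tsum d k.*2.+1 _ in Hy H *.
set U := tsum d k.*2 _ in Hx *; set V := tsum d k.*2.+1 _ in Hy *.
have p0 : 0 <= p / M by exact: carleson_ratio_ge0.
have q0 : 0 <= q / M by exact: carleson_ratio_ge0.
rewrite /pdiff /=.
set D := hdiff _ _ b in H *; set E := hdiff _ _ f.
have D0 : 0 <= D ^+ 2 / M by rewrite divr_ge0 ?sqr_ge0// ltW.
have e : (D ^+ 2 + (p + q) / 2) / M = D ^+ 2 / M + (p / M + q / M) / 2 by field; rewrite gt_eqF.
have le1 : D ^+ 2 / M + (p / M + q / M) / 2 <= 1 by rewrite -e ler_pdivrMr// mul1r.
rewrite e.
set x := pcov b f d k.*2 in Hx *; set y := pcov b f d k.*2.+1 in Hy *.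
have z0 : (0:R) <= 0 by [].
have le1' : 0 + (p / M + q / M) / 2 <= 1 by move: D0 le1; lra.
(* Only convexity is taken from here (c = 0); the gain due to the jump of the mass enters through
   [drop]. *)
have := carleson_step x y p0 q0 z0 le1'.
rewrite add0r !mul0r addr0.
set s := (p / M + q / M) / 2 in le1 *.
have s0 : 0 <= s by rewrite /s; lra.
set c := D ^+ 2 / M in D0 le1 *.
have DM : D ^+ 2 = M * (4 * (c / 4)) by rewrite /c; field; rewrite gt_eqF.
have ws : 1 <= 1 + 1 / (1 + s) <= 2.
  have : 0 <= 1 / (1 + s) <= 1.
    by rewrite divr_ge0 ?addr_ge0//= ler_pdivrMr ?mul1r ?lerDl// ltr_pwDl.
  lra.
have cw : c / 4 <= 1 / 4 by lra.
have c4 : 0 <= c / 4 by lra.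
have := dual_step ((x + y) / 2) E M0 ws cw c4 DM.
have drop : 1 + 1 / (1 + (c + s)) <= 1 + 1 / (1 + s) - c / 4.
  by move: (inv_drop s0 D0 le1); clear; lra.
have : (1 + 1 / (1 + (c + s))) * ((x + y) / 2 + D * E) ^+ 2 <=
       (1 + 1 / (1 + s) - c / 4) * ((x + y) / 2 + D * E) ^+ 2 by rewrite ler_wpM2r// sqr_ge0.
set X1 := (1 + 1 / (1 + (c + s))) * _; set X2 := (_ - c / 4) * _.
rewrite ![(1 + 1 / _) * _]mulrDl !mul1r in Hx Hy *.
have e1 : x ^+ 2 / (1 + p / M) = (1 + p / M)^-1 * x ^+ 2 by rewrite mulrC.
have e2 : y ^+ 2 / (1 + q / M) = (1 + q / M)^-1 * y ^+ 2 by rewrite mulrC.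
have e3 : ((x + y) / 2) ^+ 2 / (1 + s) = (1 + s)^-1 * ((x + y) / 2) ^+ 2 by rewrite mulrC.
rewrite e1 e2 e3.
set X := (1 + p / M)^-1 * _ in Hx *; set Y := (1 + q / M)^-1 * _ in Hy *.
set Z := (1 + s)^-1 * _.
set E2 := E ^+ 2.
(* The summand 1 of the weight pays for the new term: the squared [pdiff] is the mean of the squares
   minus the square of the mean. *)
have -> : ((y - x) / 2) ^+ 2 = (x ^+ 2 + y ^+ 2) / 2 - ((x + y) / 2) ^+ 2 by field.
move: Hx Hy; clear; set q2 := ((x + y) / 2) ^+ 2; lra.
Qed.

(** Paraproduct decomposition: an adjoint paraproduct term, controlled by [dual_carleson_tree], plus
    a Haar difference of b times a mean of f, controlled by [carleson_tree_le]. *)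
Lemma hpair_split b f d k :
  (avg d k.*2.+1 (fun x => f x * (b x - avg d.+1 k b)) -
   avg d k.*2 (fun x => f x * (b x - avg d.+1 k b))) / 2 =
  pdiff b f d.+1 k + hdiff d.+1 k b * avg d.+1 k f.
Proof.
set m := avg d.+1 k b.
have e l : avg d l (fun x => f x * (b x - m)) = avg d l (fun x => f x * b x) - m * avg d l f.
  rewrite (eq_avg _ _ (g := fun x => f x * b x - m * f x)); last by move=> x; ring.
  by rewrite avgB avgZ.
by rewrite !e /pdiff !pcovE /m /hdiff /=; field.
Qed.

Definition hpair b f d k : R :=
  hdiff d k (fun x => f x * (b x - avg d k b)).

(** The constant is 44 = 2 (18 + 4), from the two terms of [hpair_split]. *)
Lemma hpair_tree (M : R) b f d k : 0 < M ->
  allnode (fun e l => tsum e l (fun e l => hdiff e l b ^+ 2) <= M) d k ->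
  tsum d k (fun e l => hpair b f e l ^+ 2) <= 44 * M * avg d k (fun x => f x ^+ 2).
Proof.
move=> M0 H.
(* [hpair_split] concerns positive heights; as [tsum] ignores the terms of height 0, these may be
   replaced by 0. *)
have step e l (T : nat -> nat -> R) : (forall e' l', T e'.+1 l' =
    hpair b f e'.+1 l' ^+ 2) -> tsum e l T = tsum e l (fun e l => hpair b f e l ^+ 2).
  by move=> TE; elim: e l => [//|e IH] l /=; rewrite TE !IH.
apply: (@le_trans _ _ (tsum d k (fun e l => 2 * (pdiff b f e l ^+ 2) +
   2 * (hdiff e l b ^+ 2 * avg e l f ^+ 2)))).
  rewrite -(step d k (fun e l => if e is e'.+1 then (pdiff b f e l + hdiff e l b * avg e l f) ^+ 2 else 0)).
    apply: le_tsum => -[|e] l; first by rewrite addr_ge0// mulr_ge0// -?exprMn sqr_ge0.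
    rewrite -exprMn; set u := pdiff _ _ _ _; set v := hdiff _ _ _ * _.
    by have := sqr_ge0 (u - v); nra.
  by move=> e l; rewrite /hpair /hdiff /= -hpair_split.
rewrite tsumD !tsumZ.
have h1 := carleson_tree_le f M0 H.
have h2 := dual_carleson_tree f M0 H.
have h3 : tsum d k (fun e l => pdiff b f e l ^+ 2) <= 18 * M * avg d k (fun x => f x ^+ 2).
  apply: le_trans (_ : 18 * M * tsum d k (fun e l => hdiff e l f ^+ 2) <= _).
    apply: le_trans h2; rewrite lerDl mulr_ge0 ?sqr_ge0// addr_ge0// divr_ge0// addr_ge0//.
    exact: carleson_ratio_ge0.
  by rewrite ler_pM2l ?mulr_gt0// tsum_hdiff.
move: h1 h3; clear; lra.
Qed.

(** Chosen for the thresholds 2 and 4 of the stopping argument: they contribute exp(2/16) <= 8/7 and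
    exp(4/16) <= 4/3, and 8/7 + 3 (4/3) <= 6 reproduces the exponential bound 6. *)
Definition jn_rate : R := 16^-1.

Lemma expR_quarter : expR (4^-1 : R) <= 4 / 3.
Proof.
have h : 3 / 4 <= expR (- 4^-1 : R) by apply: le_trans (expR_ge1Dx _); lra.
have := ler_wpM2l (ltW (expR_gt0 4^-1)) h; rewrite expRN mulfV ?gt_eqF ?expR_gt0//; lra.
Qed.

Lemma expR_eighth : expR (8^-1 : R) <= 8 / 7.
Proof.
have h : 7 / 8 <= expR (- 8^-1 : R) by apply: le_trans (expR_ge1Dx _); lra.
have := ler_wpM2l (ltW (expR_gt0 8^-1)) h; rewrite expRN mulfV ?gt_eqF ?expR_gt0//; lra.
Qed.

(* Stopping at the maximal descendants on which the mean of |b - a| exceeds 2. *)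
Lemma john_nirenberg_stop b (a : R) d k :
  allnode (fun e l => avg e l (fun x => expR (jn_rate * `|b x - avg e l b|)) <= 6) d k ->
  avg d k (fun x => `|b x - a|) <= 4 ->
  2 < avg d k (fun x => `|b x - a|) \/ d = 0%N ->
  avg d k (fun x => expR (jn_rate * `|b x - a|)) <=
    expR (8^-1) + expR (4^-1) * 3 * avg d k (fun x => `|b x - a|).
Proof.
set y := avg d k (fun x => `|b x - a|) => H y4 h.
have y0 : 0 <= y by apply: avg_ge0.
have [y2|y2] := ltP 2 y; last first.
  have d0 : d = 0%N by case: h => //; rewrite ltNge y2.
  apply: ler_wpDr; first by rewrite !mulr_ge0// expR_ge0.
  by move: y2; rewrite /y d0 /= ler_expR /jn_rate; lra.
have ya : `|avg d k b - a| <= 4.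
  by apply: le_trans y4; rewrite -avgBc; exact: ler_norm_avg.
apply: le_trans (_ : avg d k (fun x => expR (4^-1) * expR (jn_rate * `|b x - avg d k b|)) <= _).
  apply: le_avg => x; rewrite -expRD ler_expR.
  have := ler_distD (avg d k b) (b x) a; rewrite /jn_rate; lra.
rewrite avgZ; apply: ler_wpDl; first exact: expR_ge0.
rewrite -mulrA ler_pM2l ?expR_gt0//; have := allnodeW H; lra.
Qed.

(** The bound is affine in the mean of |b - a|, so it survives averaging over two children. A
    child's mean is at most twice its parent's: while the parent's is at most 2, the invariant 4
    persists, and beyond 2 the descent stops. *)
Lemma john_nirenberg_below b (a : R) d k :
  allnode (fun e l => avg e l (fun x => expR (jn_rate * `|b x - avg e l b|)) <= 6) d k ->
  avg d k (fun x => `|b x - a|) <= 4 ->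
  avg d k (fun x => expR (jn_rate * `|b x - a|)) <=
    expR (8^-1) + expR (4^-1) * 3 * avg d k (fun x => `|b x - a|).
Proof.
elim: d k => [|d IH] k H y4; first by apply: john_nirenberg_stop => //; right.
have [y2|y2] := ltP 2 (avg d.+1 k (fun x => `|b x - a|)).
  by apply: john_nirenberg_stop => //; left.
case: H => _ [H1 H2]; move: y2 => /= y2.
have p1 : 0 <= avg d k.*2 (fun x => `|b x - a|) by apply: avg_ge0.
have p2 : 0 <= avg d k.*2.+1 (fun x => `|b x - a|) by apply: avg_ge0.
have := IH _ H1; have := IH _ H2.
set u := avg d k.*2 _ in y2 p1 *; set v := avg d k.*2.+1 _ in y2 p2 *.
move=> h2 h1.
have {}h1 : _ := h1 ltac:(lra); have {}h2 : _ := h2 ltac:(lra).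
move: h1 h2; clear; set A := avg _ _ _; set B := avg _ _ _.
set X := expR _; set Y := expR _; nra.
Qed.

(** [john_nirenberg_below] is applied to both children with a the mean over the parent; the mean of
    |b - a| over a child is then at most 2. *)
Lemma john_nirenberg_tree b d k : allnode (fun e l => node_osc e l b) d k ->
  allnode (fun e l => avg e l (fun x => expR (jn_rate * `|b x - avg e l b|)) <= 6) d k.
Proof.
elim: d k => [|d IH] k; first by rewrite /= subrr normr0 mulr0 expR0; split => //; lra.
move=> [osc [/IH H1 /IH H2]]; split=> //.
set a := avg d.+1 k b; move: osc; rewrite /node_osc -/a /= => osc.
have p1 : 0 <= avg d k.*2 (fun x => `|b x - a|) by apply: avg_ge0.
have p2 : 0 <= avg d k.*2.+1 (fun x => `|b x - a|) by apply: avg_ge0.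
have := @john_nirenberg_below b a _ _ H1; have := @john_nirenberg_below b a _ _ H2.
set u := avg d k.*2 _ in osc p1 *; set v := avg d k.*2.+1 _ in osc p2 *.
move=> h2 h1.
have {}h1 : _ := h1 ltac:(lra); have {}h2 : _ := h2 ltac:(lra).
move: h1 h2 osc p1 p2 expR_quarter expR_eighth (expR_gt0 (4^-1 : R)); clear.
set A := avg _ _ _; set B := avg _ _ _.
set X := expR _; set Y := expR _ => h1 h2 osc p1 p2 Y1 X1 Y0.
have : Y * ((u + v) / 2) <= 4 / 3 * 1 by apply: ler_pM => //; [exact: ltW|lra].
lra.
Qed.

Lemma sqr_le_expR (a x : R) : 0 < a -> 0 <= x -> x ^+ 2 <= 4 / a ^+ 2 * expR (a * x).
Proof.
move=> a0 x0; rewrite -(ler_pM2l (x := a ^+ 2 / 4)) ?divr_gt0 ?exprn_gt0//.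
rewrite [leRHS]mulrA; have -> : a ^+ 2 / 4 * (4 / a ^+ 2) = 1 by field; rewrite gt_eqF.
rewrite mul1r.
have -> : a ^+ 2 / 4 * x ^+ 2 = (a * x / 2) ^+ 2 by field.
have -> : a * x = a * x / 2 + a * x / 2 by field.
rewrite expRD -expr2 -splitr ler_sqr ?nnegrE ?expR_ge0 ?divr_ge0 ?mulr_ge0 ?(ltW a0)//.
by apply: le_trans (expR_ge1Dx _); rewrite lerDr.
Qed.

(** The Carleson mass is a variance by [hdiff_var], and the square is dominated by 4 / [jn_rate]^2
    times the exponential, whose mean is at most 6. *)
Lemma osc_carleson b d k : allnode (fun e l => node_osc e l b) d k ->
  allnode (fun e l => tsum e l (fun e l => hdiff e l b ^+ 2) <= 24 / jn_rate ^+ 2) d k.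
Proof.
move=> /john_nirenberg_tree; apply: allnode_impl => {d k} d k /allnodeW H.
rewrite hdiff_var.
apply: le_trans (_ : avg d k (fun x => 4 / jn_rate ^+ 2 * expR (jn_rate * `|b x - avg d k b|)) <= _).
  by apply: le_avg => x; rewrite -real_normK ?num_real// sqr_le_expR// /jn_rate invr_gt0.
have -> : 24 / jn_rate ^+ 2 = 4 / jn_rate ^+ 2 * 6 by rewrite /jn_rate; field.
by rewrite avgZ ler_pM2l// divr_gt0// exprn_gt0// /jn_rate invr_gt0.
Qed.

Lemma hpair_osc b f d k : allnode (fun e l => node_osc e l b) d k ->
  tsum d k (fun e l => hpair b f e l ^+ 2) <= 44 * (24 / jn_rate ^+ 2) * avg d k (fun x => f x ^+ 2).
Proof.
move=> /osc_carleson; apply: hpair_tree.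
by rewrite divr_gt0// exprn_gt0// /jn_rate invr_gt0.
Qed.

End dyadic_tree.

(** * Dyadic rectangles over a grid of cells *)

Section dyadic_product.
Context (R : realType) (m : nat).
Local Notation node := (nat * nat)%type.
Implicit Types (f g b u : seq nat -> R) (Q : seq node) (F : seq node -> bool).

Fixpoint avN Q f : R :=
  if Q is (e, l) :: Q' then avg e l (fun c => avN Q' (fun x => f (c :: x))) else f [::].

Fixpoint hdN Q f : R :=
  if Q is (e, l) :: Q' then hdiff e l (fun c => hdN Q' (fun x => f (c :: x))) else f [::].

Fixpoint TN (N : nat) (t : seq node -> R) : R :=
  if N is N'.+1 then tsum m 0 (fun e l => TN N' (fun Q => t ((e, l) :: Q))) else t [::].

Definition EN (N : nat) f : R := avN (nseq N (m, 0%N)) f.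

Definition valid_node (p : node) : bool := (p.1 <= m)%N && (p.2 < 2 ^ (m - p.1))%N.

Definition osc_le (N : nat) (B : R) b : Prop := forall Q, size Q = N -> all valid_node Q ->
  avN Q (fun x => `|b x - avN Q b|) <= B.

(** The substitute for Fubini on the grid: a linear functional commutes with finite averages,
    differences and tree sums, so the variables can be treated in any order. *)
Definition lin (T : Type) (L : (T -> R) -> R) : Prop :=
  (forall f g : T -> R, L (fun x => f x + g x) = L f + L g) /\
  (forall a (f : T -> R), L (fun x => a * f x) = a * L f).

Lemma lin_hdiff e l : lin (@hdiff R e l).
Proof. by split=> *; rewrite /hdiff ?avgD ?avgZ; field. Qed.

Lemma avg_lin (T : Type) (L : (T -> R) -> R) d k (f : T -> nat -> R) : lin L ->
  L (fun y => avg d k (f y)) = avg d k (fun c => L (fun y => f y c)).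
Proof.
move=> [LD LZ]; elim: d k => [//|d IH] k /=; rewrite -!IH.
rewrite (_ : (fun y => _) = (fun y => 2^-1 * (avg d k.*2 (f y) + avg d k.*2.+1 (f y)))).
  by rewrite LZ LD mulrC.
by apply/funext => y; rewrite mulrC.
Qed.

Lemma hdiff_lin (T : Type) (L : (T -> R) -> R) d k (f : T -> nat -> R) : lin L ->
  L (fun y => hdiff d k (f y)) = hdiff d k (fun c => L (fun y => f y c)).
Proof.
move=> Llin; rewrite /hdiff -!avg_lin//; case: (Llin) => LD LZ.
rewrite (_ : (fun y => _) = (fun y => 2^-1 * (avg d.-1 k.*2.+1 (f y) +
   (-1) * avg d.-1 k.*2 (f y)))).
  by rewrite LZ LD LZ; ring.
by apply/funext => y; ring.
Qed.

Lemma tsum_lin (T : Type) (L : (T -> R) -> R) d k (t : T -> nat -> nat -> R) : lin L ->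
  L (fun y => tsum d k (t y)) = tsum d k (fun e l => L (fun y => t y e l)).
Proof.
move=> [LD LZ]; elim: d k => [|d IH] k /=.
  by rewrite (_ : (fun y => _) = (fun y => 0 * 0))  ?LZ ?mul0r//; apply/funext => y; rewrite mul0r.
rewrite -!IH (_ : (fun y => _) = (fun y => t y d.+1 k + 2^-1 * (tsum d k.*2 (t y) + tsum d k.*2.+1 (t y)))).
  by rewrite LD LZ LD; ring.
by apply/funext => y; ring.
Qed.

Lemma lin_avN Q : lin (avN Q).
Proof.
elim: Q => [|[e l] Q [D Z]] //=; split=> [f g|a f].
  by rewrite -avgD; apply: eq_avg => c; rewrite D.
by rewrite -avgZ; apply: eq_avg => c; rewrite Z.
Qed.

Lemma eq_hdiff e l (f g : nat -> R) : f =1 g -> hdiff e l f = hdiff e l g.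
Proof. by move=> /funext ->. Qed.

Lemma lin_hdN Q : lin (hdN Q).
Proof.
elim: Q => [|[e l] Q [D Z]] //=; split=> [f g|a f].
  have [<- _] := lin_hdiff e l; apply: eq_hdiff => c; exact: D.
have [_ <-] := lin_hdiff e l; apply: eq_hdiff => c; exact: Z.
Qed.

Lemma avN_cons e l Q f : avN ((e, l) :: Q) f = avN Q (fun x => avg e l (fun c => f (c :: x))).
Proof. by rewrite /= (avg_lin _ _ _ (lin_avN Q)). Qed.

Lemma hdN_cons e l Q f : hdN ((e, l) :: Q) f = hdN Q (fun x => hdiff e l (fun c => f (c :: x))).
Proof. by rewrite /= (hdiff_lin _ _ _ (lin_hdN Q)). Qed.

Lemma le_avN Q f g : (forall x, f x <= g x) -> avN Q f <= avN Q g.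
Proof. by elim: Q f g => [|[e l] Q IH] f g fg //=; apply: le_avg => c; exact: IH. Qed.

Lemma avN_cst Q (a : R) : avN Q (fun=> a) = a.
Proof.
elim: Q => [//|[e l] Q IH] /=; rewrite -[RHS](avg_cst e l).
by apply: eq_avg => c; exact: IH.
Qed.

Lemma avNB Q f g : avN Q (fun x => f x - g x) = avN Q f - avN Q g.
Proof.
have [D Z] := lin_avN Q; rewrite -mulN1r -Z -D; congr avN; apply/funext => x.
by rewrite mulN1r.
Qed.

Lemma ler_norm_avN Q f : `|avN Q f| <= avN Q (fun x => `|f x|).
Proof.
have [_ Z] := lin_avN Q.
rewrite ler_norml; apply/andP; split.
  by rewrite -mulN1r -Z; apply: le_avN => x; rewrite mulN1r lerNl -normrN ler_norm.
by apply: le_avN => x; exact: ler_norm.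
Qed.

Lemma le_TN N t t' : (forall Q, t Q <= t' Q) -> TN N t <= TN N t'.
Proof. elim: N t t' => [|N IH] t t' H /=. exact: H. apply: le_tsum => e l; exact: IH. Qed.

Lemma lin_TN N : lin (TN N).
Proof.
elim: N => [//|N [D Z]] /=; split=> [f g|a f].
  by rewrite -tsumD; apply: eq_tsum => e l; exact: D.
by rewrite -tsumZ; apply: eq_tsum => e l; exact: Z.
Qed.

Lemma ENS N f : EN N.+1 f = EN N (fun x => avg m 0 (fun c => f (c :: x))).
Proof. by rewrite /EN [nseq _ _]/= avN_cons. Qed.

Lemma bessel_TN N f : TN N (fun Q => hdN Q f ^+ 2) <= EN N (fun x => f x ^+ 2).
Proof.
elim: N f => [|N IH] f; first exact: lexx.
rewrite ENS.
apply: le_trans (_ : EN N (fun x => tsum m 0 (fun e l =>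
   (hdiff e l (fun c => f (c :: x))) ^+ 2)) <= _); last first.
  by apply: le_avN => x; exact: tsum_hdiff.
rewrite /EN (tsum_lin _ _ _ (lin_avN _)) /=; apply: le_tsum => e l.
apply: le_trans (IH _); apply: le_TN => Q.
by rewrite -/(hdN ((e, l) :: Q) f) hdN_cons.
Qed.

Lemma allnode_under (P : nat -> nat -> Prop) d k :
  (forall e l, (e <= d)%N -> (l %/ 2 ^ (d - e))%N = k -> P e l) -> allnode P d k.
Proof.
elim: d k => [|d IH] k H /=; first by split=> //; apply: H => //; rewrite divn1.
split; first by apply: H => //; rewrite subnn divn1.
have key e l k' : (e <= d)%N -> (l %/ 2 ^ (d - e))%N = k' -> (l %/ 2 ^ (d.+1 - e))%N = k'./2.
  by move=> ed <-; rewrite subSn// expnSr divnMA divn2.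
split; apply: IH => e l ed ek; (apply: H; first exact: leqW); rewrite (key _ _ _ ed ek).
  by rewrite doubleK.
by rewrite /= uphalf_double.
Qed.

Lemma allnode_valid (P : nat -> nat -> Prop) :
  (forall e l, valid_node (e, l) -> P e l) -> allnode P m 0.
Proof.
move=> H; apply: allnode_under => e l em le0; apply: H; rewrite /valid_node em /=.
by rewrite ltnNge -divn_gt0 ?expn_gt0// le0.
Qed.

Lemma le_avg_node d k (f g : nat -> R) :
  allnode (fun e l => e = 0%N -> f l <= g l) d k -> avg d k f <= avg d k g.
Proof.
elim: d k => [|d IH] k /=; first by case=> + _; exact.
by move=> [_ [? ?]]; rewrite ler_pM2r ?invr_gt0// lerD// IH.
Qed.

Lemma le_tsum_node d k (t t' : nat -> nat -> R) :
  allnode (fun e l => t e l <= t' e l) d k -> tsum d k t <= tsum d k t'.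
Proof.
elim: d k => [//|d IH] k /= [h [? ?]].
by rewrite lerD// ler_pM2r ?invr_gt0// lerD// IH.
Qed.

Lemma le_EN N f g : (forall x, size x = N -> all (fun c => (c < 2 ^ m)%N) x -> f x <= g x) ->
  EN N f <= EN N g.
Proof.
elim: N f g => [|N IH] f g fg; first exact: fg.
rewrite /EN /=; apply: le_avg_node; apply: allnode_valid => e l v e0.
apply: IH => x sx xv; apply: fg; first by rewrite /= sx.
by move: v; rewrite /valid_node e0 /= subn0 => ->.
Qed.

Lemma avN_cells x f : avN (map (pair 0%N) x) f = f x.
Proof. by elim: x f => [//|c x IH] f /=; rewrite IH. Qed.

(** The average over a cell is evaluation, so a node in the first variable times cells in the others
    is one of the rectangles of [osc_le]. *)
Lemma osc_fiber N b x : osc_le N.+1 1 b -> size x = N -> all (fun c => (c < 2 ^ m)%N) x ->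
  allnode (fun e l => node_osc e l (fun c => b (c :: x))) m 0.
Proof.
move=> H sx xv; apply: allnode_valid => e l v.
have E h : avN ((e, l) :: map (pair 0%N) x) h = avg e l (fun c => h (c :: x)).
  by apply: eq_avg => c; exact: avN_cells.
rewrite /node_osc -(E b) -(E (fun y => `|b y - _|)); apply: H; first by rewrite /= size_map sx.
rewrite /= v all_map; apply: sub_all xv => c cm.
by rewrite /= /valid_node /= subn0.
Qed.

Lemma osc_marginal N b e l : osc_le N.+1 1 b -> valid_node (e, l) ->
  osc_le N 1 (fun x => avg e l (fun c => b (c :: x))).
Proof.
move=> H v Q sQ vQ; rewrite -avN_cons.
apply: le_trans (_ : avN ((e, l) :: Q) (fun x => `|b x - avN ((e, l) :: Q) b|) <= _).
  rewrite [leRHS]avN_cons; apply: le_avN => x.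
  by rewrite -avgBc; exact: ler_norm_avg.
by apply: H => /=; rewrite ?sQ ?v.
Qed.

(** The factors 2 come from (p + q)^2 <= 2 p^2 + 2 q^2 in [hpair_TN]; in dimension 0 there is no
    oscillation. *)
Fixpoint pair_cst (N : nat) : R :=
  if N is N'.+1 then 2 * (44 * (24 / jn_rate R ^+ 2)) + 2 * pair_cst N' else 0.

Lemma pair_cst_ge0 N : 0 <= pair_cst N.
Proof.
elim: N => [//|N IH] /=; apply: addr_ge0; last by rewrite mulr_ge0.
by rewrite !mulr_ge0// invr_ge0 exprn_ge0// /jn_rate invr_ge0.
Qed.

(* b - m_(I x Q) b splits as (b - m_I b) + (m_I b - m_Q (m_I b)): the first term
   is one-dimensional on every fiber, the second is the claim for m_I b. *)
Lemma hpair_TN N f b : osc_le N 1 b ->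
  TN N (fun Q => hdN Q (fun x => f x * (b x - avN Q b)) ^+ 2) <= pair_cst N * EN N (fun x => f x ^+ 2).
Proof.
elim: N f b => [|N IH] f b H; first by rewrite /= subrr mulr0 expr0n /= mul0r.
set bI := fun e l x => avg e l (fun c => b (c :: x)).
set fI := fun e l x => hdiff e l (fun c => f (c :: x)).
apply: (@le_trans _ _ (tsum m 0 (fun e l => 2 * EN N (fun x => hpair (fun c => b (c :: x)) (fun c => f (c :: x)) e l ^+ 2)
    + 2 * (pair_cst N * EN N (fun x => fI e l x ^+ 2))))).
  apply: le_tsum_node; apply: allnode_valid => e l v.
  have {IH} := IH (fI e l) (bI e l) (osc_marginal H v).
  set X := _ * EN N _ => hX.
  have hB := bessel_TN N (fun x => hpair (fun c => b (c :: x)) (fun c => f (c :: x)) e l).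
  apply: le_trans (lerD (ler_wpM2l _ hB) (ler_wpM2l _ hX)); rewrite //.
  have [D Z] := lin_TN N; rewrite -!Z -D; apply: le_TN => Q.
  rewrite -/(hdN ((e, l) :: Q) _) hdN_cons.
  set p := fun x => hpair _ _ _ _; set q := fun x => fI e l x * _.
  rewrite (_ : (fun x => _) = (fun x => p x + q x)).
    have [D' _] := lin_hdN Q; rewrite D'.
    by have := sqr_ge0 (hdN Q p - hdN Q q); nra.
  apply/funext => x; rewrite /p /q /hpair /fI.
  have [D' Z'] := lin_hdiff e l; rewrite mulrC -Z' -D'; apply: eq_hdiff => c.
  rewrite /bI -avN_cons; ring.
rewrite tsumD !tsumZ [pair_cst _]/= (mulrDl (2 * _)).
have -> : tsum m 0 (fun x y => EN N (fun z => fI x y z ^+ 2)) = EN N (fun z => tsum m 0 (fun x y => fI x y z ^+ 2)).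
  by rewrite /EN (tsum_lin _ _ _ (lin_avN _)).
have -> : tsum m 0 (fun x y => EN N (fun z => hpair (fun c => b (c :: z)) (fun c => f (c :: z)) x y ^+ 2)) =
   EN N (fun z => tsum m 0 (fun x y => hpair (fun c => b (c :: z)) (fun c => f (c :: z)) x y ^+ 2)).
  by rewrite /EN (tsum_lin _ _ _ (lin_avN _)).
rewrite -!(mulrA 2) ENS; apply: lerD.
  rewrite ler_pM2l//; set C := 44 * _; have [_ Z] := lin_avN (nseq N (m, 0%N)).
  rewrite /EN -Z.
  by apply: le_EN => x sx xv; exact: hpair_osc (osc_fiber H sx xv).
rewrite ler_pM2l// ler_wpM2l ?pair_cst_ge0//.
by apply: le_avN => x; exact: tsum_hdiff.
Qed.

(** Each variable halves the rate: in [john_nirenberg_EN] the exponential of a sum of two deviations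
    is split by AM-GM, which doubles both exponents. *)
Definition jn_rateN (N : nat) : R := jn_rate R / 2 ^+ N.

Lemma jn_rateN_gt0 N : 0 < jn_rateN N.
Proof. by rewrite divr_gt0 ?exprn_gt0// /jn_rate invr_gt0. Qed.

Lemma jn_rateN_le N : jn_rateN N <= jn_rate R.
Proof.
rewrite /jn_rateN ler_pdivrMr ?exprn_gt0// ler_peMr ?exprn_ege1 ?ler1n//.
by rewrite /jn_rate invr_ge0.
Qed.

(** The deviation of b is at most its deviation from the mean a over the first variable, a
    one-dimensional matter on each fiber, plus the deviation of a, covered by induction. *)
Lemma john_nirenberg_EN N b : osc_le N 1 b ->
  EN N (fun x => expR (jn_rateN N * `|b x - EN N b|)) <= 6.
Proof.
elim: N b => [|N IH] b H; first by rewrite /EN /= subrr normr0 mulr0 expR0; lra.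
set a := fun x => avg m 0 (fun c => b (c :: x)).
have vm : valid_node (m, 0%N) by rewrite /valid_node leqnn subnn.
have {}IH := IH a (osc_marginal H vm).
have -> : EN N.+1 b = EN N a by rewrite ENS.
rewrite ENS.
set r := jn_rateN N; set r0 := jn_rate R.
apply: (@le_trans _ _ (EN N (fun x => 2^-1 * (avg m 0 (fun c => expR (r0 * `|b (c :: x) - a x|))) +
   2^-1 * expR (r * `|a x - EN N a|)))).
  apply: le_avN => x.
  rewrite -[2^-1 * expR _](avg_cst m 0) -avgZ -avgD; apply: le_avg => c.
  set A := `|b _ - a x|; set B := `|a x - _|.
  have -> : jn_rateN N.+1 = r / 2 by rewrite /r /jn_rateN exprSr invfM mulrA.
  apply: (@le_trans _ _ (expR (r0 * A / 2) * expR (r * B / 2))).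
    rewrite -expRD ler_expR.
    have h1 : r * A <= r0 * A by rewrite ler_wpM2r ?jn_rateN_le// normr_ge0.
    have h2 : `|b (c :: x) - EN N a| <= A + B by exact: ler_distD.
    have h3 : r * `|b (c :: x) - EN N a| <= r * (A + B) by rewrite ler_pM2l ?jn_rateN_gt0.
    move: h1 h3; rewrite mulrDr; lra.
  have e2 z : expR z = expR (z / 2) ^+ 2 :> R by rewrite expr2 -expRD -splitr.
  rewrite (e2 (r0 * A)) (e2 (r * B)).
  set X := expR _; set Y := expR _; have := sqr_ge0 (X - Y); nra.
have [D Z] := lin_avN (nseq N (m, 0%N)); rewrite /EN D !Z -/(EN N _) -/(EN N _).
have h : EN N (fun x => avg m 0 (fun c => expR (r0 * `|b (c :: x) - a x|))) <= 6.
  rewrite -[leRHS](avN_cst (nseq N (m, 0%N))); apply: le_EN => x sx xv.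
  by have := john_nirenberg_tree (osc_fiber H sx xv); move=> /allnodeW.
move: h IH; rewrite /EN; lra.
Qed.

Definition clip (T x : R) : R := Num.max (- T) (Num.min x T).

Lemma clip_le T x : 0 <= T -> `|clip T x| <= T.
Proof. by move=> T0; rewrite /clip ler_norml le_max lexx/= ge_max ge_min lexx orbT andbT; lra. Qed.

Lemma clip_lip T x y : `|clip T x - clip T y| <= `|x - y|.
Proof.
rewrite /clip /Num.max /Num.min; repeat case: ifPn => //; rewrite -?leNgt => *.
all: rewrite ?subrr ?normr0 //; rewrite ler_norml; apply/andP; split.
all: have := ler_norm (x - y); have := ler_norm (y - x); rewrite (distrC y x) => *; lra.
Qed.

Lemma clip_id T x : `|x| <= T -> clip T x = x.
Proof.
rewrite ler_norml => /andP[h1 h2]; rewrite /clip.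
by rewrite (min_idPl h2); apply/max_idPr.
Qed.

Lemma clip_dist T x : 0 <= T -> `|x - clip T x| <= `|x|.
Proof.
move=> T0; have : clip T 0 = 0 by apply: clip_id; rewrite normr0.
rewrite /clip /Num.max /Num.min; repeat case: ifPn => //; rewrite -?leNgt => *.
all: rewrite ?subrr ?normr0 //; rewrite ler_norml; apply/andP; split.
all: have := ler_norm x; have := ler_norm (- x); rewrite normrN => *; lra.
Qed.

(** Clipping is 1-Lipschitz, but passing from the constant [clip T a] to the mean of the clipped
    function costs a factor 2, hence the division by 2. *)
Lemma osc_clip N T b : osc_le N 1 b -> osc_le N 1 (fun x => clip T (b x) / 2).
Proof.
move=> H Q sQ vQ; apply: le_trans (H Q sQ vQ).
set a := avN Q b; set bT := fun x => clip T (b x) / 2.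
apply: (@le_trans _ _ (avN Q (fun x => `|bT x - clip T a / 2| + `|clip T a / 2 - avN Q bT|))).
  by apply: le_avN => x; exact: ler_distD.
have [D _] := lin_avN Q; rewrite D avN_cst.
have h1 : `|clip T a / 2 - avN Q bT| <= avN Q (fun x => `|bT x - clip T a / 2|).
  rewrite distrC -[X in _ - X](avN_cst Q) -avNB; exact: ler_norm_avN.
have h2 : avN Q (fun x => `|bT x - clip T a / 2|) <= 2^-1 * avN Q (fun x => `|b x - a|).
  have [_ Z] := lin_avN Q; rewrite -Z; apply: le_avN => x.
  by rewrite -mulrBl normrM mulrC [`|2^-1|]ger0_norm ?invr_ge0// ler_pM2l ?invr_gt0// clip_lip.
move: h1 h2; lra.
Qed.

End dyadic_product.

(** * The multiplier bound on the grid *)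

Section dyadic_multiplier.
Context (R : realType).

Lemma expRN_le_half (n : nat) : expR (- n%:R : R) <= 2^-1 ^+ n.
Proof.
rewrite -mulrN1 expRM_natl.
rewrite lerXn2r ?nnegrE ?expR_ge0 ?invr_ge0// expRN lef_pV2 ?posrE ?expR_gt0//.
by apply: le_trans (expR_ge1Dx _); lra.
Qed.

(** The left side vanishes unless |x| > T. Then half of the exponent r |x| absorbs the square and
    the other half is traded for exp(-rT/2). *)
Lemma clip_tail (r T K a x : R) : 0 < r -> 0 <= T -> `|a| <= K ->
  (x - clip T x) ^+ 2 <= 16 / r ^+ 2 * expR (r * K) * expR (- (r * T / 2)) * expR (r * `|x - a|).
Proof.
move=> r0 T0 aK.
have c0 : 0 <= 16 / r ^+ 2 by rewrite divr_ge0// exprn_ge0// ltW.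
have [xT|xT] := leP `|x| T.
  by rewrite clip_id// subrr expr0n; do 3!apply: mulr_ge0 (expR_ge0 _).
rewrite -!mulrA -!expRD.
apply: (@le_trans _ _ (`|x| ^+ 2)).
  by rewrite -(real_normK (num_real (x - _))) ler_sqr ?nnegrE// clip_dist.
apply: le_trans (@sqr_le_expR R (r / 2) _ _ (normr_ge0 _)) _; first by rewrite divr_gt0.
have -> : 4 / (r / 2) ^+ 2 = 16 / r ^+ 2 by field; rewrite gt_eqF.
rewrite mulrA ler_wpM2l// ler_expR.
have h : `|x| <= K + `|x - a| by have := ler_distD a x 0; rewrite !subr0; lra.
have h1 : r * `|x| <= r * (K + `|x - a|) by rewrite ler_pM2l.
have h2 : r * T <= r * `|x| by rewrite ler_pM2l// ltW.
move: h1 h2; rewrite mulrDr; lra.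
Qed.

(* Here u stands for the indicator of the union of F and 2 h for b truncated at
   height T of order k. By John-Nirenberg phi (b - 2 h) is small in L^2, the
   oscillation of 2 h over Q is taken care of by hpair_TN, and its mean over Q,
   at most T, by the decay assumed for the coefficients of phi. *)
Lemma dyadic_multiplier_bound (N : nat) (M K L : R) : 0 <= M -> 0 <= K -> 0 <= L ->
  exists2 C, 0 <= C & forall m (phi b u : seq nat -> R) (F : seq (nat * nat) -> bool) k,
    (forall x, `|phi x| <= M) -> (forall x, 0 <= u x <= 1) ->
    (forall Q f, F Q -> hdN Q (fun x => f x * u x) = hdN Q f) ->
    osc_le m N 1 b -> `|EN m N b| <= K ->
    2^-1 ^+ k.+1 <= EN m N u ->
    TN m N (fun Q => (F Q)%:R * hdN Q phi ^+ 2) <= L * EN m N u / k.+1%:R ^+ 2 ->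
    TN m N (fun Q => (F Q)%:R * hdN Q (fun x => phi x * b x) ^+ 2) <= C * EN m N u.
Proof.
move=> M0 K0 L0.
set r := jn_rateN R N; have r0 : 0 < r by exact: jn_rateN_gt0.
set S := 16 / r ^+ 2 * expR (r * K).
have S0 : 0 <= S by rewrite mulr_ge0 ?expR_ge0// divr_ge0// exprn_ge0// ltW.
(* The three summands are the truncation error, the oscillation and the mean. The factors are 3 from
   the square of a sum of three terms, and 12 = 3 (2^2) because [h] is half of the clipped
   function. *)
exists (3 * (M ^+ 2 * (S * 6)) + 12 * (pair_cst R N * M ^+ 2) + 3 * ((2 / r) ^+ 2 * L)).
  have p0 := pair_cst_ge0 R N; have M2 := sqr_ge0 M; have q2 := sqr_ge0 (2 / r).
  by rewrite !addr_ge0// mulr_ge0// mulr_ge0// mulr_ge0.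
move=> m phi b u F k phiM u01 Fu bosc bK ku FL.
set V := EN m N u in ku FL *.
have V0 : 0 <= V by apply: le_trans ku; rewrite exprn_ge0// invr_ge0.
(* With this T the factor exp(-rT/2) of [clip_tail] is exp(-(k+1)), at most 2^-(k+1), hence at most
   V. *)
set T := 2 / r * k.+1%:R.
have T0 : 0 <= T by rewrite mulr_ge0// divr_ge0// ltW.
set bT := fun x => clip T (b x).
set h := fun x => clip T (b x) / 2.
set f1 := fun x => phi x * (b x - bT x).
set f2 := fun x => phi x * u x.
have split3 Q : (F Q)%:R * hdN Q (fun x => phi x * b x) ^+ 2 <=
    3 * hdN Q f1 ^+ 2 + (12 * hdN Q (fun x => f2 x * (h x - avN Q h)) ^+ 2 +
     3 * T ^+ 2 * ((F Q)%:R * hdN Q phi ^+ 2)).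
  case FQ: (F Q); last first.
    by rewrite !mul0r mulr0 addr0 addr_ge0// mulr_ge0// sqr_ge0.
  rewrite !mul1r.
  have [D Z] := lin_hdN R Q.
  have -> : hdN Q (fun x => phi x * b x) = hdN Q f1 +
      (2 * hdN Q (fun x => f2 x * (h x - avN Q h)) + 2 * avN Q h * hdN Q phi).
    (* Inserting u costs nothing on the rectangles of F, and brings the squared L^2 norm of the
       multiplier down from M^2 to M^2 V. *)
    have -> : hdN Q (fun x => f2 x * (h x - avN Q h)) = hdN Q (fun x => phi x * (h x - avN Q h)).
      by rewrite -[RHS](Fu _ _ FQ); congr hdN; apply/funext => x; rewrite /f2; ring.
    rewrite -!Z -!D; congr hdN; apply/funext => x.
    by rewrite /f1 /h /bT; field.
  set A := hdN Q f1; set B := hdN Q (fun x => f2 x * _); set P := hdN Q phi.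
  have avT : (2 * avN Q h) ^+ 2 <= T ^+ 2.
    rewrite -(real_normK (num_real (2 * _))) ler_sqr ?nnegrE//.
    rewrite normrM ger0_norm// -ler_pdivlMl//; apply: le_trans (ler_norm_avN _ _) _.
    rewrite -[leRHS](avN_cst Q); apply: le_avN => x; rewrite /h normrM mulrC ger0_norm ?invr_ge0//.
    by rewrite ler_pM2l ?invr_gt0// clip_le.
  apply: (@le_trans _ _ (3 * A ^+ 2 + (12 * B ^+ 2 + 3 * ((2 * avN Q h) ^+ 2 * P ^+ 2)))); last first.
    rewrite !lerD2l -[leRHS]mulrA ler_pM2l// ler_wpM2r// ?sqr_ge0//.
  rewrite -exprMn; set Z' := 2 * avN Q h * P.
  have := sqr_ge0 (A - 2 * B); have := sqr_ge0 (2 * B - Z'); have := sqr_ge0 (A - Z'); nra.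
apply: le_trans (le_TN _ _ split3) _.
have [D Z] := lin_TN R m N; rewrite !D !Z.
have b1 : TN m N (fun Q => hdN Q f1 ^+ 2) <= M ^+ 2 * (S * 6) * V.
  apply: le_trans (bessel_TN m N f1) _.
  apply: (@le_trans _ _ (EN m N (fun x => (M ^+ 2 * (S * expR (- k.+1%:R))) * expR (r * `|b x - EN m N b|)))).
    apply: le_avN => x; rewrite /f1 exprMn -mulrA ler_pM ?sqr_ge0//.
      by rewrite -(real_normK (num_real (phi x))) ler_sqr ?nnegrE.
    have := clip_tail (b x) r0 T0 bK; rewrite -/S /T.
    by rewrite (_ : r * (2 / r * k.+1%:R) / 2 = k.+1%:R)//; field; rewrite gt_eqF.
  have [_ Za] := lin_avN R (nseq N (m, 0%N)); rewrite {1}/EN Za.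
  rewrite -!(mulrA (M ^+ 2)) -!(mulrA S) ler_wpM2l ?sqr_ge0// ler_wpM2l//.
  have h1 := john_nirenberg_EN bosc; have h2 := expRN_le_half k.+1.
  rewrite -/(EN m N _) [leRHS]mulrC.
  apply: ler_pM; [exact: expR_ge0| |exact: le_trans h2 ku|exact: h1].
  by rewrite -(avN_cst (nseq N (m, 0%N)) 0); apply: le_avN => x; exact: expR_ge0.
have b2 : TN m N (fun Q => hdN Q (fun x => f2 x * (h x - avN Q h)) ^+ 2) <= pair_cst R N * M ^+ 2 * V.
  apply: le_trans (hpair_TN f2 (osc_clip T bosc)) _.
  rewrite -mulrA ler_wpM2l ?pair_cst_ge0//.
  have [_ Za] := lin_avN R (nseq N (m, 0%N)); rewrite /V /EN -Za; apply: le_avN => x.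
  rewrite /f2 exprMn ler_pM ?sqr_ge0//.
    by rewrite -(real_normK (num_real (phi x))) ler_sqr ?nnegrE.
  by case/andP: (u01 x) => u0 u1; rewrite expr2 ler_piMl.
have b3 : T ^+ 2 * TN m N (fun Q => (F Q)%:R * hdN Q phi ^+ 2) <= (2 / r) ^+ 2 * L * V.
  have := ler_wpM2l (sqr_ge0 T) FL; move/le_trans; apply.
  have k0 : (k.+1%:R : R) != 0 by rewrite pnatr_eq0.
  rewrite le_eqVlt; apply/orP; left; apply/eqP; rewrite /T.
  clear -k0 r0; move: (k.+1%:R : R) k0 => x x0; field.
  by rewrite x0 gt_eqF.
rewrite -(mulrA 3 (T ^+ 2)); move: b1 b2 b3; clear.
set x := TN _ _ _; set y := TN _ _ _; set z := _ * TN _ _ _.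
set X := _ * V; set Y := _ * V; set W := _ * V => *.
have -> : (3 * (M ^+ 2 * (S * 6)) + 12 * (pair_cst R N * M ^+ 2) + 3 * ((2 / r) ^+ 2 * L)) * V
  = 3 * X + 12 * Y + 3 * W by rewrite /X /Y /W; ring.
lra.
Qed.

End dyadic_multiplier.

(** * The measure of the torus *)

Section torus.
Context (R : realType).
Local Notation U := (uniform_prob (@ltr01 R)).
Local Notation mu N := (torus_measure R N).
Local Notation rv N := (rvec R N).

Lemma torus_integralS N (F : rv N.+1 -> \bar R) : measurable_fun setT F ->
  (forall x, 0 <= F x)%E ->
  (\int[mu N.+1]_x F x = \int[U]_t \int[mu N]_y F (cons_rvec (t, y)))%E.
Proof.
move=> mF F0.
rewrite [LHS](ge0_integral_distribution (P := (U \x mu N)%E) (@cons_rvec R N))//.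
have mG : measurable_fun setT (F \o @cons_rvec R N).
  by apply: measurableT_comp => //; exact: measurable_cons_rvec.
by rewrite fubini_tonelli1; [reflexivity|exact: mG|by move=> x; exact: F0].
Qed.

Lemma measurable_torus_section N (F : rv N.+1 -> \bar R) : measurable_fun setT F ->
  (forall x, 0 <= F x)%E ->
  measurable_fun setT (fun t => \int[mu N]_y F (cons_rvec (t, y)))%E.
Proof.
move=> mF F0.
apply: (@measurable_fun_fubini_tonelli_F _ _ _ _ _ (mu N) (F \o @cons_rvec R N)); last by move=> x; exact: F0.
by apply: measurableT_comp => //; exact: measurable_cons_rvec.
Qed.

Lemma tnth_cons0 N (t : R) (y : rv N) : tnth (cons_rvec (t, y)) ord0 = t.
Proof. by rewrite (tnth_nth 0). Qed.

Lemma tnth_consS N (t : R) (y : rv N) (i : 'I_N) :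
  tnth (cons_rvec (t, y)) (lift ord0 i) = tnth y i.
Proof. by rewrite !(tnth_nth 0). Qed.

Definition box N (A : 'I_N -> set R) : set (rv N) := [set x | forall i, A i (tnth x i)].

Lemma measurable_box N (A : 'I_N -> set R) : (forall i, measurable (A i)) ->
  measurable (box A).
Proof.
move=> mA.
rewrite (_ : box A = \bigcap_(i in [set: 'I_N]) ((fun x : rv N => tnth x i) @^-1` A i)).
  apply: fin_bigcap_measurable => // i _; rewrite -[X in measurable X]setTI.
  by apply: (@measurable_tnth _ (measurableTypeR R) N i) => //; exact: mA.
by rewrite predeqE => x; split=> [H i _|H i]; exact: H.
Qed.

Lemma torus_box N (A : 'I_N -> set R) : (forall i, measurable (A i)) ->
  mu N (box A) = (\prod_(i < N) fine (U (A i)))%:E.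
Proof.
elim: N A => [|N IH] A mA.
  rewrite big_ord0 /= /dirac indicE mem_set//; by move=> [].
rewrite big_ord_recl EFinM /= /distribution /pushforward /=.
have -> : @cons_rvec R N @^-1` box A = A ord0 `*` box (fun i => A (lift ord0 i)).
  rewrite predeqE => -[t y]; split => /=.
    move=> H; split; first by have := H ord0; rewrite tnth_cons0.
    by move=> i; have := H (lift ord0 i); rewrite tnth_consS.
  move=> [H1 H2] i; case: (unliftP ord0 i) => [j ->|->]; last by rewrite tnth_cons0.
  by rewrite tnth_consS; exact: H2.
rewrite product_measure1E; [|exact: mA|exact: measurable_box].
rewrite fineK; last by apply: fin_num_measure; exact: mA.
by rewrite -IH.
Qed.

Lemma uniform_itv (a b : R) : 0 <= a -> a <= b -> b <= 1 ->
  U `[a, b[%classic = (b - a)%:E.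
Proof.
move=> a0 ab b1; rewrite /uniform_prob integral_uniform_pdf.
rewrite (_ : _ `&` _ = `[a, b[%classic); last first.
  rewrite predeqE => x; rewrite /= !in_itv /=; split=> [[]//|h]; split=> //.
  move: h; lra.
rewrite (eq_integral (fun=> 1%E)).
  rewrite integral_cst//= mul1e lebesgue_measure_itv /= lte_fin; case: ltP => // ba; congr EFin; move: ab ba; lra.
move=> x; rewrite inE /= in_itv /= /uniform_pdf subr0 invr1 => h.
by case: ifPn => // /negP []; apply/andP; move: h; lra.
Qed.

Lemma measurable_addr (s : R) : measurable_fun setT (fun x : measurableTypeR R => x + s : measurableTypeR R).
Proof. exact: measurable_funD. Qed.

(** The pushforward of Lebesgue measure by a translation is again Lebesgue measure, by uniqueness on
    half-open intervals. *)
Lemma lebesgue_integral_shift (s a b : R) (F : R -> \bar R) : measurable_fun [set: R] F ->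
  (forall x, 0 <= F x)%E ->
  (\int[@lebesgue_measure R]_(x in `[a, b[) F (x + s)%R =
   \int[@lebesgue_measure R]_(x in `[(a + s)%R, (b + s)%R[) F x)%E.
Proof.
move=> mF F0.
pose f : {mfun measurableTypeR R >-> measurableTypeR R} :=
  HB.pack (fun x : measurableTypeR R => x + s : measurableTypeR R)
   (isMeasurableFun.Build _ _ _ _ _ (measurable_addr s)).
have fE c d : f @^-1` `[(c + s)%R, (d + s)%R[ = `[c, d[%classic.
  by rewrite predeqE => x /=; rewrite !in_itv /= lerD2r ltrD2r.
transitivity (\int[pushforward (@lebesgue_measure R) f]_(x in `[(a + s)%R, (b + s)%R[) F x)%E.
  rewrite ge0_integral_pushforward ?fE//.
  exact: measurable_funS mF.
apply: eq_measure_integral => //= A mA AS.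
apply/esym/lebesgue_measure_unique => //=; first exact: measurable_addr.
move=> _ _ [[c d]] _ <-.
rewrite /pushforward.
have -> : +%R^~ s @^-1` `]c, d] = `](c - s)%R, (d - s)%R]%classic.
  by rewrite predeqE => x /=; rewrite !in_itv /= ltrBlDr lerBrDr.
rewrite !lebesgue_measure_itv /= !lte_fin ltrD2r; case: ifP => // _.
by rewrite -!EFinD; congr EFin; ring.
Qed.

Lemma lebesgue_integral_split (a b c : R) (F : R -> \bar R) : measurable_fun [set: R] F ->
  (forall x, 0 <= F x)%E -> a <= b -> b <= c ->
  (\int[@lebesgue_measure R]_(x in `[a, c[) F x =
   \int[@lebesgue_measure R]_(x in `[a, b[) F x + \int[@lebesgue_measure R]_(x in `[b, c[) F x)%E.
Proof.
move=> mF F0 ab bc; rewrite -ge0_integral_setU//.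
- congr (integral _ _ _); rewrite predeqE => x /=; rewrite !in_itv /=; split.
    by move=> /andP[ax xc]; have [xb|xb] := ltP x b; [left|right]; rewrite ?ax ?xb.
  by move=> [/andP[ax xb]|/andP[bx xc]]; rewrite ?ax ?xc ?(lt_le_trans xb) ?(le_trans _ bx).
- exact: measurable_funS mF.
- apply/disj_setPS => x /= [] /=; rewrite !in_itv /= => /andP[_ xb] /andP[bx _].
  by move: xb; rewrite ltNge bx.
Qed.

Lemma uniform_integral (F : R -> \bar R) : measurable_fun [set: R] F ->
  (forall x, 0 <= F x)%E ->
  (\int[U]_x F x = \int[@lebesgue_measure R]_(x in `[0%R, 1%R[) F x)%E.
Proof.
move=> mF F0; rewrite integral_uniform// subr0 invr1 mul1e.
rewrite -integral_itv_bndo_bndc//; exact: measurable_funS mF.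
Qed.

(** Only the fractional part [th] of the shift matters. The window [th, 1 + th) is cut at 1, and the
    piece beyond 1 is moved back by periodicity. *)
Lemma uniform_integral_shift (a : R) (F : R -> \bar R) : measurable_fun [set: R] F ->
  (forall x, 0 <= F x)%E -> (forall x (k : int), F (x + k%:~R) = F x) ->
  (\int[U]_x F (x + a)%R = \int[U]_x F x)%E.
Proof.
move=> mF F0 Fper.
pose th := a - (Num.floor a)%:~R.
have th0 : 0 <= th by rewrite subr_ge0 floor_le_tmp.
have th1 : th <= 1 by have := lt_succ_floor a; rewrite /th intrD; lra.
have -> : (fun x => F (x + a)) = (fun x => F (x + th)).
  by apply/funext => x; rewrite -[in RHS](Fper _ (Num.floor a)) /th addrA subrK.
have mG : measurable_fun [set: R] (fun x => F (x + th)).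
  exact: (measurableT_comp mF (measurable_addr th)).
rewrite !uniform_integral// lebesgue_integral_shift// add0r.
rewrite (@lebesgue_integral_split th 1)//; last by rewrite lerDl.
rewrite [in RHS](@lebesgue_integral_split 0 th)// addeC; congr (_ + _)%E.
rewrite -{1}[1]add0r [1 + th]addrC -lebesgue_integral_shift//.
by apply: eq_integral => x _; rewrite (Fper x 1).
Qed.

Lemma shift_cons N (a : rv N.+1) (t : R) (y : rv N) :
  Defs.shift a (cons_rvec (t, y)) = cons_rvec (t + thead a, Defs.shift [tuple of behead a] y).
Proof.
apply: eq_from_tnth => i; rewrite tnth_mktuple.
case: (unliftP ord0 i) => [j ->|->]; last by rewrite !tnth_cons0.
rewrite !tnth_consS tnth_mktuple tnth_behead; congr (_ + tnth a _).
by apply: val_inj; rewrite /= inordK ?ltnS.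
Qed.

Definition zperiodic N (T : Type) (F : rv N -> T) : Prop :=
  forall (k : N.-tuple int) x, F (Defs.shift (int_rvec R k) x) = F x.

Lemma measurable_shift N (a : rv N) : measurable_fun [set: rv N] (Defs.shift a : rv N -> rv N).
Proof.
apply/measurable_fun_tnthP => i.
rewrite (_ : _ \o _ = (fun x : rv N => tnth x i + tnth a i)).
  exact: (measurableT_comp (measurable_addr (tnth a i)) (measurable_tnth i)).
by apply/funext => x /=; rewrite tnth_mktuple.
Qed.

Lemma torus_integral_shift N (a : rv N) (F : rv N -> \bar R) : measurable_fun setT F ->
  (forall x, 0 <= F x)%E -> zperiodic F ->
  (\int[mu N]_x F (Defs.shift a x) = \int[mu N]_x F x)%E.
Proof.
elim: N a F => [|N IH] a F mF F0 Fper.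
  by apply: eq_integral => x _; rewrite [Defs.shift a x]tuple0 [x]tuple0.
have mS : measurable_fun setT (fun x => F (Defs.shift a x)).
  by apply: measurableT_comp => //; exact: measurable_shift.
rewrite torus_integralS// torus_integralS//.
(* The integer vector (k, 0, ..., 0) isolates periodicity in the first coordinate. *)
have perS (t : R) (k : int) (y : rv N) : F (cons_rvec (t + k%:~R, y)) = F (cons_rvec (t, y)).
  rewrite -[in RHS](Fper [tuple of k :: nseq N 0%Z]) shift_cons; congr (F (cons_rvec (_, _))).
    by rewrite /thead tnth_mktuple.
  apply: eq_from_tnth => i; rewrite tnth_mktuple tnth_behead tnth_mktuple.
  by rewrite (tnth_nth 0%Z) inordK ?ltnS//= nth_nseq ltn_ord addr0.
transitivity (\int[U]_t \int[mu N]_y F (cons_rvec ((t + thead a)%R, y)))%E.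
  apply: eq_integral => t _.
  under eq_integral do rewrite shift_cons.
  apply: (IH [tuple of behead a] (fun y => F (cons_rvec (t + thead a, y)))) => //.
    apply: (measurableT_comp mF (f := F) (g := fun y => cons_rvec (t + thead a, y))).
    by apply: measurable_cons; [exact: measurable_cst|exact: measurable_id].
  move=> k y; rewrite -[in RHS](Fper [tuple of 0%Z :: k]) shift_cons; congr (F (cons_rvec (_, _))).
    by rewrite /thead tnth_mktuple (tnth_nth 0%Z) /= addr0.
  apply: eq_from_tnth => i; rewrite !tnth_mktuple tnth_behead tnth_mktuple.
  by rewrite [in RHS](tnth_nth 0%Z) inordK ?ltnS//= (tnth_nth 0%Z).
apply: (uniform_integral_shift (thead a) (F := fun t => \int[mu N]_y F (cons_rvec (t, y)))%E).
- exact: measurable_torus_section.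
- by move=> t; apply: integral_ge0.
- by move=> t k; apply: eq_integral => y _; rewrite perS.
Qed.

End torus.

(** * Discretization *)

Section cells.
Context (R : realType).
Local Notation node := (nat * nat)%type.
Local Notation mu N := (torus_measure R N).

Lemma avN_lin (T : Type) (L : (T -> R) -> R) (Q : seq node) (f : T -> seq nat -> R) : lin L ->
  L (fun y => avN Q (f y)) = avN Q (fun c => L (fun y => f y c)).
Proof.
move=> Llin; elim: Q f => [//|[e l] Q IH] f /=.
by rewrite (avg_lin _ _ _ Llin); apply: eq_avg => c; rewrite IH.
Qed.

Lemma hdN_lin (T : Type) (L : (T -> R) -> R) (Q : seq node) (f : T -> seq nat -> R) : lin L ->
  L (fun y => hdN Q (f y)) = hdN Q (fun c => L (fun y => f y c)).
Proof.
move=> Llin; elim: Q f => [//|[e l] Q IH] f /=.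
by rewrite (hdiff_lin _ _ _ Llin); apply: eq_hdiff => c; rewrite IH.
Qed.

(* The minimum only matters outside [0, 1), where it keeps idx finite-valued. *)
Definition idx (m : nat) (t : R) : nat := minn (Num.truncn (2 ^+ m * t)) (2 ^ m).

Definition cidx (m N : nat) (x : rvec R N) : seq nat := [seq idx m t | t <- x].

Lemma le_idx m n t : (n.+1 <= idx m t)%N = (n.+1 <= 2 ^ m)%N && (n.+1%:R <= 2 ^+ m * t).
Proof. by rewrite /idx leq_min truncn_gt_nat andbC. Qed.

Lemma measurable_idx m n : measurable [set t : R | (n <= idx m t)%N].
Proof.
case: n => [|n]; first by rewrite (_ : [set _ | _] = setT)// predeqE.
under eq_set do rewrite le_idx.
have [h|h] /= := boolP (n.+1 <= 2 ^ m)%N; last first.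
  by rewrite (_ : [set _ | _] = set0)// predeqE.
rewrite (_ : [set _ | _] = `[(n.+1%:R / 2 ^+ m : R), +oo[%classic); first exact: measurable_itv.
by rewrite predeqE => t /=; rewrite in_itv /= andbT ler_pdivrMr ?exprn_gt0// mulrC.
Qed.

Lemma measurable_idx1 m n : measurable [set t : R | idx m t = n].
Proof.
rewrite (_ : [set _ | _] = [set t : R | (n <= idx m t)%N] `\` [set t | (n.+1 <= idx m t)%N]).
  by apply: measurableD; exact: measurable_idx.
rewrite predeqE => t /=; split=> [->|[h1 /negP h2]]; first by rewrite ltnn leqnn.
by apply/eqP; rewrite eqn_leq h1 andbT leqNgt.
Qed.

Lemma idx_lt m t : 0 <= t < 1 -> (idx m t < 2 ^ m)%N.
Proof.
move=> /andP[t0 t1]; rewrite /idx gtn_min truncn_lt_nat ?mulr_ge0 ?exprn_ge0//.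
by rewrite natrX gtr_pMr ?exprn_gt0// t1.
Qed.

Lemma idx_div m d k t : 0 <= t < 1 -> (d <= m)%N ->
  (idx m t %/ 2 ^ d == k)%N = (k%:R * 2^-1 ^+ (m - d) <= t < k.+1%:R * 2^-1 ^+ (m - d)).
Proof.
move=> t01 dm; have /andP[t0 t1] := t01.
have pt : 0 <= 2 ^+ m * t by rewrite mulr_ge0 ?exprn_ge0.
have -> : idx m t = Num.truncn (2 ^+ m * t).
  apply/minn_idPl/ltnW; rewrite truncn_lt_nat// natrX gtr_pMr ?exprn_gt0//.
have e (n : nat) : (n%:R * 2^-1 ^+ (m - d) <= t) = ((n * 2 ^ d)%:R <= 2 ^+ m * t).
  rewrite -(ler_pM2l (x := 2 ^+ m)) ?exprn_gt0//; congr (_ <= _).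
  rewrite natrM natrX -{1}(subnK dm) exprD exprVn.
  by rewrite [RHS]mulrC mulrAC [n%:R * _]mulrC mulrA mulfV ?mul1r 1?mulrC// expf_neq0.
rewrite eqn_leq leq_divRL ?expn_gt0// -ltnS ltn_divLR ?expn_gt0// andbC.
have e' (n : nat) : (t < n%:R * 2^-1 ^+ (m - d)) = (2 ^+ m * t < (n * 2 ^ d)%:R).
  by rewrite !ltNge e.
by rewrite truncn_ge_nat// truncn_lt_nat// e e'.
Qed.

Lemma size_cidx m N (x : rvec R N) : size (cidx m x) = N.
Proof. by rewrite size_map size_tuple. Qed.

Definition cube N : set (rvec R N) := box (fun=> `[0, 1[%classic).

Arguments cube N : clear implicits.

Lemma measurable_cube N : measurable (cube N).
Proof. by apply: measurable_box => i; exact: measurable_itv. Qed.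

Lemma torus_cube N : mu N (cube N) = 1%E.
Proof.
rewrite torus_box; last by move=> i; exact: measurable_itv.
by rewrite big1// => i _; rewrite uniform_itv// subr0.
Qed.

Lemma torus_cubeC N : mu N (~` cube N) = 0%E.
Proof.
by rewrite probability_setC ?torus_cube ?subee//; exact: measurable_cube.
Qed.

(** Dyadic objects live in the unit cube and periodic ones on all of R^N; the complement of the cube
    being null, they are compared on the cube alone. *)
Lemma torus_eq_integral N (f g : rvec R N -> \bar R) :
  measurable_fun setT f -> measurable_fun setT g ->
  (forall x, cube N x -> f x = g x) -> (\int[mu N]_x f x = \int[mu N]_x g x)%E.
Proof.
move=> mf mg fg; apply: ae_eq_integral => //.
exists (~` cube N); split; [|exact: torus_cubeC|].
  by apply: measurableC; exact: measurable_cube.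
by move=> x /= h Cx; apply: h => _; exact: fg.
Qed.

Lemma cidx_nth m N (x : rvec R N) (i : 'I_N) : nth 0%N (cidx m x) i = idx m (tnth x i).
Proof. by rewrite (nth_map 0) ?size_tuple// -tnth_nth. Qed.

Lemma measurable_cell m N (c : seq nat) : measurable [set x : rvec R N | cidx m x = c].
Proof.
have [sc|sc] := eqVneq (size c) N; last first.
  rewrite (_ : [set _ | _] = set0)// predeqE => x; split=> //= h.
  by move: sc; rewrite -h size_cidx eqxx.
rewrite (_ : [set _ | _] = box (fun i : 'I_N => [set t | idx m t = nth 0%N c i])).
  by apply: measurable_box => i; exact: measurable_idx1.
rewrite predeqE => x; split=> [<- i /=|h]; first by rewrite cidx_nth.
apply: (@eq_from_nth _ 0%N); rewrite size_cidx// => i iN.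
by rewrite (cidx_nth m x (Ordinal iN)); exact: h.
Qed.

Lemma countable_seqnat : countable [set: seq nat].
Proof. exact: countableP. Qed.

Lemma measurable_cidx m N (h : seq nat -> R) :
  measurable_fun [set: rvec R N] (fun x => h (cidx m x)).
Proof.
move=> _ B mB; rewrite setTI.
rewrite (_ : _ @^-1` B = \bigcup_(c in [set: seq nat]) (if h c \in B then [set x : rvec R N | cidx m x = c] else set0)).
  apply: countable_bigcupT_measurable; first exact: countable_seqnat.
  by move=> c; case: ifP => // _; exact: measurable_cell.
rewrite predeqE => x; split => /=.
  by move=> Bx; exists (cidx m x) => //; rewrite mem_set.
by move=> [c _]; case: ifP => [hB /= xc|//]; rewrite xc; exact: set_mem hB.
Qed.

Lemma bounded_cidx m N (h : seq nat -> R) :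
  exists M, forall x : rvec R N, `|h (cidx m x)| <= M.
Proof.
elim: N h => [|N IH] h.
  by exists `|h [::]| => x; rewrite [x]tuple0.
have [F FP] := choice (fun c => IH (fun s => h (c :: s))).
exists (\big[Num.max/0]_(i < (2 ^ m).+1) F i) => x.
case/tupleP: x => t y; have -> : cidx m [tuple of t :: y] = idx m t :: cidx m y by [].
apply: le_trans (FP _ _) _.
have lt : (idx m t < (2 ^ m).+1)%N by rewrite ltnS geq_minr.
exact: (le_bigmax_cond 0 (fun i : 'I_(2 ^ m).+1 => F i) (j := Ordinal lt)).
Qed.

End cells.
Arguments cube R N : clear implicits.

(** * Averages and Haar differences of point masses *)

Section point_functions.
Context (R : realType).
Local Notation node := (nat * nat)%type.

Lemma half_eq (b k : nat) : (b./2 == k)%:R = (b == k.*2)%:R + (b == k.*2.+1)%:R :> R.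
Proof.
rewrite -natrD; congr _%:R; rewrite -(odd_double_half b).
case: (odd b); rewrite /= ?add1n ?add0n.
  rewrite uphalf_double eqSS (inj_eq double_inj) (_ : (_.*2.+1 == k.*2) = false) ?add0n//.
  by apply/negbTE/eqP => /(congr1 odd); rewrite /= !odd_double.
rewrite doubleK (inj_eq double_inj) (_ : (_ == k.*2.+1) = false) ?addn0//.
by apply/negbTE/eqP => /(congr1 odd); rewrite /= !odd_double.
Qed.

Lemma avg_point d k (a : nat) : avg d k (fun c => (a == c)%:R) =
  2^-1 ^+ d * (a %/ 2 ^ d == k)%N%:R :> R.
Proof.
elim: d k => [|d IH] k /=; first by rewrite expr0 mul1r divn1.
have e : (a %/ 2 ^ d.+1 == k)%N%:R = (a %/ 2 ^ d == k.*2)%N%:R + (a %/ 2 ^ d == k.*2.+1)%N%:R :> R; last first.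
  by rewrite !IH e exprSr; ring.
by rewrite expnSr divnMA divn2 half_eq.
Qed.

Fixpoint inN (Q : seq node) (c : seq nat) : bool :=
  match Q, c with
  | (d, k) :: Q', a :: c' => (a %/ 2 ^ d == k)%N && inN Q' c'
  | [::], [::] => true
  | _, _ => false
  end.

Definition wN (Q : seq node) : R := \prod_(p <- Q) 2^-1 ^+ p.1.

Lemma avN_point Q c : avN Q (fun c' => (c == c')%:R) = wN Q * (inN Q c)%:R :> R.
Proof.
rewrite /wN; elim: Q c => [|[d k] Q IH] [|a c] /=; rewrite ?big_nil ?mul1r// ?big_cons.
  rewrite mulr0 (eq_avg _ _ (g := fun=> 0)) ?avg_cst// => b.
  by rewrite -[RHS](avN_cst Q); congr avN; apply/funext.
rewrite (eq_avg _ _ (g := fun b => (wN Q * (inN Q c)%:R) * (a == b)%:R)).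
  by rewrite avgZ avg_point -mulnb natrM /wN; ring.
move=> b; rewrite -IH mulrC -(lin_avN R Q).2; congr avN; apply/funext => s.
by rewrite eqseq_cons -mulnb natrM.
Qed.

(** Reproducing formula. Moving a linear functional inside the average turns a pairing with a step
    function into a finite average, as in [Lam_EN]. *)
Lemma EN_point m N (h : seq nat -> R) c : size c = N -> all (fun a => (a < 2 ^ m)%N) c ->
  EN m N (fun c' => 2 ^+ (m * N) * (c == c')%:R * h c') = h c.
Proof.
move=> sc ac; rewrite /EN.
have [_ Z] := lin_avN R (nseq N (m, 0%N)).
rewrite (_ : (fun c' => _) = (fun c' => (2 ^+ (m * N) * h c) * (c == c')%:R)); last first.
  by apply/funext => c'; case: eqP => [->|_]; rewrite ?mulr1 ?mulr0 ?mul0r.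
rewrite Z avN_point /wN big_nseq iter_mulr_1 /=.
rewrite -exprM exprVn (_ : inN _ _); last first.
  elim: N {Z} c sc ac => [|N IH] [|a c] //= [sc] /andP[am ac].
  by rewrite divn_small//= IH.
rewrite mulr1 mulrAC mulfV ?mul1r// expf_neq0//.
Qed.

Fixpoint sgnN (Q : seq node) (c : seq nat) : R :=
  match Q, c with
  | (d, k) :: Q', a :: c' =>
     ((a %/ 2 ^ d.-1 == k.*2.+1)%N%:R - (a %/ 2 ^ d.-1 == k.*2)%N%:R) * sgnN Q' c'
  | [::], [::] => 1
  | _, _ => 0
  end.

Lemma hdiff_point d k (a : nat) : (0 < d)%N -> hdiff d k (fun c => (a == c)%:R) =
  2^-1 ^+ d * ((a %/ 2 ^ d.-1 == k.*2.+1)%N%:R - (a %/ 2 ^ d.-1 == k.*2)%N%:R) :> R.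
Proof. by case: d => // d _; rewrite /hdiff !avg_point exprSr /=; ring. Qed.

Lemma hdN_point Q c : all (fun p => (0 < p.1)%N) Q ->
  hdN Q (fun c' => (c == c')%:R) = wN Q * sgnN Q c :> R.
Proof.
rewrite /wN; elim: Q c => [|[d k] Q IH] [|a c] /=; rewrite ?big_nil ?mul1r// ?big_cons.
  move=> _; rewrite mulr0 (eq_hdiff _ _ (g := fun=> 0)) ?/hdiff ?avg_cst ?subrr ?mul0r// => b.
  have [_ Z] := lin_hdN R Q.
  by rewrite -[RHS](mul0r (hdN Q (fun=> 0))) -Z; congr hdN; apply/funext => s; rewrite mul0r.
move=> /andP[d0 Q0].
rewrite (eq_hdiff _ _ (g := fun b => (wN Q * sgnN Q c) * (a == b)%:R)).
  by rewrite (lin_hdiff R d k).2 hdiff_point// /wN; ring.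
move=> b; rewrite -IH// mulrC -(lin_hdN R Q).2; congr hdN; apply/funext => s.
by rewrite eqseq_cons -mulnb natrM.
Qed.

End point_functions.

Section discretization.
Context (R : realType) (N : nat).
Local Notation node := (nat * nat)%type.
Local Notation mu := (torus_measure R N).
Local Notation rv := (rvec R N).
Implicit Types (g f : rv -> R) (h : seq nat -> R) (Q : dyadic_rect N).

Definition intg g : Prop := mu.-integrable setT (EFin \o g).

Lemma intg_measurable g : intg g -> measurable_fun setT g.
Proof. by move=> /integrableP[/measurable_EFinP]. Qed.

Lemma bounded_funP g : (exists M, forall x, `|g x| <= M) -> [bounded g x | x in setT].
Proof.
move=> [M gM]; exists M; split; first exact: num_real.
by move=> y My x _ /=; apply: le_trans (gM x) (ltW My).
Qed.

Lemma intg_bounded g : measurable_fun setT g -> (exists M, forall x, `|g x| <= M) -> intg g.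
Proof.
move=> mg bg; apply: measurable_bounded_integrable => //.
  by apply: (le_lt_trans (probability_le1 mu measurableT)); exact: ltry.
exact: bounded_funP.
Qed.

Lemma intgM g f : intg g -> measurable_fun setT f -> (exists M, forall x, `|f x| <= M) ->
  intg (fun x => g x * f x).
Proof. by move=> ig mf bf; apply: (integrableMl measurableT ig mf (bounded_funP bf)). Qed.

Lemma intgZ (a : R) g : intg g -> intg (fun x => a * g x).
Proof. by move=> ig; apply: (integrableZl measurableT a ig). Qed.

Lemma intgD g f : intg g -> intg f -> intg (fun x => g x + f x).
Proof. by move=> ig ih; apply: (integrableD measurableT ig ih). Qed.

Lemma intgB g f : intg g -> intg f -> intg (fun x => g x - f x).
Proof. by move=> ig ih; apply: (integrableB measurableT ig ih). Qed.

Lemma intg_cst (a : R) : intg (fun=> a).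
Proof. by apply: intg_bounded => //; exists `|a|. Qed.

Lemma intg_norm g : intg g -> intg (fun x => `|g x|).
Proof. by move=> ig; apply: (integrable_norm ig). Qed.

Lemma RintegralE g : intg g -> (\int[mu]_x g x)%:E = (\int[mu]_x (g x)%:E)%E.
Proof. by move=> ig; rewrite /Rintegral fineK//; apply: (integrable_fin_num measurableT ig). Qed.

Lemma eq_cube g f : measurable_fun setT g -> measurable_fun setT f ->
  (forall x, cube R N x -> g x = f x) -> \int[mu]_x g x = \int[mu]_x f x.
Proof.
move=> mg mf gf; congr fine; apply: torus_eq_integral => [||x /gf ->//].
- exact/measurable_EFinP.
- exact/measurable_EFinP.
Qed.

Lemma le_cube g f : intg g -> intg f ->
  (forall x, cube R N x -> g x <= f x) -> \int[mu]_x g x <= \int[mu]_x f x.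
Proof.
move=> ig jf gf.
have mI : measurable_fun setT (\1_(cube R N) : rv -> R) by apply: measurable_indic; exact: measurable_cube.
have bI : exists M : R, forall x, `|\1_(cube R N) x : R| <= M.
  by exists 1 => x; rewrite indicE; case: (_ \in _); rewrite ?normr1 ?normr0.
rewrite (@eq_cube g (fun x => g x * \1_(cube R N) x)); first last.
- by move=> x Cx; rewrite indicE mem_set// mulr1.
- exact: intg_measurable (intgM ig mI bI).
- exact: intg_measurable.
rewrite (@eq_cube f (fun x => f x * \1_(cube R N) x)); first last.
- by move=> x Cx; rewrite indicE mem_set// mulr1.
- exact: intg_measurable (intgM jf mI bI).
- exact: intg_measurable.
apply: le_Rintegral => //; [exact: intgM|exact: intgM|move=> x _].
rewrite indicE; case: (boolP (x \in cube R N)) => [|_]; rewrite ?mulr0// !mulr1.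
by move=> /set_mem; exact: gf.
Qed.

Definition Lam (m : nat) g h : R := \int[mu]_x (g x * h (cidx m x)).

Lemma intg_cidx m g h : intg g -> intg (fun x => g x * h (cidx m x)).
Proof. by move=> ig; apply: intgM => //; [exact: measurable_cidx|exact: bounded_cidx]. Qed.

Lemma lin_Lam m g : intg g -> lin (Lam m g).
Proof.
move=> ig; split=> [f h|a f]; rewrite /Lam.
  rewrite -RintegralD//; [|exact: intg_cidx|exact: intg_cidx].
  by apply: eq_Rintegral => x _; rewrite mulrDr.
rewrite -RintegralZl//; last exact: intg_cidx.
by apply: eq_Rintegral => x _; rewrite mulrCA.
Qed.

(* On the unit cube disc m g (cidx m x) is the mean of g over the cell of x. *)
Definition disc (m : nat) g (c : seq nat) : R := 2 ^+ (m * N) * Lam m g (fun c' => (c' == c)%:R).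

(* Nodes are indexed by height above the cells of side 2^-m, dyadic intervals by
   level, whence the complement m - tag I. *)
Definition nodes (m : nat) Q : seq node := map (fun I : dyadic => ((m - tag I)%N, nat_of_ord (tagged I))) Q.

(** Strict, because the cells must resolve the halves on which Haar functions are constant; for
    means, [level_le] is enough. *)
Definition level_lt (m : nat) Q : bool := all (fun I : dyadic => (tag I < m)%N) Q.

Definition level_le (m : nat) Q : bool := all (fun I : dyadic => (tag I <= m)%N) Q.

(** A conditional expectation lets factors that are constant on cells out; applied to h =
    [disc m phi], this makes a product of two discretizations a discretization. *)
Lemma disc_cidxM m g h c : intg g -> disc m (fun x => g x * h (cidx m x)) c = h c * disc m g c.
Proof.
move=> ig; rewrite /disc mulrCA; congr (_ * _).
have [_ <-] := lin_Lam m ig; apply: eq_Rintegral => x _ /=.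
by rewrite -mulrA; congr (_ * _); case: eqP => [->|_]; rewrite ?mulr0.
Qed.

Lemma cidx_lt m (x : rv) : cube R N x -> all (fun a => (a < 2 ^ m)%N) (cidx m x).
Proof.
move=> Cx; apply/(all_nthP 0%N) => i; rewrite size_cidx => iN.
by rewrite (cidx_nth m x (Ordinal iN)) idx_lt//; have := Cx (Ordinal iN); rewrite /= in_itv.
Qed.

Lemma Lam_EN m g h : intg g -> Lam m g h = EN m N (fun c => disc m g c * h c).
Proof.
move=> ig; have L := lin_Lam m ig.
rewrite /EN (_ : (fun c => disc m g c * h c) =
   (fun c => Lam m g (fun c' => 2 ^+ (m * N) * (c' == c)%:R * h c))).
  rewrite -(avN_lin _ _ L) /Lam; apply: eq_cube.
  - exact: intg_measurable (intg_cidx m h ig).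
  - exact: intg_measurable (intg_cidx m (fun c' => avN _ (fun c => 2 ^+ (m * N) * (c' == c)%:R * h c)) ig).
  by move=> x Cx; congr (_ * _); rewrite -[LHS](@EN_point R m N) ?size_cidx ?cidx_lt.
apply/funext => c; have [_ Z] := L; rewrite /disc -Z mulrC -Z.
by congr Lam; apply/funext => c'; ring.
Qed.

Definition hscale Q : R := \prod_(I <- Q) Num.sqrt (dlen R I).

Definition rvol Q : R := \prod_(I <- Q) dlen R I.

Lemma dlen_gt0 (I : dyadic) : 0 < dlen R I.
Proof. by rewrite /dlen exprn_gt0// invr_gt0. Qed.

Lemma rvol_gt0 Q : 0 < rvol Q.
Proof. by apply: prodr_gt0 => I _; exact: dlen_gt0. Qed.

Lemma hscale_sqr Q : hscale Q ^+ 2 = rvol Q.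
Proof.
rewrite -prodrXl; apply: eq_bigr => I _.
by rewrite sqr_sqrtr// ltW// dlen_gt0.
Qed.

Lemma haar1_cell m (I : dyadic) (t : R) : 0 <= t < 1 -> (tag I < m)%N ->
  haar1 I t = Num.sqrt (dlen R I) * (2 ^+ m * (2^-1 ^+ (m - tag I) *
    ((idx m t %/ 2 ^ (m - tag I).-1 == (tagged I).*2.+1)%N%:R -
     (idx m t %/ 2 ^ (m - tag I).-1 == (tagged I).*2)%N%:R))).
Proof.
case: I => j k /= t01 jm.
rewrite /haar1 /dmid /dright /dleft /dlen /=.
move: (nat_of_ord k) => {}k; rewrite !indicE !mem_setE !in_itv /=.
have d1 : (m - j).-1 = (m - j.+1)%N by rewrite subnS.
rewrite !d1 !idx_div ?leq_subr// subKn//.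
have s0 : 0 < 2^-1 ^+ j :> R by rewrite exprn_gt0// invr_gt0.
have -> : (Num.sqrt (2^-1 ^+ j))^-1 = Num.sqrt (2^-1 ^+ j) * 2 ^+ j :> R.
  have q0 : Num.sqrt (2^-1 ^+ j) != 0 :> R by rewrite gt_eqF// sqrtr_gt0.
  apply: (mulfI q0); rewrite mulfV// mulrA -expr2 sqr_sqrtr ?ltW//.
  by rewrite exprVn mulVf// expf_neq0.
rewrite -mulrA; congr (_ * _).
rewrite mulrA; congr (_ * (_ - _)).
- have -> : 2 ^+ m = 2 ^+ (m - j) * 2 ^+ j :> R by rewrite -exprD subnK// ltnW.
  by rewrite mulrAC -exprMn mulfV// expr1n mul1r.
- congr (nat_of_bool (_ && _))%:R; rewrite exprSr.
    by congr (_ <= _); rewrite -[k.*2.+1%:R]natr1 -muln2 natrM; field.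
  by congr (_ < _); rewrite -[k.*2.+2%:R]natr1 -[k.*2.+1%:R]natr1 -muln2 natrM; field.
- congr (nat_of_bool (_ && _))%:R; rewrite exprSr.
    by congr (_ <= _); rewrite -muln2 natrM; field.
  by congr (_ < _); rewrite -[k.*2.+1%:R]natr1 -muln2 natrM; field.
Qed.

End discretization.

(** * Localization of tree sums, differences and averages *)

Section tree_sums.
Context (R : realType).
Local Notation node := (nat * nat)%type.
Implicit Types (f g : seq nat -> R) (q : seq node).

Lemma tsum_point d k (p : node) (a : R) : (0 < p.1)%N ->
  tsum d k (fun e l => ((e, l) == p)%:R * a) =
  ((p.1 <= d) && (p.2 %/ 2 ^ (d - p.1) == k))%N%:R * (2^-1 ^+ (d - p.1) * a).
Proof.
case: p => d' k' /= d0; elim: d k => [|d IH] k /=.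
  by rewrite leqNgt d0 mul0r.
rewrite !IH {IH} xpair_eqE.
case: (ltngtP d' d.+1) => [h|h|->].
- have h' : (d' <= d)%N by [].
  rewrite h' /= mul0r add0r subSn// expnSr divnMA divn2 half_eq exprSr; ring.
- have -> : (d' <= d)%N = false by apply/negbTE; rewrite -ltnNge ltnW.
  by rewrite /= !mul0r addr0 mul0r addr0.
- rewrite ltnn /= subnn divn1 expr0 mul1r !mul0r addr0 mul0r addr0.
  by rewrite [k == k']eq_sym.
Qed.

Definition haar_node (m : nat) (p : node) : bool :=
  [&& 0 < p.1, p.1 <= m & p.2 < 2 ^ (m - p.1)]%N.

Lemma TN_point m N q0 (t : seq node -> R) : size q0 = N -> all (haar_node m) q0 ->
  TN m N (fun q => (q == q0)%:R * t q) = (\prod_(p <- q0) 2^-1 ^+ (m - p.1)) * t q0.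
Proof.
elim: N q0 t => [|N IH] [|p q0]//= t; first by rewrite big_nil.
move=> [sq] /andP[/and3P[p0 pm pk] aq]; rewrite big_cons.
transitivity (tsum m 0 (fun e l => ((e, l) == p)%:R *
  ((\prod_(p <- q0) 2^-1 ^+ (m - p.1)) * t (p :: q0)))).
  apply: eq_tsum => e l; rewrite -(IH q0 (fun q => t (p :: q)))//.
  rewrite -(lin_TN R m N).2; congr TN; apply/funext => q.
  rewrite eqseq_cons -mulnb natrM -mulrA.
  by case: eqP => [->|_]; rewrite ?mul0r.
rewrite tsum_point// pm (divn_small pk) eqxx /= mul1r; ring.
Qed.

Lemma eq_avg_node d k (f g : nat -> R) : (forall c, (c %/ 2 ^ d)%N = k -> f c = g c) ->
  avg d k f = avg d k g.
Proof.
elim: d k => [|d IH] k fg /=; first by apply: fg; rewrite divn1.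
congr ((_ + _) / 2); apply: IH => c cd; apply: fg; rewrite expnSr divnMA divn2 cd.
  by rewrite doubleK.
by rewrite /= uphalf_double.
Qed.

(** Positive heights matter: at height 0 the difference would read values outside the node. *)
Lemma eq_hdN_in q f g : all (fun p => (0 < p.1)%N) q -> (forall c, inN q c -> f c = g c) ->
  hdN q f = hdN q g.
Proof.
elim: q f g => [|[[//|d] k] q IH] f g /=; first by move=> _; exact.
move=> q0 fg; rewrite /hdiff /=.
have key l a : (a %/ 2 ^ d)%N = l -> l./2 = k ->
    hdN q (fun x => f (a :: x)) = hdN q (fun x => g (a :: x)).
  move=> al lk; apply: IH => // c qc; apply: fg.
  by rewrite expnSr divnMA divn2 al lk eqxx.
congr ((_ - _) / 2); apply: eq_avg_node => a al; apply: (key _ _ al).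
  by rewrite /= uphalf_double.
by rewrite doubleK.
Qed.

Lemma le_avN_in q f g : (forall c, inN q c -> f c <= g c) -> avN q f <= avN q g.
Proof.
elim: q f g => [|[d k] q IH] f g fg /=; first exact: fg.
have H l a : (a %/ 2 ^ d)%N = l -> l = k -> avN q (fun x => f (a :: x)) <= avN q (fun x => g (a :: x)).
  by move=> al lk; apply: IH => c qc; apply: fg; rewrite /= al lk eqxx.
have key e l : (forall a, (a %/ 2 ^ e)%N = l -> (a %/ 2 ^ d)%N = k) ->
    avg e l (fun c => avN q (fun x => f (c :: x))) <= avg e l (fun c => avN q (fun x => g (c :: x))).
  elim: e l => [|e IHe] l h /=; first by apply: (H _ _ erefl); apply: h; rewrite divn1.
  rewrite ler_pM2r ?invr_gt0// lerD// IHe// => a ea; apply: h; rewrite expnSr divnMA divn2 ea.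
    by rewrite doubleK.
  by rewrite /= uphalf_double.
by apply: key.
Qed.

End tree_sums.

(** * Haar functions and coefficients in terms of cells *)

Section haar_discretization.
Context (R : realType) (N : nat).
Local Notation node := (nat * nat)%type.
Local Notation mu := (torus_measure R N).
Local Notation rv := (rvec R N).
Implicit Types (g f : rv -> R) (h : seq nat -> R) (Q : dyadic_rect N).

Lemma cube_cons n (t : R) (y : rvec R n) :
  cube R n.+1 [tuple of t :: y] <-> 0 <= t < 1 /\ cube R n y.
Proof.
split=> [C|[t01 Cy] i].
  split; first by have := C ord0; rewrite tnth0 /= in_itv.
  by move=> i; have := C (lift ord0 i); rewrite tnthS.
by case: (unliftP ord0 i) => [j ->|->]; rewrite ?tnthS ?tnth0 /= ?in_itv//; have := Cy j.
Qed.

Lemma haar_cell m Q (x : rv) : cube R N x -> level_lt m Q ->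
  haar Q x = hscale R Q * (2 ^+ (m * N) * (wN R (nodes m Q) * sgnN R (nodes m Q) (cidx m x))).
Proof.
rewrite /haar /hscale /wN.
elim: N Q x => [|n IH] Q x.
  by rewrite big_ord0 [x]tuple0 [Q]tuple0 /= !big_nil muln0 expr0 !mul1r.
case/tupleP: Q => I Q; case/tupleP: x => t y /cube_cons[t01 Cy] /= /andP[Im Qm].
rewrite big_ord_recl !tnth0 (eq_bigr (fun i : 'I_n => haar1 (tnth Q i) (tnth y i))); last first.
  by move=> i _; rewrite !tnthS.
rewrite (IH Q y Cy Qm) (haar1_cell t01 Im) !big_cons /= mulnS exprD; ring.
Qed.

Lemma rect_set_cell m Q (x : rv) : cube R N x -> level_le m Q ->
  rect_set Q x <-> inN (nodes m Q) (cidx m x).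
Proof.
elim: N Q x => [|n IH] Q x.
  by rewrite [x]tuple0 [Q]tuple0 /=; split => // _ [].
case/tupleP: Q => I Q; case/tupleP: x => t y /cube_cons[t01 Cy] /= /andP[Im Qm].
have e : (`[dleft R I, dright R I[%classic t : Prop) = (idx m t %/ 2 ^ (m - tag I) == tagged I)%N.
  rewrite (idx_div _ t01) ?leq_subr// subKn//= in_itv /= /dright /dleft /dlen.
  by congr (is_true (_ && (_ < _))); rewrite -[(tagged I).+1%:R]natr1 mulrDl mul1r.
split=> [H|/andP[H1 /IH H2] i].
  apply/andP; split; first by rewrite -e; have := H ord0; rewrite !tnth0.
  by apply/IH => // i; have := H (lift ord0 i); rewrite !tnthS.
case: (unliftP ord0 i) => [j ->|->]; rewrite ?tnthS ?tnth0; last by rewrite e.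
exact: H2.
Qed.

Lemma rect_set_cube Q : rect_set Q `<=` cube R N.
Proof.
move=> x Qx i; have := Qx i; rewrite /= !in_itv /= => /andP[h1 h2].
move: (tnth Q i) h1 h2 => [j k]; rewrite /dleft /dright /dlen /dleft /=.
have p0 : 0 < 2^-1 ^+ j :> R by rewrite exprn_gt0// invr_gt0.
move=> h1 h2; apply/andP; split; first by apply: le_trans h1; rewrite mulr_ge0// ltW.
have h3 : k.+1%:R * 2^-1 ^+ j <= 1 :> R.
  by rewrite exprVn ler_pdivrMr ?exprn_gt0// mul1r -natrX ler_nat.
by apply: lt_le_trans h2 _; rewrite -[k.+1%:R]natr1 mulrDl mul1r in h3.
Qed.

Lemma measurable_rect Q : measurable (rect_set Q : set rv).
Proof.
rewrite (_ : rect_set Q = box (fun i => `[dleft R (tnth Q i), dright R (tnth Q i)[%classic))//.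
by apply: measurable_box => i; exact: measurable_itv.
Qed.

Lemma measurable_haar Q : measurable_fun setT (haar Q : rv -> R).
Proof.
apply: measurable_prod => i _.
apply: (@measurableT_comp _ _ _ _ _ _ (haar1 (tnth Q i)) _ (fun x : rv => tnth x i)).
  apply: measurable_funM => //; apply: measurable_funB; apply: measurable_indic; exact: measurable_itv.
exact: measurable_tnth.
Qed.

Lemma bounded_haar Q : exists M, forall x : rv, `|haar Q x| <= M.
Proof.
exists (\prod_(i < N) (Num.sqrt (dlen R (tnth Q i)))^-1) => x.
rewrite /haar normr_prod; apply: ler_prod => i _; rewrite normr_ge0 /= /haar1 normrM ger0_norm ?invr_ge0 ?sqrtr_ge0//.
rewrite ler_piMr ?invr_ge0 ?sqrtr_ge0// !indicE.
case: (boolP (_ \in `[dmid R _, _[%classic)) => h1; case: (boolP (_ \in _)) => h2; rewrite ?subrr ?subr0 ?sub0r ?normrN ?normr0 ?normr1//.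
Qed.

Definition hc g Q : R := \int[mu]_x (g x * haar Q x).

Lemma hc_disc m g Q : intg g -> level_lt m Q ->
  hc g Q = hscale R Q * hdN (nodes m Q) (disc m g).
Proof.
move=> ig Qm.
have L := lin_Lam m ig.
have all0 : all (fun p => (0 < p.1)%N) (nodes m Q).
  by rewrite all_map; apply: sub_all Qm => I /= Im; rewrite subn_gt0.
have -> : hdN (nodes m Q) (disc m g) = Lam m g (fun c => 2 ^+ (m * N) * hdN (nodes m Q) (fun c' => (c == c')%:R)).
  rewrite L.2 (hdN_lin _ _ L) /disc -(lin_hdN R _).2; congr hdN.
rewrite /hc -L.2 /Lam; apply: eq_cube.
- exact: intg_measurable (intgM ig (measurable_haar Q) (bounded_haar Q)).
- exact: intg_measurable (intg_cidx m (fun c => hscale R Q * (2 ^+ (m * N) * hdN (nodes m Q) (fun c' => (c == c')%:R))) ig).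
by move=> x Cx; rewrite (haar_cell Cx Qm) hdN_point.
Qed.

End haar_discretization.

(** * Means over dyadic rectangles and measures of their unions *)

Section rect_averages.
Context (R : realType) (N : nat).
Local Notation node := (nat * nat)%type.
Local Notation mu := (torus_measure R N).
Local Notation rv := (rvec R N).
Implicit Types (g f : rv -> R) (h : seq nat -> R) (Q : dyadic_rect N).

Lemma wN_nodes m Q : level_le m Q -> 2 ^+ (m * N) * wN R (nodes m Q) = (rvol R Q)^-1.
Proof.
rewrite /wN /rvol; elim: N Q => [|n IH] Q.
  by rewrite [Q]tuple0 /= !big_nil muln0 expr0 mulr1 invr1.
case/tupleP: Q => I Q /= /andP[Im Qm].
rewrite !big_cons /= mulnS exprD invfM -(IH Q Qm).
have -> : (dlen R I)^-1 = 2 ^+ m * 2^-1 ^+ (m - tag I).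
  rewrite /dlen exprVn invrK -{1}(subnK Im) exprD exprVn.
  by rewrite mulrAC mulfV ?mul1r// expf_neq0.
ring.
Qed.

Definition rmean g Q : R := (rvol R Q)^-1 * \int[mu]_x (g x * \1_(rect_set Q) x).

Lemma measurable_indic_rect Q : measurable_fun setT (\1_(rect_set Q) : rv -> R).
Proof. by apply: measurable_indic; exact: measurable_rect. Qed.

Lemma indic_bounded (A : set rv) : exists M : R, forall x, `|\1_A x : R| <= M.
Proof. by exists 1 => x; rewrite indicE; case: (_ \in _); rewrite ?normr1 ?normr0. Qed.

Lemma indic_rect_cell m Q (x : rv) : cube R N x -> level_le m Q ->
  \1_(rect_set Q) x = (inN (nodes m Q) (cidx m x))%:R :> R.
Proof.
move=> Cx Qm; rewrite indicE; congr (nat_of_bool _)%:R; apply/idP/idP.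
  by move/set_mem/(rect_set_cell Cx Qm).
by move/(rect_set_cell Cx Qm)/mem_set.
Qed.

Lemma avN_disc m g Q : intg g -> level_le m Q ->
  avN (nodes m Q) (disc m g) = rmean g Q.
Proof.
move=> ig Qm; have L := lin_Lam m ig.
have -> : avN (nodes m Q) (disc m g) = Lam m g (fun c => 2 ^+ (m * N) * avN (nodes m Q) (fun c' => (c == c')%:R)).
  by rewrite L.2 (avN_lin _ _ L) /disc -(lin_avN R _).2.
rewrite /rmean -RintegralZl//; last first.
  by apply: intgM => //; [exact: measurable_indic_rect|exact: indic_bounded].
rewrite /Lam; apply: eq_cube.
- exact: intg_measurable (intg_cidx m (fun c => 2 ^+ (m * N) * avN (nodes m Q) (fun c' => (c == c')%:R)) ig).
- apply: (intg_measurable (intgZ _ (intgM ig (measurable_indic_rect Q) (indic_bounded _)))).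
move=> x Cx; rewrite avN_point (mulrA (2 ^+ _)) wN_nodes// (indic_rect_cell Cx Qm); ring.
Qed.

Lemma nodes_surj m n (q : seq node) : size q = n -> all (valid_node m) q ->
  exists Q : dyadic_rect n, level_le m Q /\ nodes m Q = q.
Proof.
elim: n q => [|n IH] [|[d k] q] //=; first by exists [tuple].
move=> [sq] /andP[/andP[/= dm kd] qv]; have [Q [Qm Qq]] := IH q sq qv.
exists [tuple of (existT (fun j => 'I_(2 ^ j)%N) (m - d)%N (Ordinal kd) : dyadic) :: Q]; split.
  by apply/andP; split => //; exact: leq_subr.
by rewrite /nodes /= subKn// -Qq.
Qed.

Lemma RintegralEindic (A : set rv) : measurable A -> \int[mu]_x (\1_A x : R) = fine (mu A).
Proof. by move=> mA; rewrite /Rintegral integral_indic// setIT. Qed.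

Lemma mu_rect Q : mu (rect_set Q) = (rvol R Q)%:E.
Proof.
rewrite (_ : rect_set Q = box (fun i => `[dleft R (tnth Q i), dright R (tnth Q i)[%classic))//.
rewrite torus_box; last by move=> i; exact: measurable_itv.
congr EFin; rewrite /rvol big_tuple; apply: eq_bigr => i _.
rewrite uniform_itv.
- by rewrite /dright /= addrC addKr.
- by rewrite /dleft mulr_ge0// ltW// dlen_gt0.
- by rewrite /dright lerDl ltW// dlen_gt0.
move: (tnth Q i) => [j k]; rewrite /dright /dleft /dlen /=.
have h3 : k.+1%:R * 2^-1 ^+ j <= 1 :> R.
  by rewrite exprVn ler_pdivrMr ?exprn_gt0// mul1r -natrX ler_nat.
by rewrite -[k.+1%:R]natr1 mulrDl mul1r in h3.
Qed.

Lemma rmean_cst Q (a : R) : rmean (fun=> a) Q = a.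
Proof.
rewrite /rmean RintegralZl//.
  rewrite RintegralEindic; last exact: measurable_rect.
  by rewrite mu_rect /= mulrCA mulVf ?mulr1// gt_eqF// rvol_gt0.
by apply: intg_bounded; [exact: measurable_indic_rect|exact: indic_bounded].
Qed.

Lemma disc_rmean m g (c : seq nat) : intg g -> size c = N -> all (fun a => (a < 2 ^ m)%N) c ->
  exists2 Q : dyadic_rect N, level_le m Q & disc m g c = rmean g Q.
Proof.
move=> ig sc ac; have [||Q [Qm Qc]] := @nodes_surj m N (map (pair 0%N) c).
- by rewrite size_map.
- by rewrite all_map; apply: sub_all ac => a /=; rewrite /valid_node /= subn0.
by exists Q => //; rewrite -(avN_disc ig Qm) Qc avN_cells.
Qed.

Lemma disc_cst m (a : R) (c : seq nat) : size c = N -> all (fun a => (a < 2 ^ m)%N) c ->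
  disc m (fun _ : rv => a) c = a.
Proof. by move=> sc ac; have [Q _ ->] := disc_rmean (intg_cst _ a) sc ac; exact: rmean_cst. Qed.

(** The grid estimates quantify over all index sequences; thanks to this default value, uniform
    bounds such as [disc_bound] hold for all of them. *)
Lemma disc_off m g (c : seq nat) : intg g -> ~~ ((size c == N) && all (fun a => (a < 2 ^ m)%N) c) ->
  disc m g c = 0.
Proof.
move=> ig cN; rewrite /disc /Lam (@eq_cube _ _ _ (fun=> 0)).
- by rewrite Rintegral_cst// mul0r mulr0.
- exact: intg_measurable (intg_cidx m (fun c' => (c' == c)%:R) ig).
- exact: measurable_cst.
move=> x Cx; case: eqP => [e|_]; last by rewrite mulr0.
by move: cN; rewrite -e size_cidx eqxx cidx_lt.
Qed.

Lemma discD m g f c : intg g -> intg f -> disc m (fun x => g x + f x) c = disc m g c + disc m f c.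
Proof.
move=> ig jf; rewrite /disc -mulrDr /Lam -RintegralD//; [|exact: (intg_cidx m (fun c' => (c' == c)%:R) ig)|exact: (intg_cidx m (fun c' => (c' == c)%:R) jf)].
by congr (_ * _); apply: eq_Rintegral => x _; rewrite mulrDl.
Qed.

Lemma discZ m (a : R) g c : intg g -> disc m (fun x => a * g x) c = a * disc m g c.
Proof.
move=> ig; rewrite /disc mulrCA; congr (_ * _); rewrite /Lam -RintegralZl//; last exact: (intg_cidx m (fun c' => (c' == c)%:R) ig).
by apply: eq_Rintegral => x _; rewrite mulrA.
Qed.

Lemma le_disc m g f c : intg g -> intg f -> (forall x, cube R N x -> g x <= f x) ->
  disc m g c <= disc m f c.
Proof.
move=> ig jf gf; rewrite /disc ler_pM2l ?exprn_gt0//; apply: le_cube.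
- exact: (intg_cidx m (fun c' => (c' == c)%:R)).
- exact: (intg_cidx m (fun c' => (c' == c)%:R)).
by move=> x Cx; rewrite ler_wpM2r// gf.
Qed.

Lemma disc_norm_le m g c : intg g -> `|disc m g c| <= disc m (fun x => `|g x|) c.
Proof.
move=> ig; rewrite ler_norml; apply/andP; split.
  rewrite lerNl -mulN1r -discZ//; apply: le_disc; [exact: intgZ|exact: intg_norm|].
  by move=> x _; rewrite mulN1r -normrN ler_norm.
by apply: le_disc => //; [exact: intg_norm|move=> x _; exact: ler_norm].
Qed.

Lemma disc_bound m g (M : R) c : 0 <= M -> intg g -> (forall x, `|g x| <= M) -> `|disc m g c| <= M.
Proof.
move=> M0 ig gM; have [/andP[/eqP sc ac]|/disc_off ->//] := boolP ((size c == N) && all (fun a => (a < 2 ^ m)%N) c); last by rewrite normr0.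
apply: le_trans (disc_norm_le _ _ ig) _; rewrite -(disc_cst M sc ac).
by apply: le_disc => // [|]; [exact: intg_norm|exact: intg_cst].
Qed.

Lemma inN_valid m q (c : seq nat) : all (valid_node m) q -> inN q c ->
  size c = size q /\ all (fun a => (a < 2 ^ m)%N) c.
Proof.
elim: q c => [|[d k] q IH] [|a c] //= /andP[/andP[/= dm kd] qv] /andP[/eqP ak /(IH _ qv)[-> ->]].
split=> //; rewrite andbT -(subnK dm) expnD -ltn_divLR ?expn_gt0// ak.
exact: kd.
Qed.

(** Jensen's inequality on each cell: taking cell means does not increase the oscillation over a
    union of cells. *)
Lemma osc_disc m b (B : R) : intg b ->
  (forall Q, level_le m Q -> rmean (fun x => `|b x - rmean b Q|) Q <= B) ->
  osc_le m N B (disc m b).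
Proof.
move=> ib H q sq qv; have [Q [Qm Qq]] := nodes_surj sq qv.
rewrite -Qq avN_disc//; set a := rmean b Q.
have ia := intg_cst N a.
have iba : intg (fun x => b x - a) by exact: intgB.
apply: le_trans (H Q Qm); rewrite -(avN_disc (intg_norm iba) Qm) Qq; apply: le_avN_in => c qc.
have [sc ac] := inN_valid qv qc; rewrite sq in sc.
rewrite -[X in _ - X](disc_cst a sc ac) -mulN1r -discZ// -discD//; last exact: intgZ.
have -> : (fun x => b x + -1 * a) = (fun x => b x - a) by apply/funext => x; rewrite mulN1r.
exact: disc_norm_le.
Qed.

Lemma nodes_inj m Q Q' : level_le m Q -> level_le m Q' -> nodes m Q = nodes m Q' -> Q = Q'.
Proof.
elim: N Q Q' => [|n IH] Q Q'; first by rewrite [Q]tuple0 [Q']tuple0.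
case/tupleP: Q => -[j k] Q; case/tupleP: Q' => -[j' k'] Q' /=.
move=> /andP[jm Qm] /andP[jm' Qm'] [e1 e2 /(IH _ _ Qm Qm') ->].
have {e1} ej : j = j' by move: e1 jm jm' => /= *; lia.
by clear jm jm'; case: j' / ej k' e2 => k' /= /val_inj ->.
Qed.

Lemma level_ltW m Q : level_lt m Q -> level_le m Q.
Proof. by apply: sub_all => I /ltnW. Qed.

(** The weight |Q| hidden in [TN] offsets the normalization of [hdN], so that for squares of [hdN]
    the summands become squared Haar coefficients ([hscale_hdN], [hc_disc]). *)
Lemma TN_sum m (F : seq (dyadic_rect N)) (t : seq node -> R) : uniq F -> all (level_lt m) F ->
  TN m N (fun q => (q \in map (nodes m) F)%:R * t q) = \sum_(Q <- F) rvol R Q * t (nodes m Q).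
Proof.
elim: F => [|Q F IH] /=.
  move=> _ _; rewrite big_nil -[RHS](mul0r (TN m N (fun=> 0))) -(lin_TN R m N).2.
  by congr TN; apply/funext => q; rewrite !mul0r.
move=> /andP[QF uF] /andP[Qm Fm]; rewrite big_cons -(IH uF Fm).
have -> : rvol R Q * t (nodes m Q) = TN m N (fun q => (q == nodes m Q)%:R * t q).
  rewrite TN_point.
  - congr (_ * _); rewrite /rvol big_map !big_seq; apply: eq_bigr => I IQ /=.
    by rewrite subKn//; exact/ltnW/(allP Qm).
  - by rewrite size_map size_tuple.
  rewrite all_map; apply/allP => I IQ /=; have Im := allP Qm _ IQ.
  by rewrite /haar_node /= subn_gt0 Im leq_subr subKn ?ltn_ord// ltnW.
rewrite -(lin_TN R m N).1; congr TN; apply/funext => q.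
rewrite inE -mulrDl; congr (_ * _); case: eqP => [->|_] /=; last by rewrite add0r.
rewrite (_ : (_ \in _) = false) ?addr0//; apply/negbTE/mapP => -[Q' Q'F /nodes_inj e].
move: QF; rewrite (e (level_ltW Qm)) ?Q'F//.
by apply: level_ltW; exact: (allP Fm).
Qed.

Definition runion (F : seq (dyadic_rect N)) : set rv := \bigcup_(Q in [set Q | Q \in F]) rect_set Q.

Lemma measurable_runion F : measurable (runion F).
Proof.
rewrite /runion; elim: F => [|Q F IH].
  by rewrite (_ : [set _ | _] = set0) ?bigcup_set0// predeqE => Q; rewrite /= in_nil.
rewrite (_ : [set _ | _] = Q |` [set Q | Q \in F]).
  by rewrite bigcup_setU1; apply: measurableU => //; exact: measurable_rect.
rewrite predeqE => P /=; rewrite inE; split=> [/orP[/eqP|]|[->|->]]; first by left.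
- by right.
- by rewrite eqxx.
- by rewrite orbT.
Qed.

Lemma EN_union m (F : seq (dyadic_rect N)) : all (level_le m) F ->
  EN m N (fun c => (has (fun q => inN q c) (map (nodes m) F))%:R) = fine (mu (runion F)).
Proof.
move=> Fm; set u := fun c => (has _ _)%:R.
rewrite -RintegralEindic; last exact: measurable_runion.
transitivity (Lam m (fun _ : rv => 1) u).
  rewrite Lam_EN; last exact: intg_cst.
  have E c : size c = N -> all (fun a => (a < 2 ^ m)%N) c -> u c = disc m (fun _ : rv => 1) c * u c.
    by move=> sc ac; rewrite disc_cst// mul1r.
  by apply/eqP; rewrite eq_le; apply/andP; split; apply: le_EN => c sc ac; rewrite -E.
rewrite /Lam; apply: eq_cube.
- exact: intg_measurable (intg_cidx m u (intg_cst N 1)).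
- by apply: measurable_indic; exact: measurable_runion.
move=> x Cx; rewrite mul1r /u indicE; congr (nat_of_bool _)%:R; apply/idP/idP.
  move=> /hasP[q /mapP[Q QF ->] /(rect_set_cell Cx (allP Fm _ QF)) xQ].
  by apply/mem_set; exists Q.
move/set_mem => -[Q /= QF /(rect_set_cell Cx (allP Fm _ QF)) xQ].
by apply/hasP; exists (nodes m Q) => //; apply: map_f.
Qed.

End rect_averages.

(** * Density of step functions *)

Section density.
Import HBSimple.
Context (R : realType) (N : nat).
Local Notation mu := (torus_measure R N).
Local Notation rv := (rvec R N).
Implicit Types (g f u : rv -> R) (h : seq nat -> R) (A D : set rv).

Lemma idx_refine m m' (t : R) : (m <= m')%N -> idx m t = (idx m' t %/ 2 ^ (m' - m))%N.
Proof.
move=> mm.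
have e n : (n <= idx m t)%N = (n <= idx m' t %/ 2 ^ (m' - m))%N.
  case: n => [//|n]; rewrite leq_divRL ?expn_gt0//.
  have p0 : (0 < n.+1 * 2 ^ (m' - m))%N by rewrite muln_gt0 expn_gt0.
  rewrite -(prednK p0) !le_idx (prednK p0); congr (_ && _).
    by rewrite -{2}(subnK mm) expnD mulnC leq_pmul2l ?expn_gt0.
  have -> : 2 ^+ m' * t = 2 ^+ m * t * 2 ^+ (m' - m).
    by rewrite mulrAC -exprD subnKC.
  by rewrite natrM natrX ler_pM2r ?exprn_gt0.
by apply/eqP; rewrite eqn_leq -e leqnn e leqnn.
Qed.

Lemma cidx_refine m m' (x : rv) : (m <= m')%N ->
  cidx m x = [seq (a %/ 2 ^ (m' - m))%N | a <- cidx m' x].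
Proof. by move=> mm; rewrite /cidx -map_comp; apply: eq_map => t /=; exact: idx_refine. Qed.

Definition stepset D : Prop := exists m (S : seq nat -> bool), D = [set x : rv | S (cidx m x)].

Lemma stepset_refine m m' (S : seq nat -> bool) : (m <= m')%N -> exists S' : seq nat -> bool,
  [set x : rv | S (cidx m x)] = [set x | S' (cidx m' x)].
Proof.
move=> mm; exists (fun c => S [seq (a %/ 2 ^ (m' - m))%N | a <- c]).
by rewrite predeqE => x /=; rewrite (cidx_refine _ mm).
Qed.

Lemma stepsetC D : stepset D -> stepset (~` D).
Proof.
move=> [m [S ->]]; exists m, (fun c => ~~ S c).
by rewrite predeqE => x /=; split => [/negP|/negP].
Qed.

Lemma stepsetU D D' : stepset D -> stepset D' -> stepset (D `|` D').
Proof.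
move=> [m [S ->]] [m' [S' ->]].
have [T ->] := stepset_refine S (leq_maxl m m').
have [T' ->] := stepset_refine S' (leq_maxr m m').
exists (maxn m m'), (fun c => T c || T' c).
by rewrite predeqE => x /=; split => [[->|->]//|/orP//]; rewrite orbT.
Qed.

Lemma stepset0 : stepset set0.
Proof. by exists 0%N, (fun=> false); rewrite predeqE. Qed.

Lemma measurable_stepset D : stepset D -> measurable D.
Proof.
move=> [m [S ->]].
have := measurable_cidx m (N := N) (fun c => (S c)%:R : R) measurableT (measurable_set1 1).
rewrite setTI (_ : _ @^-1` _ = [set x | S (cidx m x)])//.
rewrite predeqE => x /=; case: (S _) => //; split=> //.
by move/eqP; rewrite eq_sym oner_eq0.
Qed.

Lemma cvge0_near (u : (\bar R)^nat) (e : R) : u @ \oo --> 0%E -> 0 < e ->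
  exists K, forall n, (K <= n)%N -> (u n <= e%:E)%E.
Proof.
move=> /fine_cvgP[[K1 _ H1]] /cvgrPdist_le H e0; have [K2 _ H2] := H e e0.
exists (maxn K1 K2) => n; rewrite geq_max => /andP[n1 n2].
rewrite -(fineK (H1 n n1)) lee_fin; have := H2 n n2.
by rewrite /= sub0r normrN; apply: le_trans; exact: ler_norm.
Qed.

Definition sd A D : set rv := (A `\` D) `|` (D `\` A).

Definition apx A : Prop := measurable A /\
  forall e : R, 0 < e -> exists2 D, stepset D & (mu (sd A D) <= e%:E)%E.

Lemma measurable_sd A D : measurable A -> measurable D -> measurable (sd A D).
Proof. by move=> mA mD; apply: measurableU; exact: measurableD. Qed.

Lemma apxC A : apx A -> apx (~` A).
Proof.
move=> [mA H]; split; first exact: measurableC.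
move=> e e0; have [D sD De] := H e e0; exists (~` D); first exact: stepsetC.
rewrite (_ : sd _ _ = sd A D)// /sd !setDE !setCK setUC; congr (_ `|` _); by rewrite setIC.
Qed.

Lemma bigsetU_apx (A D : (set rv)^nat) (d : R) K : (forall n, measurable (A n)) ->
  (forall n, stepset (D n)) -> (forall n, (n < K)%N -> (mu (sd (A n) (D n)) <= d%:E)%E) ->
  stepset (\big[setU/set0]_(n < K) D n) /\
  (mu (sd (\big[setU/set0]_(n < K) A n) (\big[setU/set0]_(n < K) D n)) <= (d *+ K)%:E)%E.
Proof.
move=> mA sD; elim: K => [|K IH] H.
  by rewrite !big_ord0; split; [exact: stepset0|rewrite /sd setD0 setU0 measure0 mulr0n].
have [|sK muK] := IH; first by move=> n nK; apply: H; exact: ltnW.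
rewrite !big_ord_recr /=; split; first exact: stepsetU.
set X := \big[_/_]_(_ < _) A _ in muK *; set Y := \big[_/_]_(_ < _) D _ in sK muK *.
have mX : measurable X by apply: bigsetU_measurable.
have mY := measurable_stepset sK; have mD := measurable_stepset (sD K).
apply: (@le_trans _ _ (mu (sd X Y `|` sd (A K) (D K)))).
  apply: le_measure; rewrite ?inE.
  - by apply: measurable_sd; exact: measurableU.
  - by apply: measurableU; exact: measurable_sd.
  move=> x [[[Xx|Ax] /not_orP[nY nD]]|[[Yx|Dx] /not_orP[nX nA]]].
  - by left; left.
  - by right; left.
  - by left; right.
  - by right; right.
apply: le_trans (measureU2 _ _ _) _; [exact: measurable_sd|exact: measurable_sd|].
by rewrite mulrS addrC EFinD; apply: leeD => //; exact: H.
Qed.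

(** By continuity of the measure a finite union already fills the whole up to e/2; its finitely many
    members share the other half of the error. *)
Lemma apx_bigcup (A : (set rv)^nat) : (forall n, apx (A n)) -> apx (\bigcup_n A n).
Proof.
move=> H; have mA n : measurable (A n) by case: (H n).
split; first exact: bigcupT_measurable.
move=> e e0; have e2 : 0 < e / 2 by rewrite divr_gt0.
pose B K := \big[setU/set0]_(n < K) A n.
have mB K : measurable (B K) by apply: bigsetU_measurable.
have mU : measurable (\bigcup_n A n) by exact: bigcupT_measurable.
have cv : mu ((\bigcup_n A n) `\` B K) @[K --> \oo] --> 0%E.
  rewrite -(measure0 mu).
  rewrite (_ : set0 = \bigcap_K ((\bigcup_n A n) `\` B K)); last first.
    rewrite predeqE => x; split=> // h; have [[n _ Ax] _] := h 0%N I.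
    have [_] := h n.+1 I; apply; rewrite /B -bigcup_mkord; exists n => //=.
  apply: nonincreasing_cvg_mu => //.
  - by apply: le_lt_trans (probability_le1 mu (measurableD mU (mB 0%N))) _; exact: ltry.
  - by move=> K; exact: measurableD.
  - by apply: bigcap_measurable => // K _; exact: measurableD.
  move=> a b ab; apply/subsetPset => x [Ux Bx]; split=> // Ba; apply: Bx.
  by apply: subset_bigsetU ab _ Ba.
have [K BK] : exists K, (mu ((\bigcup_n A n) `\` B K) <= (e / 2)%:E)%E.
  have [K HK] := cvge0_near cv e2.
  by exists K; apply: HK.
(* K + 1 instead of K, as the finite union may be empty. *)
have d0 : 0 < e / 2 / K.+1%:R by rewrite divr_gt0.
have [D DP] := choice (fun n => let: conj _ H' := H n in
  let: ex_intro2 D sD De := H' _ d0 in ex_intro (fun D => stepset D /\ (mu (sd (A n) D) <= (e / 2 / K.+1%:R)%:E)%E) D (conj sD De)).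
have [sD muD] := @bigsetU_apx A D _ K mA (fun n => (DP n).1) (fun n _ => (DP n).2).
exists (\big[setU/set0]_(n < K) D n) => //.
set Y := \big[_/_]_(_ < _) _ in sD muD *.
have mY := measurable_stepset sD.
apply: (@le_trans _ _ (mu (((\bigcup_n A n) `\` B K) `|` sd (B K) Y))).
  apply: le_measure; rewrite ?inE.
  - exact: measurable_sd.
  - by apply: measurableU; [exact: measurableD|exact: measurable_sd].
  move=> x [[Ux Yx]|[Yx Ux]].
    by have [Bx|Bx] := pselect (B K x); [right; left|left].
  right; right; split=> // Bx; apply: Ux.
  by move: Bx; rewrite /B -bigcup_mkord => -[n _ Ax]; exists n.
apply: le_trans (measureU2 _ _ _) _; [exact: measurableD|exact: measurable_sd|].
rewrite [e]splitr EFinD; apply: leeD => //; apply: le_trans muD _.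
rewrite lee_fin -[leLHS]mulr_natr mulrAC -mulrA ler_piMr ?(ltW e2)//.
by rewrite ler_pdivrMr// mul1r ler_nat.
Qed.

Lemma measurable_tnth_preimage (i : 'I_N) (B : set R) : measurable B ->
  measurable [set x : rv | B (tnth x i)].
Proof.
move=> mB; rewrite -[X in measurable X]setTI.
by apply: (@measurable_tnth _ (measurableTypeR R) N i) => //; exact: mB.
Qed.

Lemma torus_tnth (i : 'I_N) (B : set R) : measurable B ->
  mu [set x : rv | B (tnth x i)] = uniform_prob (@ltr01 R) B.
Proof.
move=> mB; rewrite (_ : [set _ | _] = box (fun j => if j == i then B else setT)).
  rewrite torus_box; last by move=> j; case: ifP.
  rewrite (bigD1 i)//= eqxx big1 ?mulr1 ?fineK//.
    by apply: fin_num_measure.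
  by move=> j /negbTE ->; rewrite probability_setT.
rewrite predeqE => x; split=> [Bx j|/(_ i)]; last by rewrite eqxx.
by case: eqP => [->|].
Qed.

Lemma idx_fiber (m : nat) (a : nat) : (a < 2 ^ m)%N ->
  (uniform_prob (@ltr01 R) [set t | idx m t = a] <= (2^-1 ^+ m)%:E)%E.
Proof.
move=> am.
have -> : uniform_prob (@ltr01 R) [set t | idx m t = a] =
   uniform_prob (@ltr01 R) ([set t | idx m t = a] `&` `[0, 1[%classic).
  apply/eqP; rewrite eq_le; apply/andP; split; last first.
    by apply: le_measure; rewrite ?inE//; [apply: measurableI => //|]; exact: measurable_idx1.
  have U0 : uniform_prob (@ltr01 R) (~` `[0, 1[%classic) = 0%E.
    have U1 : uniform_prob (@ltr01 R) `[0, 1[%classic = 1%E by rewrite uniform_itv// subr0.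
    apply: etrans (probability_setC (uniform_prob (@ltr01 R)) (measurable_itv `[0, 1[)) _.
    by apply: etrans (congr1 (fun z => 1 - z)%E U1) _; rewrite subee.
  apply: (@le_trans _ _ (uniform_prob (@ltr01 R) (([set t | idx m t = a] `&` `[0, 1[%classic) `|` ~` `[0, 1[%classic))).
    apply: le_measure; rewrite ?inE//; first exact: measurable_idx1.
      by apply: measurableU => //; [apply: measurableI => //; exact: measurable_idx1|exact: measurableC].
    by move=> t ta; have [t01|t01] := pselect (`[0, 1[%classic t); [left|right].
  apply: le_trans (measureU2 _ _ _) _.
  - by apply: measurableI => //; exact: measurable_idx1.
  - exact: measurableC.
  have U0' : (uniform_prob (@ltr01 R) (~` `[0%R, 1%R[%classic) <= 0)%E by rewrite U0.
  by rewrite -[leRHS]adde0; apply: leeD; [exact: lexx|exact: U0'].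
apply: (@le_trans _ _ (uniform_prob (@ltr01 R) `[a%:R * 2^-1 ^+ m, a.+1%:R * 2^-1 ^+ m[%classic)).
  apply: le_measure; rewrite ?inE//.
    by apply: measurableI => //; exact: measurable_idx1.
  move=> t [/= ta]; rewrite !in_itv /= => t01.
  by have := idx_div a t01 (leq0n m); rewrite subn0 divn1 ta eqxx => <-.
have p0 : 0 < 2^-1 ^+ m :> R by rewrite exprn_gt0// invr_gt0.
rewrite uniform_itv ?mulr_ge0 ?(ltW p0) ?ler_pM2r ?ler_nat//.
  by rewrite lee_fin -mulrBl -natrB// subSnn mul1r.
by rewrite exprVn ler_pdivrMr ?exprn_gt0// mul1r -natrX ler_nat.
Qed.

(** The ray differs from a union of cells only inside the column of cells containing a, of measure
    at most 2^-m. *)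
Lemma apx_ray (i : 'I_N) (a : R) : apx [set x : rv | a < tnth x i].
Proof.
have mr : measurable [set x : rv | a < tnth x i].
  rewrite (_ : [set _ | _] = [set x : rv | `]a, +oo[%classic (tnth x i)]).
    by apply: measurable_tnth_preimage; exact: measurable_itv.
  by rewrite predeqE => x /=; rewrite in_itv /= andbT.
split=> // e e0.
have [m me] : exists m, 2^-1 ^+ m <= e :> R.
  have [m _ /(_ m (leqnn m)) /ltW h] := near_infty_natSinv_expn_lt (PosNum e0).
  by exists m; move: h; rewrite /= div1r exprVn.
exists [set x | (idx m a < idx m (tnth x i))%N].
  exists m, (fun c => (idx m a < nth 0%N c i)%N); rewrite predeqE => x /=.
  by rewrite cidx_nth.
set D := [set x | (_ < _)%N].
have sub : sd [set x : rv | a < tnth x i] D `<=` [set x | [set t | idx m t = idx m a] (tnth x i)].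
  have mono s t : s <= t -> (idx m s <= idx m t)%N.
    move=> st; case E : (idx m s) => [//|n].
    move/eqP: E; rewrite eq_sym => /eqP E; have := leqnn n.+1; rewrite {2}E !le_idx => /andP[-> h] /=.
    by apply: le_trans h _; rewrite ler_pM2l ?exprn_gt0.
  move=> x [[/= ax /negP]|[/= h /negP]].
    by rewrite -leqNgt => h; apply/eqP; rewrite eqn_leq h mono// ltW.
  by rewrite -leNgt => /mono; rewrite leqNgt h.
(* The capped index 2^m belongs to no point of [0, 1), so that column lies in the null complement of
   the cube. *)
have [h|h] := ltnP (idx m a) (2 ^ m); last first.
  apply: (@le_trans _ _ 0%E); last by rewrite lee_fin ltW.
  rewrite -(torus_cubeC R N); apply: le_measure; rewrite ?inE.
  - apply: measurable_sd => //; apply: measurable_stepset.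
    by exists m, (fun c => (idx m a < nth 0%N c i)%N); rewrite predeqE => x /=; rewrite cidx_nth.
  - by apply: measurableC; exact: measurable_cube.
  move=> x /sub /= xa Cx; have := idx_lt m (t := tnth x i); rewrite xa ltnNge h /= => H.
  by have := Cx i; rewrite /= in_itv /= => /H.
apply: (@le_trans _ _ (mu [set x : rv | [set t | idx m t = idx m a] (tnth x i)])).
  apply: le_measure; rewrite ?inE//.
  - apply: measurable_sd => //; apply: measurable_stepset.
    by exists m, (fun c => (idx m a < nth 0%N c i)%N); rewrite predeqE => x /=; rewrite cidx_nth.
  - by apply: measurable_tnth_preimage; exact: measurable_idx1.
rewrite torus_tnth; last exact: measurable_idx1.
by apply: le_trans (idx_fiber h) _; rewrite lee_fin.
Qed.

Lemma apx0 : apx set0.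
Proof.
split=> // e e0; exists set0; first exact: stepset0.
by rewrite /sd setD0 setU0 measure0 lee_fin ltW.
Qed.

(** The approximable sets form a sigma-algebra, and rays in the coordinates generate all measurable
    sets. *)
Lemma apx_measurable A : measurable A -> apx A.
Proof.
move: A; apply: smallest_sub.
  split; [exact: apx0|move=> A; rewrite setTD; exact: apxC|exact: apx_bigcup].
rewrite -bigcup_seq => A [i _ [B mB <-]]; rewrite setTI.
have {mB} : (@RGenOInfty.G R).-sigma.-measurable B by rewrite -RGenOInfty.measurableE.
move: B; apply: smallest_sub.
  split.
  - by rewrite /= preimage_set0; exact: apx0.
  - by move=> B; rewrite /= setTD preimage_setC; exact: apxC.
  - by move=> F FP /=; rewrite preimage_bigcup; exact: apx_bigcup.
move=> B [a ->] /=; rewrite (_ : _ @^-1` _ = [set x : rv | a < tnth x i]); first exact: apx_ray.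
by rewrite predeqE => x /=; rewrite in_itv /= andbT.
Qed.

Definition dense1 u : Prop := intg u /\
  forall e : R, 0 < e -> exists m h, \int[mu]_x `|u x - h (cidx m x)| <= e.

Lemma intg_h m h : intg (fun x : rv => h (cidx m x)).
Proof. by apply: intg_bounded; [exact: measurable_cidx|exact: bounded_cidx]. Qed.

Lemma le_int u v : intg u -> intg v -> (forall x, u x <= v x) -> \int[mu]_x u x <= \int[mu]_x v x.
Proof. by move=> iu iv uv; apply: le_Rintegral. Qed.

Lemma h_refine m m' h : (m <= m')%N -> exists h', forall x : rv, h (cidx m x) = h' (cidx m' x).
Proof.
move=> mm; exists (fun c => h [seq (a %/ 2 ^ (m' - m))%N | a <- c]) => x.
by rewrite (cidx_refine _ mm).
Qed.

Lemma dense1_indic A : measurable A -> dense1 (\1_A).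
Proof.
move=> mA.
have iA : intg (\1_A : rv -> R).
  by apply: intg_bounded; [exact: measurable_indic|exact: indic_bounded].
split=> // e e0; have [_ /(_ e e0)[D [m [S DE]] De]] := apx_measurable mA.
have mD : measurable D by apply: measurable_stepset; exists m, S.
have msd := measurable_sd mA mD.
exists m, (fun c => (S c)%:R).
rewrite -lee_fin; apply: le_trans De; rewrite -(fineK (fin_num_measure mu _ msd)) lee_fin.
rewrite -RintegralEindic//; apply: le_int.
- by apply: intg_norm; apply: intgB => //; exact: (intg_h m (fun c => (S c)%:R)).
- by apply: intg_bounded; [exact: measurable_indic|exact: (indic_bounded (sd A D))].
move=> x; have -> : (S (cidx m x))%:R = \1_D x :> R.
  by rewrite DE indicE; congr (nat_of_bool _)%:R; apply/idP/idP => [h|/set_mem//]; exact/mem_set.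
rewrite !indicE; have [Ax|Ax] := boolP (x \in A); have [Dx|Dx] := boolP (x \in D).
- by rewrite subrr normr0.
- rewrite subr0 normr1 mem_set//; left; split; [exact: set_mem|by move=> /mem_set; apply/negP].
- rewrite sub0r normrN normr1 mem_set//; right; split; [exact: set_mem|by move=> /mem_set; apply/negP].
- by rewrite subrr normr0.
Qed.

Lemma dense1Z (a : R) u : dense1 u -> dense1 (fun x => a * u x).
Proof.
move=> [iu H]; split; first exact: intgZ.
move=> e e0; have a1 : 0 < `|a| + 1 by rewrite ltr_wpDl.
have [m [h mh]] := H (e / (`|a| + 1)) (divr_gt0 e0 a1).
exists m, (fun c => a * h c).
rewrite (_ : (\int[mu]_x _) = `|a| * \int[mu]_x `|u x - h (cidx m x)|).
  apply: (@le_trans _ _ (`|a| * (e / (`|a| + 1)))); first by rewrite ler_wpM2l.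
  by rewrite mulrCA ler_piMr ?(ltW e0)// ler_pdivrMr// mul1r lerDl.
rewrite -RintegralZl//; last by apply: intg_norm; apply: intgB => //; exact: intg_h.
by apply: eq_Rintegral => x _; rewrite -mulrBr normrM.
Qed.

Lemma dense1D u v : dense1 u -> dense1 v -> dense1 (fun x => u x + v x).
Proof.
move=> [iu H] [iv H']; split; first exact: intgD.
move=> e e0; have e2 : 0 < e / 2 by rewrite divr_gt0.
have [m [h mh]] := H _ e2; have [m' [h' mh']] := H' _ e2.
have [k kE] := h_refine h (leq_maxl m m'); have [k' kE'] := h_refine h' (leq_maxr m m').
exists (maxn m m'), (fun c => k c + k' c).
have i1 : intg (fun x => `|u x - h (cidx m x)|) by apply: intg_norm; apply: intgB => //; exact: intg_h.
have i2 : intg (fun x => `|v x - h' (cidx m' x)|) by apply: intg_norm; apply: intgB => //; exact: intg_h.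
apply: (@le_trans _ _ (\int[mu]_x (`|u x - h (cidx m x)| + `|v x - h' (cidx m' x)|))).
  apply: le_int; [|exact: intgD|].
    apply: intg_norm; apply: intgB; [exact: intgD|exact: (intg_h _ (fun c => k c + k' c))].
  by move=> x; rewrite opprD addrACA kE kE' ler_normD.
by rewrite RintegralD// [e]splitr lerD.
Qed.

Lemma dense1_integrable u : intg u -> dense1 u.
Proof.
move=> iu; split=> // e e0; have e2 : 0 < e / 2 by rewrite divr_gt0.
have [g [ig _ cvg0]] := approximation_sfun_integrable measurableT iu.
have [K HK] := cvge0_near cvg0 e2.
have {HK} := HK K (leqnn K).
have dg : dense1 (g K).
  have [] : dense1 (g K) /\ True; last by [].
  split=> //.
  rewrite (_ : (g K : rv -> R) = fun x => \sum_(y <- finmap.enum_fset (fset_set (range (g K)))) y * \1_(g K @^-1` [set y]) x).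
    elim: (finmap.enum_fset _) => [|y s IH].
      rewrite (_ : (fun x => _) = fun=> 0); last by apply/funext => x; rewrite big_nil.
      split; first exact: intg_cst.
      move=> d d0; exists 0%N, (fun=> 0); rewrite subrr normr0 Rintegral_cst// mul0r; exact: ltW.
    rewrite (_ : (fun x => _) = fun x => y * \1_(g K @^-1` [set y]) x + \sum_(y <- s) y * \1_(g K @^-1` [set y]) x).
      by apply: dense1D => //; apply: dense1Z; exact: dense1_indic.
    by apply/funext => x; rewrite big_cons.
  by apply/funext => x; rewrite fimfunE fsbig_finite.
case: dg => igK /(_ _ e2)[m [h mh]] gK.
exists m, h.
have i1 : intg (fun x => `|u x - g K x|) by apply: intg_norm; exact: intgB.
have i2 : intg (fun x => `|g K x - h (cidx m x)|) by apply: intg_norm; apply: intgB => //; exact: intg_h.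
apply: (@le_trans _ _ (\int[mu]_x (`|u x - g K x| + `|g K x - h (cidx m x)|))).
  apply: le_int; [|exact: intgD|by move=> x; exact: ler_distD].
  by apply: intg_norm; apply: intgB => //; exact: intg_h.
by rewrite RintegralD// [e]splitr lerD// -lee_fin RintegralE.
Qed.

Definition cexp m g (x : rv) : R := disc m g (cidx m x).

Lemma intg_cexp m g : intg (cexp m g).
Proof. exact: (intg_h m (disc m g)). Qed.

Lemma cexp_step m m' g h : intg g -> (m <= m')%N ->
  \int[mu]_x (cexp m' g x * h (cidx m x)) = \int[mu]_x (g x * h (cidx m x)).
Proof.
move=> ig mm; have [k kE] := h_refine h mm.
transitivity (Lam m' (fun _ : rv => 1) (fun c => disc m' g c * k c)).
  by rewrite /Lam; apply: eq_Rintegral => x _; rewrite mul1r kE.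
transitivity (Lam m' g k); last by rewrite /Lam; apply: eq_Rintegral => x _; rewrite kE.
rewrite !Lam_EN//; last exact: intg_cst.
by apply/eqP; rewrite eq_le; apply/andP; split; apply: le_EN => c sc ac; rewrite disc_cst// mul1r.
Qed.

(** Against a step function of level m0, g and its conditional expectation have equal pairings once
    m >= m0. Both are bounded by M, so the rest is at most 2M times the L^1 distance of u to step
    functions. *)
Lemma cexp_weak g u (M : R) : intg g -> 0 <= M -> (forall x, `|g x| <= M) -> intg u ->
  forall e : R, 0 < e -> exists m0, forall m, (m0 <= m)%N ->
    `|\int[mu]_x (cexp m g x * u x) - \int[mu]_x (g x * u x)| <= e.
Proof.
move=> ig M0 gM iu e e0.
have d0 : 0 < e / (2 * M + 1) by rewrite divr_gt0// ltr_wpDl// mulr_ge0.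
have [_ /(_ _ d0)[m0 [h mh]]] := dense1_integrable iu.
exists m0 => m mm.
have cM x : `|cexp m g x| <= M by apply: disc_bound.
have mg := intg_measurable ig; have mc := intg_measurable (intg_cexp m g).
have iuh : intg (fun x => u x - h (cidx m0 x)) by apply: intgB => //; exact: intg_h.
have i1 : intg (fun x => cexp m g x * u x).
  by rewrite (_ : (fun x => _) = (fun x => u x * cexp m g x)); [apply: intgM => //; exists M|apply/funext => x; rewrite mulrC].
have i2 : intg (fun x => g x * u x).
  by rewrite (_ : (fun x => _) = (fun x => u x * g x)); [apply: intgM => //; exists M|apply/funext => x; rewrite mulrC].
have i3 : intg (fun x => cexp m g x * h (cidx m0 x)).
  by apply: intgM; [exact: intg_cexp|exact: measurable_cidx|exact: bounded_cidx].
have i4 : intg (fun x => g x * h (cidx m0 x)).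
  by apply: intgM; [|exact: measurable_cidx|exact: bounded_cidx].
have -> : \int[mu]_x (cexp m g x * u x) - \int[mu]_x (g x * u x) =
   \int[mu]_x ((cexp m g x * u x - cexp m g x * h (cidx m0 x)) - (g x * u x - g x * h (cidx m0 x))).
  rewrite RintegralB//; [|exact: intgB|exact: intgB].
  rewrite [X in _ = X - _]RintegralB// [X in _ = _ - X]RintegralB// cexp_step//; ring.
apply: le_trans (le_normr_Rintegral measurableT _) _; first by apply: intgB; apply: intgB.
apply: (@le_trans _ _ (\int[mu]_x (2 * M * `|u x - h (cidx m0 x)|))).
  apply: le_int; [by apply: intg_norm; apply: intgB; apply: intgB|by apply: intgZ; exact: intg_norm|].
  move=> x; rewrite -!mulrBr -mulrBl normrM ler_wpM2r//.
  apply: le_trans (ler_normB _ _) _; rewrite mulr_natl mulr2n; exact: lerD.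
rewrite RintegralZl//; last exact: intg_norm.
apply: (@le_trans _ _ (2 * M * (e / (2 * M + 1)))); first by rewrite ler_wpM2l// mulr_ge0.
rewrite mulrCA ler_piMr ?(ltW e0)// ler_pdivrMr ?mul1r ?lerDl//.
by rewrite ltr_wpDl// mulr_ge0.
Qed.

End density.

(** * The multiplier bound on the torus *)

Section torus_multiplier.
Context (R : realType) (N : nat).
Local Notation mu := (torus_measure R N).
Local Notation rv := (rvec R N).
Implicit Types (g f u phi b : rv -> R) (Q : dyadic_rect N) (F : seq (dyadic_rect N)).

Lemma half_pow_bracket (V : R) : 0 < V -> V <= 1 ->
  exists k, 2^-1 ^+ k.+1 <= V /\ V <= 2^-1 ^+ k.
Proof.
move=> V0 V1.
have ex : exists m, 2^-1 ^+ m <= V.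
  have [m _ /(_ m (leqnn m)) /ltW h] := near_infty_natSinv_expn_lt (PosNum V0).
  by exists m; move: h; rewrite /= div1r exprVn.
case: (ex_minnP ex) => -[|k] kV kmin.
  exists 0%N; rewrite expr0; split=> //; apply: le_trans kV.
  by rewrite expr0 expr1 invf_le1// ler1n.
exists k; split=> //; rewrite leNgt; apply/negP => /ltW /kmin.
by rewrite ltnn.
Qed.

Lemma hscale_hdN m Q (t : seq nat -> R) :
  rvol R Q * hdN (nodes m Q) t ^+ 2 = (hscale R Q * hdN (nodes m Q) t) ^+ 2.
Proof. by rewrite exprMn hscale_sqr. Qed.

Lemma runion_gt0 F Q : Q \in F -> 0 < fine (mu (runion F)).
Proof.
move=> QF; apply: (@lt_le_trans _ _ (rvol R Q)); first exact: rvol_gt0.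
rewrite -[rvol R Q]/(fine (rvol R Q)%:E) -mu_rect; apply: fine_le.
- by apply: fin_num_measure; exact: measurable_rect.
- by apply: fin_num_measure; exact: measurable_runion.
apply: le_measure; rewrite ?inE; [exact: measurable_rect|exact: measurable_runion|].
by move=> x Qx; exists Q.
Qed.

Lemma fine_mu_le1 (A : set rv) : measurable A -> fine (mu A) <= 1.
Proof.
by move=> mA; rewrite -lee_fin fineK ?fin_num_measure//; exact: probability_le1.
Qed.

Lemma levels_bound F : exists m1, forall m, (m1 <= m)%N -> all (level_lt m) F.
Proof.
exists (\max_(Q <- F) \max_(I <- Q) (tag I)).+1 => m mm.
apply/allP => Q QF; apply/allP => I IQ; apply: leq_trans mm; rewrite ltnS.
apply: (@leq_trans (\max_(I <- Q) tag I)).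
  exact: (@leq_bigmax_seq _ _ xpredT (fun I : dyadic => tag I)).
exact: (@leq_bigmax_seq _ _ xpredT (fun Q : dyadic_rect N => \max_(I <- Q) tag I)).
Qed.

Lemma hc_cexp_cvg phi b (M : R) Q : intg phi -> 0 <= M -> (forall x, `|phi x| <= M) -> intg b ->
  hc (fun x => b x * cexp m phi x) Q @[m --> \oo] --> hc (fun x => phi x * b x) Q.
Proof.
move=> iphi M0 phiM ib.
have ibh : intg (fun x => b x * haar Q x) by apply: intgM => //; [exact: measurable_haar|exact: bounded_haar].
apply/cvgrPdist_le => e e0; have [m0 Hm] := cexp_weak iphi M0 phiM ibh e0.
exists m0 => // m /= /Hm; rewrite distrC /hc.
have -> : \int[mu]_x (b x * cexp m phi x * haar Q x) = \int[mu]_x (cexp m phi x * (b x * haar Q x)).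
  by apply: eq_Rintegral => x _; rewrite mulrAC mulrC.
have -> // : \int[mu]_x (phi x * b x * haar Q x) = \int[mu]_x (phi x * (b x * haar Q x)).
by apply: eq_Rintegral => x _; rewrite mulrA.
Qed.

(** For fixed F the grid bound applies at every fine enough level m to b times [cexp m phi], with a
    constant independent of m; the finitely many coefficients converge to those of phi b. *)
Lemma torus_multiplier_bound (M K L : R) : 0 <= M -> 0 <= K -> 0 <= L ->
  exists2 C, 0 <= C & forall phi b,
    intg phi -> (forall x, `|phi x| <= M) -> intg b ->
    (forall Q, rmean (fun x => `|b x - rmean b Q|) Q <= 1) ->
    `|\int[mu]_x b x| <= K ->
    (forall F k, uniq F -> fine (mu (runion F)) <= 2^-1 ^+ k ->
      \sum_(Q <- F) hc phi Q ^+ 2 <= L * fine (mu (runion F)) / k.+1%:R ^+ 2) ->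
    forall F, uniq F -> \sum_(Q <- F) hc (fun x => phi x * b x) Q ^+ 2 <= C * fine (mu (runion F)).
Proof.
move=> M0 K0 L0; have [C C0 HC] := dyadic_multiplier_bound N M0 K0 L0.
exists C => // phi b iphi phiM ib bosc bK lmo F uF.
have [->|[Q0 Q0F]] : F = [::] \/ exists Q, Q \in F.
  by case: F {uF} => [|Q F]; [left|right; exists Q; rewrite mem_head].
  by rewrite big_nil mulr_ge0// fine_ge0.
set V := fine (mu (runion F)).
have V0 : 0 < V by exact: runion_gt0 Q0F.
have V1 : V <= 1 by apply: fine_mu_le1; exact: measurable_runion.
have [k [kV Vk]] := half_pow_bracket V0 V1.
have [m1 Hm1] := levels_bound F.
have key m : (m1 <= m)%N -> \sum_(Q <- F) hc (fun x => b x * cexp m phi x) Q ^+ 2 <= C * V.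
  move=> /Hm1 Fm.
  have Fle : all (level_le m) F by apply: sub_all Fm => Q; exact: level_ltW.
  set u : seq nat -> R := fun c => (has (fun q => inN q c) (map (nodes m) F))%:R.
  have Eu : EN m N u = V by exact: EN_union.
  have TNE g : intg g -> TN m N (fun q => (q \in map (nodes m) F)%:R * hdN q (disc m g) ^+ 2) =
      \sum_(Q <- F) hc g Q ^+ 2.
    move=> ig; rewrite TN_sum// !big_seq; apply: eq_bigr => Q QF.
    by rewrite hscale_hdN -hc_disc//; exact: (allP Fm).
  have := HC m (disc m phi) (disc m b) u (fun q => q \in map (nodes m) F) k.
  rewrite Eu.
  (* This identity is the reason for using [cexp]: it fails for phi itself. *)
  have -> : (fun x => disc m phi x * disc m b x) = disc m (fun x => b x * cexp m phi x).
    by apply/funext => c; rewrite /cexp disc_cidxM.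
  rewrite !TNE//; last first.
    by apply: intgM => //; [exact: measurable_cidx|exact: bounded_cidx].
  apply.
  - by move=> c; apply: disc_bound.
  - by move=> c; rewrite /u; case: has; rewrite ?lexx ?ler01.
  - move=> q f /mapP[Q QF ->]; apply: eq_hdN_in => [|c qc].
      rewrite all_map; apply: sub_all (allP Fm Q QF) => I /=.
      by rewrite subn_gt0.
    rewrite /u (_ : has _ _) ?mulr1//; apply/hasP; exists (nodes m Q) => //; exact: map_f.
  - by apply: osc_disc => // Q _.
  - rewrite (_ : EN m N (disc m b) = \int[mu]_x b x)//.
    rewrite (_ : disc m b = fun c => disc m b c * 1); last by apply/funext => c; rewrite mulr1.
    rewrite -(Lam_EN m (fun=> 1) ib) /Lam; apply: eq_Rintegral => x _; exact: mulr1.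
  - exact: kV.
  - exact: lmo.
have cv : \sum_(Q <- F) hc (fun x => b x * cexp m phi x) Q ^+ 2 @[m --> \oo] -->
    \sum_(Q <- F) hc (fun x => phi x * b x) Q ^+ 2.
  elim: (F) => [|Q s IH].
    by under eq_fun do rewrite big_nil; rewrite big_nil; exact: cvg_cst.
  under eq_fun do rewrite big_cons; rewrite big_cons; apply: cvgD => //.
  under eq_fun do rewrite expr2; rewrite expr2.
  by apply: cvgM; apply: (hc_cexp_cvg (M := M)) => //.
apply: (ler_cvg_to cv (cvg_cst (C * V))).
by exists m1 => // m /= /key.
Qed.

End torus_multiplier.

(** * The function spaces *)

Section complex_parts.
Local Open Scope complex_scope.
Context (R : realType).
Implicit Types (z w : R[i]).

Lemma cReM z w : complex.Re (z * w) = complex.Re z * complex.Re w - complex.Im z * complex.Im w.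
Proof. by case: z; case: w. Qed.

Lemma cImM z w : complex.Im (z * w) = complex.Re z * complex.Im w + complex.Im z * complex.Re w.
Proof. by case: z; case: w. Qed.

Lemma cReB z w : complex.Re (z - w) = complex.Re z - complex.Re w.
Proof. by case: z; case: w. Qed.

Lemma cImB z w : complex.Im (z - w) = complex.Im z - complex.Im w.
Proof. by case: z; case: w. Qed.

Lemma cabs_sqr z : cabs z ^+ 2 = complex.Re z ^+ 2 + complex.Im z ^+ 2.
Proof. by case: z => x y; rewrite /cabs /= sqr_sqrtr// addr_ge0// sqr_ge0. Qed.

Lemma cabs_ge0 z : 0 <= cabs z.
Proof. by case: z => x y; exact: sqrtr_ge0. Qed.

Lemma Re_cabs z : `|complex.Re z| <= cabs z.
Proof.
rewrite -ler_sqr ?nnegrE ?cabs_ge0// cabs_sqr real_normK ?num_real//.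
by rewrite lerDl sqr_ge0.
Qed.

Lemma Im_cabs z : `|complex.Im z| <= cabs z.
Proof.
rewrite -ler_sqr ?nnegrE ?cabs_ge0// cabs_sqr real_normK ?num_real//.
by rewrite lerDr sqr_ge0.
Qed.

Lemma cabs_le z : cabs z <= `|complex.Re z| + `|complex.Im z|.
Proof.
rewrite -ler_sqr ?nnegrE ?cabs_ge0 ?addr_ge0// cabs_sqr sqrrD !real_normK ?num_real//.
by rewrite lerD2r lerDl mulrn_wge0// mulr_ge0.
Qed.

Lemma cabsE z : cabs z = Num.sqrt (complex.Re z ^+ 2 + complex.Im z ^+ 2).
Proof. by case: z. Qed.

End complex_parts.

Section torus_spaces.
Local Open Scope complex_scope.
Context (R : realType) (N : nat).
Local Notation mu := (torus_measure R N).
Local Notation rv := (rvec R N).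
Implicit Types (g f u b : rv -> R) (Q : dyadic_rect N) (F : seq (dyadic_rect N)).

Definition l2 g : Prop := measurable_fun setT g /\ intg (fun x => g x ^+ 2).

Lemma le_intg g f : measurable_fun setT g -> intg f -> (forall x, `|g x| <= `|f x|) -> intg g.
Proof.
move=> mg jf gf; apply: (le_integrable measurableT _ _ jf); first exact/measurable_EFinP.
by move=> x _ /=; rewrite lee_fin.
Qed.

Lemma l2_intg g : l2 g -> intg g.
Proof.
move=> [mg ig]; apply: (le_intg mg (intgD (intg_cst N 1) ig)) => x.
rewrite [leRHS]ger0_norm ?addr_ge0 ?sqr_ge0//.
rewrite -[g x ^+ 2]real_normK ?num_real//; set t := `|g x|.
have t0 : 0 <= t := normr_ge0 _; have := sqr_ge0 (t - 1); nra.
Qed.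

Lemma l2M_intg g f : l2 g -> l2 f -> intg (fun x => g x * f x).
Proof.
move=> [mg ig] [mf jf]; apply: (le_intg (measurable_funM mg mf) (intgD ig jf)) => x.
rewrite [leRHS]ger0_norm ?addr_ge0 ?sqr_ge0// normrM.
rewrite -[g x ^+ 2]real_normK ?num_real// -[f x ^+ 2]real_normK ?num_real//.
set s := `|g x|; set t := `|f x|; have s0 : 0 <= s := normr_ge0 _; have t0 : 0 <= t := normr_ge0 _.
have := sqr_ge0 (s - t); nra.
Qed.

Lemma l2D g f : l2 g -> l2 f -> l2 (fun x => g x + f x).
Proof.
move=> lg lf; split; first by apply: measurable_funD; [exact: lg.1|exact: lf.1].
rewrite (_ : (fun x => _) = fun x => (g x ^+ 2 + f x ^+ 2) + 2 * (g x * f x)); last first.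
  by apply/funext => x; ring.
by apply: intgD; [apply: intgD; [exact: lg.2|exact: lf.2]|apply: intgZ; exact: l2M_intg].
Qed.

Lemma l2Z (a : R) g : l2 g -> l2 (fun x => a * g x).
Proof.
move=> [mg ig]; split; first exact: measurable_funM.
rewrite (_ : (fun x => _) = fun x => a ^+ 2 * g x ^+ 2); first exact: intgZ.
by apply/funext => x; rewrite exprMn.
Qed.

Lemma l2_bounded g (M : R) : measurable_fun setT g -> (forall x, `|g x| <= M) -> l2 g.
Proof.
move=> mg gM; split=> //; apply: intg_bounded; first exact: measurable_funX.
by exists (M ^+ 2) => x; rewrite normrX lerXn2r// ?nnegrE// (le_trans _ (gM x)).
Qed.

Lemma l2M_bounded g f (M : R) : l2 g -> measurable_fun setT f -> (forall x, `|f x| <= M) ->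
  l2 (fun x => g x * f x).
Proof.
move=> [mg ig] mf fM; split; first exact: measurable_funM.
rewrite (_ : (fun x => _) = fun x => g x ^+ 2 * f x ^+ 2); last by apply/funext => x; rewrite exprMn.
by apply: intgM => //; [exact: measurable_funX|exists (M ^+ 2) => x; rewrite normrX lerXn2r// ?nnegrE// (le_trans _ (fM x))].
Qed.

Lemma measurable_cabs (f : rv -> R[i]) : torus_fun f -> measurable_fun setT (fun x => cabs (f x)).
Proof.
move=> [_ mR mI].
rewrite (_ : (fun x => _) = (@powR R ^~ 2^-1) \o (fun x => complex.Re (f x) ^+ 2 + complex.Im (f x) ^+ 2)).
  apply: measurableT_comp; first exact: measurable_powR.
  by apply: measurable_funD; exact: measurable_funX.
apply/funext => x /=; rewrite powR12_sqrt; first exact: cabsE.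
by rewrite addr_ge0// sqr_ge0.
Qed.

Lemma Lp2P (f : rv -> R[i]) : Lp_torus R N 2%:E f <->
  [/\ torus_fun f, l2 (fun x => complex.Re (f x)) & l2 (fun x => complex.Im (f x))].
Proof.
have E : torus_fun f -> ('N[mu]_2%:E[(fun x => (cabs (f x))%:E)] < +oo)%E <->
    intg (fun x => cabs (f x) ^+ 2).
  move=> tf; rewrite unlock.
  have -> : (\int[mu]_x `|(cabs (f x))%:E| `^ 2 = \int[mu]_x `|(cabs (f x) ^+ 2)%:E|)%E.
    apply: eq_integral => x _; rewrite !gee0_abs ?lee_fin ?cabs_ge0 ?sqr_ge0// poweR_EFin.
    by rewrite -powR_mulrn ?cabs_ge0.
  split=> [/lty_poweRy h|/integrableP[_ h]]; last exact: poweR_lty.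
  apply/integrableP; split; last by apply: h; rewrite invr_neq0.
  by apply/measurable_EFinP; apply: measurable_funX; exact: measurable_cabs.
split=> [[tf /(E tf) h]|[tf [mr ir] [mi ii]]].
  have [_ mr mi] := tf; split=> //; split=> //.
    apply: (le_intg _ h) => [|x]; first exact: measurable_funX.
    by rewrite !ger0_norm ?sqr_ge0// cabs_sqr lerDl sqr_ge0.
  apply: (le_intg _ h) => [|x]; first exact: measurable_funX.
  by rewrite !ger0_norm ?sqr_ge0// cabs_sqr lerDr sqr_ge0.
split=> //; apply/(E tf); rewrite (_ : (fun x => _) = fun x => complex.Re (f x) ^+ 2 + complex.Im (f x) ^+ 2).
  exact: intgD.
by apply/funext => x; exact: cabs_sqr.
Qed.

Lemma LpooP (f : rv -> R[i]) : Lp_torus R N +oo%E f <->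
  torus_fun f /\ exists M : R, {ae mu, forall x, cabs (f x) <= M}.
Proof.
have P0 : (0 < mu setT)%E by apply: lt_le_trans (lte01) _; rewrite -(@probability_setT _ _ _ mu).
have E : ('N[mu]_+oo[(fun x => (cabs (f x))%:E)] = ess_sup mu (abse \o (fun x => (cabs (f x))%:E)))%E.
  by rewrite unlock P0.
split=> [[tf h]|[tf [M hM]]]; split=> //.
  have [r hr] : exists r : R, (ess_sup mu (abse \o (fun x => (cabs (f x))%:E)) <= r%:E)%E.
    move: h; rewrite E; case: (ess_sup _ _) => [r| |] // _; [by exists r|by exists 0; rewrite leNye].
  exists r; move/ess_supP: hr; apply: filterS => x /=.
  by rewrite lee_fin ger0_norm ?cabs_ge0.
rewrite E; apply: (@le_lt_trans _ _ M%:E); last exact: ltry.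
apply/ess_supP; apply: filterS hM => x /=.
by rewrite lee_fin ger0_norm ?cabs_ge0.
Qed.

Lemma torus_integral_shift_gen (a : rv) (F : rv -> \bar R) : measurable_fun setT F ->
  zperiodic F -> (\int[mu]_x F (Defs.shift a x) = \int[mu]_x F x)%E.
Proof.
move=> mF Fp; rewrite [LHS]integralE [RHS]integralE; congr (_ - _)%E.
  by rewrite -(torus_integral_shift a (F := F^\+%E))// => [||k x]; [apply: eq_integral => x _; rewrite !funeposE|exact: measurable_funepos|rewrite !funeposE Fp].
by rewrite -(torus_integral_shift a (F := F^\-%E))// => [||k x]; [apply: eq_integral => x _; rewrite !funenegE|exact: measurable_funeneg|rewrite !funenegE Fp].
Qed.

Lemma Rintegral_shift (a : rv) g : measurable_fun setT g -> zperiodic g ->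
  \int[mu]_x g (Defs.shift a x) = \int[mu]_x g x.
Proof.
move=> mg gp; congr fine; apply: (torus_integral_shift_gen a (F := EFin \o g)).
  exact/measurable_EFinP.
by move=> k x /=; rewrite gp.
Qed.

Lemma intg_shift (a : rv) g : zperiodic g -> intg g -> intg (fun x => g (Defs.shift a x)).
Proof.
move=> gp ig; have mg := intg_measurable ig; move: ig => /integrableP[_ h]; apply/integrableP; split.
  apply/measurable_EFinP; apply: measurableT_comp => //; exact: measurable_shift.
rewrite (torus_integral_shift a (F := fun x => `|(g x)%:E|%E))//.
  by apply: measurableT_comp => //; exact/measurable_EFinP.
by move=> k x /=; rewrite gp.
Qed.

End torus_spaces.

(** * Arcs of the circle and their length *)

Section arcs.
Local Open Scope complex_scope.
Context (R : realType).

Lemma measurable_arc (a b : R) : measurable (Defs.arc a b).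
Proof.
rewrite (_ : Defs.arc a b = \bigcup_(k in [set: int]) `[a - k%:~R, b - k%:~R[%classic).
  apply: countable_bigcupT_measurable; first exact: countableP.
  by move=> k; exact: measurable_itv.
rewrite predeqE => x; split=> [[k h]|[k _ h]]; exists k => //; move: h; rewrite /= in_itv /=.
  by rewrite lerBlDr ltrBrDr.
by rewrite lerBlDr ltrBrDr.
Qed.

Lemma arc_addz (a b t : R) (k : int) : Defs.arc a b (t + k%:~R) <-> Defs.arc a b t.
Proof.
split=> -[l h]; first by exists (k + l); rewrite intrD addrA.
exists (l - k); have -> // : t + k%:~R + (l - k)%:~R = t + l%:~R.
by rewrite intrB; ring.
Qed.

Lemma arc_addr (a b s t : R) : Defs.arc (a + s) (b + s) (t + s) <-> Defs.arc a b t.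
Proof. by split=> -[k h]; exists k; move: h; rewrite addrAC lerD2r ltrD2r. Qed.

Lemma arc01 (a b t : R) : 0 <= a -> b <= 1 -> 0 <= t < 1 -> Defs.arc a b t <-> a <= t < b.
Proof.
move=> a0 b1 /andP[t0 t1]; split=> [[k /andP[h1 h2]]|h]; last by exists 0; rewrite addr0.
have k1 : k < 1 by rewrite -(ltr_int R); lra.
have k0 : -1 < k by rewrite -(ltr_int R) mulrN1z; lra.
have k00 : k = 0 by lia.
by move: h1 h2; rewrite k00 addr0 => -> ->.
Qed.

(** After rotation by a, the arc meets [0, 1) exactly in [0, b - a), without wrap-around. *)
Lemma uniform_arc (a b : R) : a < b -> b <= a + 1 ->
  uniform_prob (@ltr01 R) (Defs.arc a b) = (b - a)%:E.
Proof.
move=> ab ba.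
have mE (A : set R) : measurable A -> measurable_fun [set: R] (fun x : R => (\1_A x : R)%:E).
  by move=> mA; apply/measurable_EFinP; exact: measurable_indic.
have E (A : set R) : measurable A -> uniform_prob (@ltr01 R) A = (\int[uniform_prob (@ltr01 R)]_x (\1_A x : R)%:E)%E.
  by move=> mA; rewrite integral_indic// setIT.
have i01 (A : set R) (x : R) : (0%R <= (\1_A x : R)%:E)%E by rewrite lee_fin.
have mA := measurable_arc a b.
rewrite E// -(uniform_integral_shift a (mE _ mA))//; last first.
  move=> x k; congr EFin; rewrite !indicE; congr (nat_of_bool _)%:R.
  by apply/idP/idP => /set_mem/arc_addz/mem_set.
transitivity (uniform_prob (@ltr01 R) `[0, (b - a)[%classic); last first.
  by rewrite uniform_itv ?subr0//; lra.
rewrite [RHS]E// !uniform_integral//; last 2 first.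
- exact: mE.
- apply/measurable_EFinP; apply: (measurableT_comp (f := \1_(Defs.arc a b) : R -> R)).
    exact: measurable_indic.
  exact: measurable_addr.
apply: eq_integral => x; rewrite inE /= in_itv /= => x01; congr EFin.
rewrite !indicE; congr (nat_of_bool _)%:R.
have e : Defs.arc a b (x + a) <-> 0 <= x < b - a.
  have := arc_addr 0 (b - a) a x; rewrite add0r subrK => ->.
  by apply: arc01 => //; lra.
by apply/idP/idP => /set_mem h; apply/mem_set; move: h; rewrite /= in_itv /=; rewrite e.
Qed.

End arcs.

(** * Little bmo: translation invariance and restriction to dyadic rectangles *)

Section rectangle_osc.
Local Open Scope complex_scope.
Context (R : realType) (N : nat).
Local Notation mu := (torus_measure R N).
Local Notation rv := (rvec R N).
Implicit Types (g f u b : rv -> R) (Q : dyadic_rect N) (F : seq (dyadic_rect N)) (P : set rv).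

Definition arcbox (a b : rv) : set rv := box (fun i => Defs.arc (tnth a i) (tnth b i)).

Lemma measurable_rectangle P : rectangles P -> measurable P.
Proof. by move=> [a [b [_ ->]]]; apply: (@measurable_box R N (fun i => Defs.arc (tnth a i) (tnth b i))) => i; exact: measurable_arc. Qed.

Lemma vol_arcbox (a b : rv) : (forall i, tnth a i < tnth b i <= tnth a i + 1) ->
  vol (arcbox a b) = \prod_(i < N) (tnth b i - tnth a i).
Proof.
move=> ab; rewrite /vol torus_box; last by move=> i; exact: measurable_arc.
by apply: eq_bigr => i _; case/andP: (ab i) => h1 h2; rewrite uniform_arc.
Qed.

Lemma vol_gt0 P : rectangles P -> 0 < vol P.
Proof.
move=> [a [b [ab ->]]]; rewrite (vol_arcbox ab); apply: prodr_gt0 => i _.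
by rewrite subr_gt0; case/andP: (ab i).
Qed.

Lemma rectangle_periodic P : rectangles P -> zperiodic (\1_P : rv -> R).
Proof.
move=> [a [b [_ ->]]] k x; rewrite !indicE; congr (nat_of_bool _)%:R.
apply/idP/idP => /set_mem h; apply/mem_set => i; have := h i; rewrite tnth_mktuple tnth_mktuple.
  by move/arc_addz.
by move=> /= ?; apply/arc_addz.
Qed.

Lemma rectangle_shift P (a : rv) : rectangles P -> exists2 P' : set rv, rectangles P' &
  forall x, \1_P' (Defs.shift a x) = \1_P x :> R.
Proof.
move=> [l [r [lr ->]]]; exists (arcbox (Defs.shift a l) (Defs.shift a r)).
  exists (Defs.shift a l), (Defs.shift a r); split=> // i.
  by rewrite !tnth_mktuple ltrD2r addrAC lerD2r.
move=> x; rewrite !indicE; congr (nat_of_bool _)%:R.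
apply/idP/idP => /set_mem h; apply/mem_set => i; have := h i; rewrite /= !tnth_mktuple.
  by move/arc_addr.
by move=> ?; apply/arc_addr.
Qed.

Lemma RintegralE_in (D : set rv) g : \int[mu]_(x in D) g x = \int[mu]_x (g x * \1_D x).
Proof.
rewrite Rintegral_mkcond; apply: eq_Rintegral => x _; rewrite patchE indicE.
by case: ifP => _; rewrite ?mulr1 ?mulr0.
Qed.

Lemma volE P : measurable P -> vol P = \int[mu]_x (\1_P x : R).
Proof. by move=> mP; rewrite RintegralEindic. Qed.

Lemma vol_shift P P' (a : rv) : rectangles P -> rectangles P' ->
  (forall x, \1_P' (Defs.shift a x) = \1_P x :> R) -> vol P' = vol P.
Proof.
move=> rP rP' e; rewrite !volE; [|exact: measurable_rectangle..].
rewrite -(Rintegral_shift a (g := \1_P'))//; last exact: rectangle_periodic.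
  by apply: eq_Rintegral => x _; exact: e.
by apply: measurable_indic; exact: measurable_rectangle.
Qed.

Lemma measurable_indic_rectangle P : rectangles P -> measurable_fun setT (\1_P : rv -> R).
Proof. by move=> rP; apply: measurable_indic; exact: measurable_rectangle. Qed.

Lemma Re_mean P (f : rv -> R[i]) : complex.Re (mean P f) = (vol P)^-1 * \int[mu]_x (complex.Re (f x) * \1_P x).
Proof. by rewrite /mean cReM /= mul0r subr0 RintegralE_in. Qed.

Lemma Im_mean P (f : rv -> R[i]) : complex.Im (mean P f) = (vol P)^-1 * \int[mu]_x (complex.Im (f x) * \1_P x).
Proof. by rewrite /mean cImM /= mul0r addr0 RintegralE_in. Qed.

Lemma torus_funB (f : rv -> R[i]) (c : R[i]) : torus_fun f -> torus_fun (fun x => f x - c).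
Proof.
move=> [fp mr mi]; split=> [k x||]; first by rewrite fp.
- rewrite (_ : (fun x => _) = fun x => complex.Re (f x) - complex.Re c); last by apply/funext => x; rewrite cReB.
  by apply: measurable_funB.
- rewrite (_ : (fun x => _) = fun x => complex.Im (f x) - complex.Im c); last by apply/funext => x; rewrite cImB.
  by apply: measurable_funB.
Qed.

Lemma intg_cabsB (f : rv -> R[i]) (c : R[i]) : Lp_torus R N 2%:E f -> intg (fun x => cabs (f x - c)).
Proof.
move=> /Lp2P[tf lr li].
have h1 : intg (fun x => complex.Re (f x) - complex.Re c) by apply: intgB; [exact: l2_intg|exact: intg_cst].
have h2 : intg (fun x => complex.Im (f x) - complex.Im c) by apply: intgB; [exact: l2_intg|exact: intg_cst].
apply: (le_intg _ (intgD (intg_norm h1) (intg_norm h2))).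
  by apply: measurable_cabs; exact: torus_funB.
move=> x; rewrite ger0_norm ?cabs_ge0// ger0_norm ?addr_ge0//.
by apply: le_trans (cabs_le _) _; rewrite cReB cImB.
Qed.

Lemma little_bmoP (f : rv -> R[i]) : little_bmo R N f <-> Lp_torus R N 2%:E f /\
  exists B, forall P, rectangles P -> \int[mu]_x (cabs (f x - mean P f) * \1_P x) <= B * vol P.
Proof.
have E P : Lp_torus R N 2%:E f -> rectangles P ->
    (((vol P)^-1)%:E * \int[mu]_(t in P) (cabs (f t - mean P f))%:E =
    ((vol P)^-1 * \int[mu]_x (cabs (f x - mean P f) * \1_P x))%:E)%E.
  move=> lf rP; rewrite EFinM; congr (_ * _)%E.
  rewrite RintegralE; last first.
    apply: intgM; [exact: intg_cabsB|exact: measurable_indic_rectangle|exact: indic_bounded].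
  rewrite integral_mkcond; apply: eq_integral => x _; rewrite patchE indicE.
  by case: ifP => _; rewrite ?mulr1 ?mulr0.
split=> [[lf h]|[lf [B HB]]]; split=> //.
  set s := ereal_sup _ in h.
  exists (fine s) => P rP; rewrite mulrC -ler_pdivrMl ?vol_gt0// -lee_fin.
  have le_s : (((vol P)^-1 * \int[mu]_x (cabs (f x - mean P f) * \1_P x))%:E <= s)%E.
    by rewrite -E//; apply: ereal_sup_ubound; exists P.
  rewrite fineK// fin_numElt h andbT; apply: lt_le_trans le_s; exact: ltNyr.
apply: (@le_lt_trans _ _ B%:E); last exact: ltry.
apply: ge_ereal_sup => _ [P rP <-]; rewrite E// lee_fin ler_pdivrMl ?vol_gt0//.
by rewrite mulrC HB.
Qed.

Lemma torus_fun_translate (a : rv) (f : rv -> R[i]) : torus_fun f -> torus_fun (translate a f).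
Proof.
move=> [fp mr mi]; split=> [k x||].
- rewrite /translate /= -[RHS](fp k); congr f; apply: eq_from_tnth => i.
  by rewrite !tnth_mktuple addrAC.
- exact: (measurableT_comp mr (measurable_shift a)).
- exact: (measurableT_comp mi (measurable_shift a)).
Qed.

Lemma l2_shift (a : rv) g : zperiodic g -> l2 g -> l2 (fun x => g (Defs.shift a x)).
Proof.
move=> gp [mg ig]; split; first exact: (measurableT_comp mg (measurable_shift a)).
by apply: (intg_shift a (g := fun x => g x ^+ 2)) => // k x; rewrite gp.
Qed.

Lemma Lp2_translate (a : rv) (f : rv -> R[i]) : Lp_torus R N 2%:E f -> Lp_torus R N 2%:E (translate a f).
Proof.
move=> /Lp2P[tf lr li]; have [fp _ _] := tf; apply/Lp2P; split; first exact: torus_fun_translate.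
  by apply: (l2_shift a (g := fun x => complex.Re (f x))) => // k x; rewrite fp.
by apply: (l2_shift a (g := fun x => complex.Im (f x))) => // k x; rewrite fp.
Qed.

Lemma little_bmo_translate (a : rv) (f : rv -> R[i]) :
  little_bmo R N f -> little_bmo R N (translate a f).
Proof.
move=> /little_bmoP[lf [B HB]]; apply/little_bmoP; split; first exact: Lp2_translate.
have [tf lr li] := (Lp2P f).1 lf; have [fp mr mi] := tf.
exists B => P rP; have [P' rP' e] := rectangle_shift a rP.
have pP := rectangle_periodic rP'.
have -> : mean P (translate a f) = mean P' f.
  apply/eqP; rewrite eq_complex !Re_mean !Im_mean (vol_shift rP rP' e); apply/andP; split; apply/eqP; congr (_ * _).
    rewrite -(Rintegral_shift a (g := fun x => complex.Re (f x) * \1_P' x)).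
    - by apply: eq_Rintegral => x _; rewrite e.
    - by apply: measurable_funM => //; exact: measurable_indic_rectangle.
    - by move=> k x; rewrite fp pP.
  rewrite -(Rintegral_shift a (g := fun x => complex.Im (f x) * \1_P' x)).
  - by apply: eq_Rintegral => x _; rewrite e.
  - by apply: measurable_funM => //; exact: measurable_indic_rectangle.
  - by move=> k x; rewrite fp pP.
rewrite -(vol_shift rP rP' e); apply: le_trans (HB P' rP').
rewrite -[leRHS](Rintegral_shift a (g := fun x => cabs (f x - mean P' f) * \1_P' x)).
- by rewrite le_eqVlt; apply/orP; left; apply/eqP; apply: eq_Rintegral => x _; rewrite e.
- apply: measurable_funM; last exact: measurable_indic_rectangle.
  by apply: measurable_cabs; exact: torus_funB.
- by move=> k x; rewrite fp pP.
Qed.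

Lemma dyadic_rectangle Q : exists2 P : set rv, rectangles P &
  forall x, cube R N x -> \1_P x = \1_(rect_set Q) x :> R.
Proof.
pose l : rv := [tuple dleft R (tnth Q i) | i < N].
pose r : rv := [tuple dright R (tnth Q i) | i < N].
have l0 i : 0 <= dleft R (tnth Q i) by rewrite /dleft mulr_ge0// ltW// dlen_gt0.
have r1 i : dright R (tnth Q i) <= 1.
  move: (tnth Q i) => [j k]; rewrite /dright /dleft /dlen /=.
  have h3 : k.+1%:R * 2^-1 ^+ j <= 1 :> R.
    by rewrite exprVn ler_pdivrMr ?exprn_gt0// mul1r -natrX ler_nat.
  by rewrite -[k.+1%:R]natr1 mulrDl mul1r in h3.
exists (arcbox l r).
  exists l, r; split=> // i; rewrite !tnth_mktuple; apply/andP; split.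
    by rewrite /dright ltrDl dlen_gt0.
  by apply: le_trans (r1 i) _; rewrite lerDr.
move=> x Cx; rewrite !indicE; congr (nat_of_bool _)%:R.
have e i : Defs.arc (tnth l i) (tnth r i) (tnth x i) <-> dleft R (tnth Q i) <= tnth x i < dright R (tnth Q i).
  by rewrite !tnth_mktuple; apply: arc01 => //; have := Cx i; rewrite /= in_itv.
apply/idP/idP => /set_mem h; apply/mem_set => i; have := h i; rewrite /= in_itv /=.
  by move/e.
by move=> ?; apply/e.
Qed.

Lemma little_bmo_dyadic (f : rv -> R[i]) : little_bmo R N f -> exists2 B, 0 <= B & forall Q,
  rmean (fun x => `|complex.Re (f x) - rmean (fun x => complex.Re (f x)) Q|) Q <= B /\
  rmean (fun x => `|complex.Im (f x) - rmean (fun x => complex.Im (f x)) Q|) Q <= B.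
Proof.
move=> /little_bmoP[lf [B HB]]; exists `|B| => // Q.
have [tf lr li] := (Lp2P f).1 lf; have [fp mr mi] := tf.
have [P rP e] := dyadic_rectangle Q.
have cubeE g : measurable_fun setT g -> \int[mu]_x (g x * \1_P x) = \int[mu]_x (g x * \1_(rect_set Q) x).
  move=> mg; apply: eq_cube => [||x /e ->//].
    by apply: measurable_funM => //; exact: measurable_indic_rectangle.
  by apply: measurable_funM => //; exact: measurable_indic_rect.
have vE : vol P = rvol R Q.
  rewrite volE; last exact: measurable_rectangle.
  rewrite (@eq_cube _ _ _ (\1_(rect_set Q)))//; [|exact: measurable_indic_rectangle|exact: measurable_indic_rect].
  by rewrite RintegralEindic ?mu_rect//; exact: measurable_rect.
have rE : complex.Re (mean P f) = rmean (fun x => complex.Re (f x)) Q.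
  by rewrite Re_mean vE cubeE.
have iE : complex.Im (mean P f) = rmean (fun x => complex.Im (f x)) Q.
  by rewrite Im_mean vE cubeE.
have HB' := HB P rP.
(* Serves for both real and imaginary parts, each dominated by [cabs]. *)
have key (h : R[i] -> R) : (forall z, `|h z| <= cabs z) -> measurable_fun setT (fun x => h (f x - mean P f)) ->
    rmean (fun x => `|h (f x - mean P f)|) Q <= `|B|.
  move=> hz mh; rewrite /rmean -vE ler_pdivrMl ?vol_gt0// -cubeE; last exact: measurableT_comp.
  rewrite mulrC; apply: (@le_trans _ _ (B * vol P)); last first.
    by rewrite ler_pM2r ?vol_gt0// ler_norm.
  apply: le_trans HB'.
  have ic := intg_cabsB (mean P f) lf.
  have icP : intg (fun x => cabs (f x - mean P f) * \1_P x).
    by apply: intgM => //; [exact: measurable_indic_rectangle|exact: indic_bounded].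
  apply: le_int => //.
    apply: (le_intg _ icP); first by apply: measurable_funM; [exact: measurableT_comp|exact: measurable_indic_rectangle].
    move=> x; rewrite !normrM normr_id ler_wpM2r// (ger0_norm (cabs_ge0 _)); exact: hz.
  by move=> x; rewrite ler_wpM2r// ?hz// indicE.
split.
  rewrite -rE; have := key (@complex.Re R) (@Re_cabs R).
  under [X in measurable_fun _ X]eq_fun do rewrite cReB.
  rewrite (_ : (fun x => `|complex.Re (f x - mean P f)|) = (fun x => `|complex.Re (f x) - complex.Re (mean P f)|)).
    by apply; exact: measurable_funB.
  by apply/funext => x; rewrite cReB.
rewrite -iE; have := key (@complex.Im R) (@Im_cabs R).
under [X in measurable_fun _ X]eq_fun do rewrite cImB.
rewrite (_ : (fun x => `|complex.Im (f x - mean P f)|) = (fun x => `|complex.Im (f x) - complex.Im (mean P f)|)).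
  by apply; exact: measurable_funB.
by apply/funext => x; rewrite cImB.
Qed.

End rectangle_osc.

(** * Haar coefficients and dyadic product BMO *)

Section torus_opens.
Context (R : realType) (N : nat).
Local Notation rv := (rvec R N).
Local Notation mu := (torus_measure R N).
Implicit Types (Omega : set rv) (Q : dyadic_rect N) (F : seq (dyadic_rect N)).

Definition ratbox (p : N.-tuple rat * nat) : set rv :=
  [set y | forall i, `|tnth y i - ratr (tnth p.1 i)| < (p.2.+1%:R)^-1].

Lemma measurable_ratbox p : measurable (ratbox p).
Proof.
rewrite (_ : ratbox p = box (fun i => `]ratr (tnth p.1 i) - (p.2.+1%:R)^-1, ratr (tnth p.1 i) + (p.2.+1%:R)^-1[%classic)).
  by apply: measurable_box => i; exact: measurable_itv.
by rewrite predeqE => y; split=> h i; have := h i; rewrite /= in_itv /= ltr_distl.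
Qed.

(** The sigma-algebra on tuples comes from the coordinates, not from a topology; a countable cover
    by rational cubes links it to openness. *)
Lemma torus_open_measurable Omega : torus_open Omega -> measurable Omega.
Proof.
move=> [_ oO].
rewrite (_ : Omega = \bigcup_p (if `[< ratbox p `<=` Omega >] then ratbox p else set0)).
  apply: countable_bigcupT_measurable; first exact: countableP.
  by move=> p; case: ifP => // _; exact: measurable_ratbox.
rewrite predeqE => x; split=> [Ox|[p _]]; last by case: ifP => // /asboolP h /h.
pose v : 'rV[R]_N := \row_i tnth x i.
have vE : [tuple v ord0 i | i < N] = x by apply: eq_from_tnth => i; rewrite tnth_mktuple mxE.
have : nbhs v [set v : 'rV[R]_N | Omega [tuple v ord0 i | i < N]].
  by apply: open_nbhs_nbhs; split=> //=; rewrite vE.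
move=> /nbhs_ballP[e /= e0 he].
(* Half of the radius: the cube is centered at a rational point c near x, and two distances, x to c
   and c to y, add up. *)
have [n _ /(_ n (leqnn n)) /= h0] := near_infty_natSinv_lt (PosNum (divr_gt0 e0 (ltr0Sn R 1))).
have {h0} nE : n.+1%:R^-1 < e / 2 := h0.
have hc0 (i : 'I_N) : exists c : rat, `|tnth x i - ratr c| < (n.+1%:R)^-1.
  have [|c] := @rat_in_itvoo R (tnth x i - (n.+1%:R)^-1) (tnth x i + (n.+1%:R)^-1).
    have : 0 < (n.+1%:R : R)^-1 by rewrite invr_gt0.
    by move=> h1; apply: (@lt_trans _ _ (tnth x i)); [rewrite ltrBlDr ltrDl|rewrite ltrDl].
  by rewrite in_itv /= => h; exists c; rewrite distrC ltr_distl.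
have [c hc1] := choice hc0; pose c' : N.-tuple rat := [tuple c i | i < N].
exists (c', n) => //; case: ifPn => [_ i|/asboolP []]; first by rewrite /= tnth_mktuple.
move=> y hy; have -> : y = [tuple (\row_i tnth y i : 'rV[R]_N) ord0 i | i < N].
  by apply: eq_from_tnth => i; rewrite tnth_mktuple mxE.
apply: (he (\row_i tnth y i)); split=> // i j; rewrite !mxE /ball /=.
have := hy j; have := hc1 j; rewrite /= tnth_mktuple => h1 h2.
rewrite (_ : tnth x j - tnth y j = (tnth x j - ratr (c j)) - (tnth y j - ratr (c j))); last by ring.
apply: le_lt_trans (ler_normB _ _) _; apply: lt_trans (ltrD h1 h2) _.
by rewrite [ltRHS]splitr ltrD.
Qed.

(** Half-open sides are already open on the right, so only left ends move. All integer translates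
    are included to obtain a subset of the torus. *)
Definition enlarge F (d : R) : set rv := [set x | exists2 Q, Q \in F & exists k : N.-tuple int,
  forall i, dleft R (tnth Q i) - d < tnth x i + (tnth k i)%:~R < dright R (tnth Q i)].

Lemma enlarge_open F d : torus_open (enlarge F d).
Proof.
split=> [k x|].
  split=> -[Q QF [l h]]; exists Q => //.
    exists [tuple tnth k i + tnth l i | i < N] => i; have := h i.
    by rewrite !tnth_mktuple intrD addrA.
  exists [tuple tnth l i - tnth k i | i < N] => i; have := h i.
  rewrite !tnth_mktuple intrB (_ : tnth x i + _ + _ = tnth x i + (tnth l i)%:~R)//; ring.
rewrite openE => v [Q QF [k h]].
have : nbhs v (fun w : 'rV[R]_N => forall i, dleft R (tnth Q i) - d < w ord0 i + (tnth k i)%:~R < dright R (tnth Q i)).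
  apply: (@filter_forall _ _ (fun i (w : 'rV[R]_N) => dleft R (tnth Q i) - d < w ord0 i + (tnth k i)%:~R < dright R (tnth Q i)) _ (nbhs_filter v)) => i.
  rewrite nearE; apply/nbhs_ballP.
  have := h i; rewrite tnth_mktuple => /andP[h1 h2].
  exists (Num.min (v ord0 i + (tnth k i)%:~R - (dleft R (tnth Q i) - d)) (dright R (tnth Q i) - (v ord0 i + (tnth k i)%:~R))).
    by rewrite /= lt_min !subr_gt0 h1.
  move=> w [_ /(_ ord0 i)]; rewrite /ball /= lt_min !ltr_distlC => /andP[/andP[a1 a2] /andP[a3 a4]].
  by apply/andP; split; lra.
apply: filterS => w hw; exists Q => //; exists k => i.
by have := hw i; rewrite tnth_mktuple.
Qed.

Lemma sub_enlarge F d Q : 0 < d -> Q \in F -> rect_set Q `<=` enlarge F d.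
Proof.
move=> d0 QF x Qx; exists Q => //; exists [tuple 0 | i < N] => i; rewrite tnth_mktuple addr0.
have := Qx i; rewrite /= in_itv /= => /andP[h ->]; rewrite andbT.
by apply: lt_le_trans h; lra.
Qed.

(** For a fixed x in the cube, the finitely many conditions leave some e > 0 below which neither
    integer translates nor displaced left ends can capture x wrongly. *)
Lemma enlarge_cap F x : cube R N x -> (forall n, enlarge F (n.+1%:R^-1) x) -> runion F x.
Proof.
move=> Cx H.
have [e e0 he] : exists2 e : R, 0 < e & forall Q, Q \in F -> forall (k : int) i,
    dleft R (tnth Q i) - e < tnth x i + k%:~R < dright R (tnth Q i) ->
    dleft R (tnth Q i) <= tnth x i < dright R (tnth Q i).
  have key Q i : exists2 e : R, 0 < e & forall (k : int),
    dleft R (tnth Q i) - e < tnth x i + k%:~R < dright R (tnth Q i) ->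
    dleft R (tnth Q i) <= tnth x i < dright R (tnth Q i).
    have := Cx i; rewrite /= in_itv /= => /andP[x0 x1].
    have l0 : 0 <= dleft R (tnth Q i) by rewrite /dleft mulr_ge0// ltW// dlen_gt0.
    have r1 : dright R (tnth Q i) <= 1.
      case: (tnth Q i) => j k; rewrite /dright /dleft /dlen /=.
      rewrite -[X in _ + X]mul1r -mulrDl exprVn ler_pdivrMr ?exprn_gt0// mul1r.
      by rewrite natr1 -natrX ler_nat.
    (* The bound 1 - x_i excludes negative translates, positive ones passing the right end anyway;
       the other bound excludes points to the left of the side. *)
    set e := if tnth x i < dleft R (tnth Q i) then Num.min (1 - tnth x i) (dleft R (tnth Q i) - tnth x i) else 1 - tnth x i.
    have e0 : 0 < e.
      rewrite /e; case: ifP => h; last by lra.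
      by rewrite lt_min; apply/andP; split; lra.
    have e1 : e <= 1 - tnth x i by rewrite /e; case: ifP => // _; rewrite ge_min lexx.
    exists e => // k /andP[h1 h2].
    have k0 : -1 < k by rewrite -(ltr_int R) mulrN1z; lra.
    have k1 : k < 1 by rewrite -(ltr_int R); lra.
    have kk : k = 0 by lia.
    move: h1 h2; rewrite kk addr0 => h1 ->; rewrite andbT leNgt; apply/negP => h.
    have : e <= dleft R (tnth Q i) - tnth x i by rewrite /e h ge_min lexx orbT.
    by lra.
  elim: F {H} => [|Q F [e e0 he]]; first by exists 1.
  have [g g0 hg] : exists2 g : R, 0 < g & forall (k : int) i,
    dleft R (tnth Q i) - g < tnth x i + k%:~R < dright R (tnth Q i) ->
    dleft R (tnth Q i) <= tnth x i < dright R (tnth Q i).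
    have [g hg] := choice (fun i => (let: ex_intro2 e a b := key Q i in ex_intro _ e (conj a b))).
    exists (\big[Num.min/1]_i g i).
      by apply: (big_ind (fun u => 0 < u)) => // [u w u0 w0|i _]; [rewrite lt_min u0|exact: (hg i).1].
    move=> k i /andP[h1 h2]; apply: ((hg i).2 k); rewrite h2 andbT.
    by apply: le_lt_trans h1; rewrite lerD2l lerN2 bigmin_le_cond.
  exists (Num.min e g); first by rewrite lt_min e0.
  move=> Q'; rewrite inE => /predU1P[->|QF] k i /andP[h1 h2].
    by apply: (hg k); rewrite h2 andbT; apply: le_lt_trans h1; rewrite lerD2l lerN2 ge_min lexx orbT.
  by apply: (he _ QF k); rewrite h2 andbT; apply: le_lt_trans h1; rewrite lerD2l lerN2 ge_min lexx.
have [n _ /(_ n (leqnn n)) /= nE] := near_infty_natSinv_lt (PosNum e0).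
have [Q QF [k h]] := H n; exists Q => // i; rewrite /= in_itv /=.
apply: (he _ QF (tnth k i)); have /andP[h1 ->] := h i; rewrite andbT.
by apply: le_lt_trans h1; rewrite lerD2l lerN2 ltW.
Qed.

Lemma mu_cubeI (A : set rv) : measurable A -> mu (A `&` cube R N) = mu A.
Proof.
move=> mA; have mC : measurable (cube R N) by exact: measurable_cube.
apply/eqP; rewrite eq_le le_measure ?inE//=; last exact: measurableI.
rewrite -[X in (_ <= X)%E]adde0 -(torus_cubeC R N).
apply: (@le_trans _ _ (mu ((A `&` cube R N) `|` ~` cube R N))).
  apply: le_measure; rewrite ?inE//.
    by apply: measurableU; [exact: measurableI|exact: measurableC].
  by move=> x Ax; have [Cx|Cx] := pselect (cube R N x); [left|right].
by apply: measureU2; [exact: measurableI|exact: measurableC].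
Qed.

(** Continuity from above along d = 1/(n+1), after intersecting with the cube, where the
    enlargements decrease to [runion F]. *)
Lemma mu_enlarge F (e : R) : 0 < e ->
  exists2 d : R, 0 < d & fine (mu (enlarge F d)) <= fine (mu (runion F)) + e.
Proof.
move=> e0; pose U n := enlarge F (n.+1%:R^-1 : R) `&` cube R N.
have mU n : measurable (U n).
  by apply: measurableI; [apply: torus_open_measurable; exact: enlarge_open|exact: measurable_cube].
have capU : \bigcap_n U n = runion F.
  rewrite predeqE => x; split=> [h|[Q QF Qx] n _].
    by apply: enlarge_cap => [|n]; [exact: (h 0%N I).2|exact: (h n I).1].
  split; first by apply: (sub_enlarge _ QF) => //; rewrite invr_gt0.
  exact: rect_set_cube Qx.
have dU : {homo U : n m / (n <= m)%N >-> (m <= n)%O}.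
  move=> n m nm; apply/subsetPset => x [[Q QF [k h]] Cx]; split=> //; exists Q => //; exists k => i.
  have /andP[h1 ->] := h i; rewrite andbT; apply: le_lt_trans h1.
  by rewrite lerD2l lerN2 lef_pV2 ?posrE// ler_nat.
have finU n : mu (U n) \is a fin_num by exact: fin_num_measure.
have mF := @measurable_runion R N F.
have := @nonincreasing_cvg_mu _ _ _ mu U _ mU.
rewrite capU => /(_ _ mF dU) h.
have /h {}h : (mu (U 0%N) < +oo)%E by rewrite ltey_eq finU.
have /fine_cvgP[_ /cvgrPdist_le /(_ e e0) [n _ /(_ n (leqnn n)) /= H]] : (mu \o U) n @[n --> \oo] --> (fine (mu (runion F)))%:E.
  by rewrite fineK ?fin_num_measure.
exists (n.+1%:R^-1); first by rewrite invr_gt0.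
rewrite -lerBlDl -(mu_cubeI (torus_open_measurable (enlarge_open _ _))).
by apply: le_trans H; rewrite distrC ler_norm.
Qed.

End torus_opens.

(** * The dyadic BMO norm through finite families of rectangles *)

Section BMOd_criteria.
Local Open Scope complex_scope.
Context (R : realType) (N : nat).
Local Notation rv := (rvec R N).
Local Notation mu := (torus_measure R N).
Implicit Types (Omega : set rv) (Q : dyadic_rect N) (F : seq (dyadic_rect N)) (c : dyadic_rect N -> R[i]).

Lemma Re_haar_coef (f : rv -> R[i]) Q : complex.Re (haar_coef f Q) = hc (fun x => complex.Re (f x)) Q.
Proof. by rewrite /haar_coef /cintegral /hc /=; apply: eq_Rintegral => x _; rewrite cReM /= mulr0 subr0. Qed.

Lemma Im_haar_coef (f : rv -> R[i]) Q : complex.Im (haar_coef f Q) = hc (fun x => complex.Im (f x)) Q.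
Proof. by rewrite /haar_coef /cintegral /hc /=; apply: eq_Rintegral => x _; rewrite cImM /= mulr0 add0r. Qed.

Lemma fsets_seq Omega (A : set (dyadic_rect N)) c : fsets [set Q | rect_set Q `<=` Omega] A ->
  exists F, [/\ uniq F, (forall Q, Q \in F -> rect_set Q `<=` Omega) &
    (\sum_(Q \in A) (cabs (c Q) ^+ 2)%:E)%R = (\sum_(Q <- F) cabs (c Q) ^+ 2)%:E].
Proof.
move=> [fA sA]; exists (finmap.enum_fset (fset_set A)); split.
- exact: finmap.fset_uniq.
- by move=> Q QA; apply: sA; move: QA; rewrite in_fset_set// => /set_mem.
- by rewrite fsbig_finite//= sumEFin.
Qed.

Lemma BMOd_norm_le c (C : R) : 0 <= C ->
  (forall F, uniq F -> \sum_(Q <- F) cabs (c Q) ^+ 2 <= C ^+ 2 * fine (mu (runion F))) ->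
  (BMOd_norm c <= C%:E)%E.
Proof.
move=> C0 H; rewrite /BMOd_norm.
rewrite (_ : C%:E = sqrte (C ^+ 2)%:E); last by rewrite /sqrte sqrtr_sqr ger0_norm.
rewrite lee_sqrt ?lee_fin ?sqr_ge0//; apply: ge_ereal_sup => _ [ Omega [oO _] <-].
have mO := torus_open_measurable oO.
have V0 : 0 <= vol Omega by apply: fine_ge0.
(* With the convention that the inverse of 0 is 0, the quotient vanishes. *)
have [V|V] := eqVneq (vol Omega) 0; first by rewrite V invr0 mul0e lee_fin sqr_ge0.
have Vp : 0 < vol Omega by rewrite lt_neqAle eq_sym V.
rewrite muleC lee_pdivrMr//; apply: ge_ereal_sup => _ [A fA <-].
have [F [uF sF ->]] := fsets_seq c fA.
rewrite lee_fin; apply: le_trans (H F uF) _; rewrite ler_wpM2l ?sqr_ge0//.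
apply: fine_le; [exact: fin_num_measure (measurable_runion F)|exact: fin_num_measure|].
apply: le_measure; rewrite ?inE//; first exact: measurable_runion.
by move=> x [Q QF Qx]; exact: (sF Q QF x Qx).
Qed.

(** The norm tests open sets whereas [runion F] is half-open: it is applied to [enlarge F d], whose
    extra measure is arbitrarily small. *)
Lemma BMOd_norm_fin c (C : R) F : 0 <= C -> (BMOd_norm c <= C%:E)%E -> uniq F ->
  \sum_(Q <- F) cabs (c Q) ^+ 2 <= C ^+ 2 * fine (mu (runion F)).
Proof.
move=> C0 H uF.
have [F0|[Q0 QF]] : F = [::] \/ exists Q, Q \in F.
  by case: F {uF} => [|Q F]; first (by left); right; exists Q; exact: mem_head.
  by rewrite F0 big_nil mulr_ge0 ?sqr_ge0// fine_ge0.
have m0 := runion_gt0 R QF.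
apply/ler_addgt0Pl => e e0.
(* The 1 keeps the divisor positive when C = 0. *)
have Cp : 0 < C ^+ 2 + 1 by rewrite ltr_wpDl ?sqr_ge0.
have [d d0 hd] := mu_enlarge F (divr_gt0 e0 Cp).
set Omega := enlarge F d; have oO : torus_open Omega by exact: enlarge_open.
have mO := torus_open_measurable oO.
have Vp : 0 < vol Omega.
  apply: lt_le_trans m0 _; apply: fine_le; [exact: fin_num_measure (measurable_runion F)|exact: fin_num_measure|].
  apply: le_measure; rewrite ?inE//; first exact: measurable_runion.
  by move=> x [Q QF' Qx]; exact: (sub_enlarge d0 QF' Qx).
have ne : Omega !=set0.
  have [x Qx] : exists x : rv, rect_set Q0 x.
    apply/(@set0P _ (rect_set Q0))/eqP => Q0e; have := mu_rect R Q0; rewrite Q0e measure0 => -[/esym/eqP].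
    by rewrite gt_eqF// rvol_gt0.
  by exists x; exact: (sub_enlarge d0 QF Qx).
have : (((vol Omega)^-1)%:E * (\esum_(Q in [set Q | rect_set Q `<=` Omega]) ((cabs (c Q)) ^+ 2)%:E) <= (C ^+ 2)%:E)%E.
  have := H; rewrite /BMOd_norm.
  set s := ereal_sup _ => hs.
  have s0 : (0 <= s)%E.
    apply: (@le_trans _ _ (((vol Omega)^-1)%:E * (\esum_(Q in [set Q | rect_set Q `<=` Omega]) ((cabs (c Q)) ^+ 2)%:E))%E); last first.
      by apply: ereal_sup_ubound; exists Omega.
    by apply: mule_ge0; [rewrite lee_fin invr_ge0 ltW|apply: esum_ge0 => Q _; rewrite lee_fin sqr_ge0].
  apply: (@le_trans _ _ s); first by apply: ereal_sup_ubound; exists Omega.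
  by rewrite -(sqr_sqrte s0) EFin_expe lee_sqr// sqrte_ge0.
rewrite muleC lee_pdivrMr// => h.
have : ((\sum_(Q <- F) cabs (c Q) ^+ 2)%:E <= (C ^+ 2)%:E * (vol Omega)%:E)%E.
  apply: le_trans h; apply: esum_ge; exists [set` F].
    by split; [exact: finite_seq|move=> Q /= QF'; exact: (sub_enlarge d0 QF')].
  by rewrite -fsbig_seq//= sumEFin.
rewrite -EFinM lee_fin => /le_trans; apply.
apply: le_trans (ler_wpM2l (sqr_ge0 C) hd) _.
rewrite mulrDr addrC lerD2r mulrA ler_pdivrMr// mulrDr mulr1 mulrC lerDl.
exact: ltW.
Qed.

Lemma BMOdP (f : rv -> R[i]) : BMOd f <-> Lp_torus R N 2%:E f /\ exists2 C, 0 <= C & forall F, uniq F ->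
  \sum_(Q <- F) (hc (fun x => complex.Re (f x)) Q ^+ 2 + hc (fun x => complex.Im (f x)) Q ^+ 2)
    <= C * fine (mu (runion F)).
Proof.
have E F : \sum_(Q <- F) (hc (fun x => complex.Re (f x)) Q ^+ 2 + hc (fun x => complex.Im (f x)) Q ^+ 2)
    = \sum_(Q <- F) cabs (haar_coef f Q) ^+ 2.
  by apply: eq_bigr => Q _; rewrite cabs_sqr Re_haar_coef Im_haar_coef.
split=> -[lf]; last first.
  move=> [C C0 H]; split=> //; apply: (@le_lt_trans _ _ (Num.sqrt C)%:E); last exact: ltry.
  by apply: BMOd_norm_le => [|F uF]; rewrite ?sqrtr_ge0// sqr_sqrtr// -E; exact: H.
move=> h; split=> //.
have h0 : (0 <= BMOd_norm (haar_coef f))%E by exact: sqrte_ge0.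
exists (fine (BMOd_norm (haar_coef f)) ^+ 2); first exact: sqr_ge0.
move=> F uF; rewrite E; apply: BMOd_norm_fin => //; first exact: fine_ge0.
by rewrite fineK// ge0_fin_numE.
Qed.

End BMOd_criteria.

(** * Bounded LMO functions are multipliers *)

Section superset.
Local Open Scope complex_scope.
Context (R : realType) (N : nat).
Local Notation rv := (rvec R N).
Local Notation mu := (torus_measure R N).
Implicit Types (Q : dyadic_rect N) (F : seq (dyadic_rect N)) (g f p b : rv -> R).

Lemma measurable_clip (M : R) p : measurable_fun setT p -> measurable_fun setT (fun x => clip M (p x)).
Proof.
move=> mp; apply: measurable_maxr; first exact: measurable_cst.
by apply: measurable_minr => //; exact: measurable_cst.
Qed.

Lemma ae_Rintegral g f : measurable_fun setT g -> measurable_fun setT f ->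
  {ae mu, forall x, g x = f x} -> \int[mu]_x g x = \int[mu]_x f x.
Proof.
move=> mg mf gf; congr fine; apply: ae_eq_integral => //; try exact/measurable_EFinP.
by apply: filterS gf => x /= -> _.
Qed.

Lemma ae_intg g f : intg f -> measurable_fun setT g -> {ae mu, forall x, g x = f x} -> intg g.
Proof.
move=> jf mg gf; have mf := intg_measurable jf; move: jf => /integrableP[_ h].
have mE (u : rv -> R) : measurable_fun setT u -> measurable_fun setT (fun x => `|(u x)%:E|%E : \bar R).
  by move=> mu_; apply: measurableT_comp => //; exact/measurable_EFinP.
apply/integrableP; split; first exact/measurable_EFinP.
rewrite (@ge0_ae_eq_integral _ _ _ mu setT _ (fun x => `|(f x)%:E|%E))//; try exact: mE.
by apply: filterS gf => x /= -> _.
Qed.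

Lemma l2M_ae p b (M : R) : 0 <= M -> measurable_fun setT p -> {ae mu, forall x, `|p x| <= M} -> l2 b ->
  l2 (fun x => p x * b x).
Proof.
move=> M0 mp pM lb; have mc := measurable_clip M mp.
have [_ h] := l2M_bounded lb mc (fun x => clip_le (p x) M0).
split; first by apply: measurable_funM => //; exact: lb.1.
apply: (ae_intg h); first by apply: measurable_funX; apply: measurable_funM => //; exact: lb.1.
by apply: filterS pM => x /clip_id /= ->; rewrite mulrC.
Qed.

Lemma hcD g f Q : intg g -> intg f -> hc (fun x => g x + f x) Q = hc g Q + hc f Q.
Proof.
move=> ig jf; rewrite /hc -RintegralD//.
- by apply: eq_Rintegral => x _; rewrite mulrDl.
- by apply: intgM => //; [exact: measurable_haar|exact: bounded_haar].
- by apply: intgM => //; [exact: measurable_haar|exact: bounded_haar].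
Qed.

Lemma hcZ (a : R) g Q : intg g -> hc (fun x => a * g x) Q = a * hc g Q.
Proof.
move=> ig; rewrite /hc -RintegralZl//; last by apply: intgM => //; [exact: measurable_haar|exact: bounded_haar].
by apply: eq_Rintegral => x _; rewrite mulrA.
Qed.

Lemma ae_hc g f Q : measurable_fun setT g -> measurable_fun setT f ->
  {ae mu, forall x, g x = f x} -> hc g Q = hc f Q.
Proof.
move=> mg mf gf; apply: ae_Rintegral; try (by apply: measurable_funM => //; exact: measurable_haar).
by apply: filterS gf => x ->.
Qed.

Lemma rmeanZ (a : R) g Q : intg g -> rmean (fun x => a * g x) Q = a * rmean g Q.
Proof.
move=> ig; rewrite /rmean mulrCA; congr (_ * _); rewrite -RintegralZl//; last first.
  by apply: intgM => //; [exact: measurable_indic_rect|exact: indic_bounded].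
by apply: eq_Rintegral => x _; rewrite mulrA.
Qed.

Definition carleson (p : rv -> R) : Prop :=
  exists2 C, 0 <= C & forall F, uniq F -> \sum_(Q <- F) hc p Q ^+ 2 <= C * fine (mu (runion F)).

(** The form in which LMO enters the grid estimate: sets of measure 2^-k replace the projections
    Q_j. *)
Definition lmo (p : rv -> R) : Prop :=
  exists2 L, 0 <= L & forall F k, uniq F -> fine (mu (runion F)) <= 2^-1 ^+ k ->
      \sum_(Q <- F) hc p Q ^+ 2 <= L * fine (mu (runion F)) / k.+1%:R ^+ 2.

Lemma carlesonD g f : intg g -> intg f -> carleson g -> carleson f -> carleson (fun x => g x + f x).
Proof.
move=> ig jf [C C0 HC] [D D0 HD]; exists (2 * (C + D)); first by rewrite mulr_ge0// addr_ge0.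
move=> F uF; apply: (@le_trans _ _ (\sum_(Q <- F) (2 * hc g Q ^+ 2 + 2 * hc f Q ^+ 2))).
  apply: ler_sum => Q _; rewrite hcD//; have := sqr_ge0 (hc g Q - hc f Q); nra.
rewrite big_split /= -!mulr_sumr -mulrDr -mulrA [(C + D) * _]mulrDl ler_pM2l//.
by apply: lerD; [exact: HC|exact: HD].
Qed.

Lemma carlesonZ (a : R) g : intg g -> carleson g -> carleson (fun x => a * g x).
Proof.
move=> ig [C C0 HC]; exists (a ^+ 2 * C); first by rewrite mulr_ge0// sqr_ge0.
move=> F uF; rewrite -mulrA; apply: le_trans (ler_wpM2l (sqr_ge0 a) (HC F uF)).
by rewrite mulr_sumr; apply: ler_sum => Q _; rewrite hcZ// exprMn.
Qed.

(** Reduction by homogeneity to oscillation at most 1, dividing by B + 1 > 0, and to a multiplier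
    bounded everywhere, since clipping at M alters p on a null set only. *)
Lemma multiplier_carleson p b (M B : R) : measurable_fun setT p -> {ae mu, forall x, `|p x| <= M} -> 0 <= M ->
  lmo p -> intg b -> 0 <= B ->
  (forall Q, rmean (fun x => `|b x - rmean b Q|) Q <= B) -> carleson (fun x => p x * b x).
Proof.
move=> mp pM M0 [L L0 HL] ib B0 osc.
have mb := intg_measurable ib.
pose a := (B + 1)^-1; have a0 : 0 < a by rewrite invr_gt0 ltr_wpDl.
pose b1 := fun x => a * b x; have ib1 : intg b1 by exact: intgZ.
have mc := measurable_clip M mp.
have cp : {ae mu, forall x, clip M (p x) = p x} by apply: filterS pM => x /clip_id.
have [C C0 H] := torus_multiplier_bound N M0 (normr_ge0 (\int[mu]_x b1 x)) L0.
have H1 : carleson (fun x => clip M (p x) * b1 x).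
  exists C => //; apply: H => //.
  - by apply: intg_bounded => //; exists M => x; exact: clip_le.
  - by move=> x; exact: clip_le.
  - move=> Q; rewrite rmeanZ//.
    rewrite (_ : (fun x => _) = fun x => a * `|b x - rmean b Q|); last first.
      by apply/funext => x; rewrite -mulrBr normrM gtr0_norm.
    rewrite rmeanZ; last by apply: intg_norm; apply: intgB => //; exact: intg_cst.
    rewrite /a mulrC ler_pdivrMr ?mul1r ?ltr_wpDl//.
    by apply: le_trans (osc Q) _; rewrite lerDl.
  - move=> F k uF Fk; apply: le_trans (HL F k uF Fk); rewrite le_eqVlt; apply/orP; left; apply/eqP.
    by apply: eq_bigr => Q _; congr (_ ^+ 2); apply: ae_hc.
have ic : intg (fun x => clip M (p x) * b1 x).
  rewrite (_ : (fun x => _) = fun x => b1 x * clip M (p x)); last by apply/funext => x; rewrite mulrC.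
  by apply: intgM => //; exists M => x; exact: clip_le.
have [C' C'0 H2] := carlesonZ (B + 1) ic H1.
exists C' => // F uF; apply: le_trans (H2 F uF).
rewrite le_eqVlt; apply/orP; left; apply/eqP; apply: eq_bigr => Q _; congr (_ ^+ 2); apply: ae_hc.
- exact: measurable_funM.
- by apply: measurable_funM => //; apply: measurable_funM => //; exact: measurable_funM.
apply: filterS cp => x ->; rewrite /b1 /a mulrCA; congr (_ * _).
by rewrite mulrA mulfV ?mul1r// gt_eqF// ltr_wpDl.
Qed.

Lemma rvolE Q : rvol R Q = 2^-1 ^+ (\sum_(l < N) tag (tnth Q l))%N.
Proof.
rewrite /rvol big_tuple; elim/big_rec2: _ => [|l x y _ ->]; first by rewrite expr0.
by rewrite exprD.
Qed.

Lemma rvol_le F Q : Q \in F -> rvol R Q <= fine (mu (runion F)).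
Proof.
move=> QF; rewrite -[rvol R Q]/(fine (rvol R Q)%:E) -mu_rect; apply: fine_le.
- by apply: fin_num_measure; exact: measurable_rect.
- by apply: fin_num_measure; exact: measurable_runion.
apply: le_measure; rewrite ?inE; [exact: measurable_rect|exact: measurable_runion|].
by move=> x Qx; exists Q.
Qed.

(* If the union of F has measure at most 2^-k, then every Q in F has a side of
   level at least k / N. *)
Lemma LMOd_finite (psi : rv -> R[i]) : (0 < N)%N -> LMOd psi ->
  exists2 L, 0 <= L & forall F k, uniq F -> fine (mu (runion F)) <= 2^-1 ^+ k ->
      \sum_(Q <- F) cabs (haar_coef psi Q) ^+ 2 <= L * fine (mu (runion F)) / k.+1%:R ^+ 2.
Proof.
move=> N0 [_ [C C0 H]]; exists (N%:R * (C * N%:R) ^+ 2); first by rewrite mulr_ge0// sqr_ge0.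
move=> F k uF Fk; set V := fine (mu (runion F)); set c := haar_coef psi.
have V0 : 0 <= V by exact: fine_ge0.
set n := (k %/ N)%N.
pose j (l : 'I_N) : N.-tuple nat := [tuple if l' == l then n else 0%N | l' < N].
have key Q : Q \in F -> exists l : 'I_N, (n <= tag (tnth Q l))%N.
  move=> QF; apply/existsP; apply: contraT; rewrite negb_exists => /forallP h.
  have : 2^-1 ^+ (\sum_(l < N) tag (tnth Q l))%N <= 2^-1 ^+ k :> R.
    by rewrite -rvolE; apply: le_trans (rvol_le QF) Fk.
  rewrite !exprVn lef_pV2 ?posrE ?exprn_gt0// ler_eXn2l ?ltr1n//.
  move=> kS; have : (\sum_(l < N) tag (tnth Q l) < k)%N; last by rewrite ltnNge kS.
  apply: (@leq_trans (\sum_(l < N) n)%N); last by rewrite sum_nat_const card_ord mulnC; exact: leq_trunc_div.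
  apply: (@leq_trans (\sum_(l < N) (tag (tnth Q l)).+1)%N).
    have -> : (\sum_(l < N) (tag (tnth Q l)).+1 = \sum_(l < N) (tag (tnth Q l) + 1))%N.
      by apply: eq_bigr => l _; rewrite [RHS]addn1.
    by rewrite big_split /= sum_nat_const card_ord muln1 -addn1 leq_add2l.
  by apply: leq_sum => l _; have := h l; rewrite -ltnNge.
apply: (@le_trans _ _ (\sum_(Q <- F) \sum_(l < N) cabs (haar_proj (j l) c Q) ^+ 2)).
  rewrite big_seq [leRHS]big_seq; apply: ler_sum => Q QF.
  have [l hl] := key Q QF; rewrite (bigD1 l)//= {1}/haar_proj ifT.
    by rewrite lerDl; apply: sumr_ge0 => l' _; exact: sqr_ge0.
  apply/forallP => l'; rewrite tnth_mktuple /dlen.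
  by apply: ler_wiXn2l; rewrite ?invr_ge0 ?invf_le1 ?ler1n//; case: eqP => // ->.
rewrite exchange_big /=.
apply: (@le_trans _ _ (\sum_(l < N) (C / (n + N)%:R) ^+ 2 * V)).
  apply: ler_sum => l _; apply: BMOd_norm_fin => //; first by rewrite divr_ge0// ltW.
  rewrite (_ : n = \sum_(l' < N) tnth (j l) l')%N; first exact: H.
  rewrite (bigD1 l)//= tnth_mktuple eqxx big1 ?addn0// => l' /negPf ll.
  by rewrite tnth_mktuple ll.
rewrite sumr_const card_ord -[_ *+ N]mulr_natl.
(* This amounts to k + 1 <= N (n + N), true since k is n N plus a remainder smaller than N. *)
have h : C / (n + N)%:R <= C * N%:R / k.+1%:R.
  rewrite ler_pdivrMr ?ltr0n ?addn_gt0 ?N0 ?orbT// mulrAC ler_pdivlMr ?ltr0n// -mulrA ler_pM2l//.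
  rewrite -natrM ler_nat mulnDr mulnC -addn1 {1}(divn_eq k N) -addnA mulnC leq_add2l.
  rewrite addn1; apply: leq_trans (ltn_pmod k N0) _.
  exact: leq_pmulr.
have h2 := lerXn2r 2%N (divr_ge0 (ltW C0) (ler0n R (n + N)%N)) (divr_ge0 (mulr_ge0 (ltW C0) (ler0n R N)) (ler0n R k.+1)) h.
rewrite (_ : N%:R * _ * V / _ = N%:R * ((C * N%:R / k.+1%:R) ^+ 2 * V)).
  by rewrite ler_wpM2l// ler_wpM2r.
by rewrite [in RHS]expr_div_n [in RHS]mulrAC !mulrA.
Qed.

(** The set where |phi| exceeds M is periodic and null, so its translates are null. *)
Lemma Lpoo_translate (a : rv) (phi : rv -> R[i]) : Lp_torus R N +oo%E phi -> Lp_torus R N +oo%E (translate a phi).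
Proof.
move=> /LpooP[tf [M hM]]; apply/LpooP; split; first exact: torus_fun_translate.
exists M; have mc := measurable_cabs tf.
have mA : measurable [set x | M < cabs (phi x)].
  rewrite (_ : [set x | _] = [set: rv] `&` [set x | M < cabs (phi x)]); last by rewrite setTI.
  have := mc measurableT _ (measurable_itv `]M, +oo[).
  congr measurable; rewrite predeqE => x; split=> [[_ /=]|[_ /= h]]; rewrite ?in_itv /= andbT//.
have mA' := measurable_shift a measurableT mA; rewrite setTI in mA'.
have A0 : mu [set x | M < cabs (phi x)] = 0.
  case: hM => B [mB B0 AB]; apply/eqP; rewrite eq_le measure_ge0 andbT -B0.
  by apply: le_measure; rewrite ?inE// => x /= h; apply: AB => /=; rewrite leNgt h.
exists (Defs.shift a @^-1` [set x | M < cabs (phi x)]); split=> //; last first.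
  by move=> x /= /negP; rewrite -ltNge.
rewrite -[LHS]fineK ?fin_num_measure//; congr EFin; rewrite -RintegralEindic//.
have mi : measurable_fun setT (\1_[set x | M < cabs (phi x)] : rv -> R) by exact: measurable_indic.
have zi : zperiodic (\1_[set x | M < cabs (phi x)] : rv -> R).
  move=> k x; have [fp _ _] := tf; rewrite !indicE; congr (nat_of_bool _)%:R.
  by apply/idP/idP => /set_mem /= h; apply/mem_set; move: h; rewrite /= fp.
by have := Rintegral_shift a mi zi; rewrite [RHS]RintegralEindic// A0.
Qed.

Lemma torus_funM (f g : rv -> R[i]) : torus_fun f -> torus_fun g -> torus_fun (fun x => f x * g x).
Proof.
move=> [fp fr fi] [gp gr gi]; split=> [k x||]; first by rewrite fp gp.
- rewrite (_ : (fun x => _) = fun x => complex.Re (f x) * complex.Re (g x) - complex.Im (f x) * complex.Im (g x)).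
    by apply: measurable_funB; exact: measurable_funM.
  by apply/funext => x; rewrite cReM.
- rewrite (_ : (fun x => _) = fun x => complex.Re (f x) * complex.Im (g x) + complex.Im (f x) * complex.Re (g x)).
    by apply: measurable_funD; exact: measurable_funM.
  by apply/funext => x; rewrite cImM.
Qed.

Lemma BMOd_carleson (f : rv -> R[i]) : BMOd f <-> [/\ Lp_torus R N 2%:E f,
  carleson (fun x => complex.Re (f x)) & carleson (fun x => complex.Im (f x))].
Proof.
split=> [/BMOdP[lf [C C0 H]]|[lf [C C0 H] [D D0 H']]].
  split=> //; exists C => // F uF; apply: le_trans (H F uF); apply: ler_sum => Q _.
    by rewrite lerDl sqr_ge0.
  by rewrite lerDr sqr_ge0.
apply/BMOdP; split=> //; exists (C + D); first exact: addr_ge0.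
by move=> F uF; rewrite big_split /= mulrDl lerD ?H ?H'.
Qed.

Lemma LMOd_lmo (psi : rv -> R[i]) : (0 < N)%N -> LMOd psi ->
  lmo (fun x => complex.Re (psi x)) /\ lmo (fun x => complex.Im (psi x)).
Proof.
move=> N0 /(LMOd_finite N0)[L L0 HL]; split; exists L => // F k uF Fk.
  apply: le_trans (HL F k uF Fk); apply: ler_sum => Q _.
  by rewrite cabs_sqr Re_haar_coef lerDl sqr_ge0.
apply: le_trans (HL F k uF Fk); apply: ler_sum => Q _.
by rewrite cabs_sqr Im_haar_coef lerDr sqr_ge0.
Qed.

Lemma bounded_LMO_multiplier (phi : rv -> R[i]) : (0 < N)%N -> Lp_torus R N +oo%E phi -> LMO R N phi ->
  multipliers (little_bmo R N) (product_BMO R N) phi.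
Proof.
move=> N0 bphi Lphi b bb a Ca; have lphi : LMOd (translate a phi) := Lphi a Ca.
have [tp [M hM]] := (LpooP _).1 (Lpoo_translate a bphi).
have [lp1 lp2] := LMOd_lmo N0 lphi.
set psi := translate a phi in tp hM lp1 lp2 *.
have bbeta := little_bmo_translate a bb.
set beta := translate a b in bbeta.
change (BMOd (fun x => psi x * beta x)).
have [lb _] := (little_bmoP _).1 bbeta; have [tb lb1 lb2] := (Lp2P _).1 lb.
have [B B0 HB] := little_bmo_dyadic bbeta.
have [_ mp1 mp2] := tp.
have b1 : {ae mu, forall x, `|complex.Re (psi x)| <= `|M|}.
  by apply: filterS hM => x h; apply: le_trans (Re_cabs _) (le_trans h (ler_norm _)).
have b2 : {ae mu, forall x, `|complex.Im (psi x)| <= `|M|}.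
  by apply: filterS hM => x h; apply: le_trans (Im_cabs _) (le_trans h (ler_norm _)).
have L11 := l2M_ae (normr_ge0 M) mp1 b1 lb1; have L12 := l2M_ae (normr_ge0 M) mp1 b1 lb2.
have L21 := l2M_ae (normr_ge0 M) mp2 b2 lb1; have L22 := l2M_ae (normr_ge0 M) mp2 b2 lb2.
have ib1 := l2_intg lb1; have ib2 := l2_intg lb2.
(* The complex product is expanded into four real products, each handled separately. *)
have C11 := multiplier_carleson mp1 b1 (normr_ge0 M) lp1 ib1 B0 (fun Q => (HB Q).1).
have C12 := multiplier_carleson mp1 b1 (normr_ge0 M) lp1 ib2 B0 (fun Q => (HB Q).2).
have C21 := multiplier_carleson mp2 b2 (normr_ge0 M) lp2 ib1 B0 (fun Q => (HB Q).1).
have C22 := multiplier_carleson mp2 b2 (normr_ge0 M) lp2 ib2 B0 (fun Q => (HB Q).2).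
have eR : (fun x => complex.Re (psi x * beta x)) =
    (fun x => complex.Re (psi x) * complex.Re (beta x) + -1 * (complex.Im (psi x) * complex.Im (beta x))).
  by apply/funext => x; rewrite cReM mulN1r.
have eI : (fun x => complex.Im (psi x * beta x)) =
    (fun x => complex.Re (psi x) * complex.Im (beta x) + complex.Im (psi x) * complex.Re (beta x)).
  by apply/funext => x; rewrite cImM.
apply/BMOd_carleson; rewrite eR eI; split.
- apply/Lp2P; rewrite eR eI; split; [exact: torus_funM|apply: l2D => //; exact: l2Z|exact: l2D].
- apply: carlesonD => //; first exact: l2_intg.
    by apply: intgZ; exact: l2_intg.
  by apply: carlesonZ => //; exact: l2_intg.
- by apply: carlesonD => //; exact: l2_intg.
Qed.

End superset.

(** * A gliding hump argument *)

Section monotone_limits.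
Local Open Scope complex_scope.
Context (R : realType) (N : nat).
Local Notation rv := (rvec R N).
Local Notation mu := (torus_measure R N).
Implicit Types (g : nat -> rv -> R) (f b u : rv -> R).

(** The supremum is taken at every point, in the extended reals, so that the limit is exactly
    periodic. [fine] returns 0 where it is infinite, a null set because the limit W of the squares
    is integrable. *)
Lemma monotone_l2 g (A : R) : (forall n, l2 (g n)) -> (forall n, zperiodic (g n)) ->
  (forall n x, 0 <= g n x) -> (forall n x, g n x <= g n.+1 x) ->
  (forall n, \int[mu]_x (g n x ^+ 2) <= A) ->
  exists f, [/\ l2 f, zperiodic f, forall x, 0 <= f x &
    {ae mu, forall x, g n x @[n --> \oo] --> f x /\ forall n, g n x <= f x}].
Proof.
move=> lg gp g0 gS gA.
have gh x : {homo g^~ x : n m / (n <= m)%N >-> n <= m}.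
  by apply: homo_leq => [//|? ? ?|n]; [exact: le_trans|exact: gS].
pose F x := ereal_sup (range (fun n => (g n x)%:E)).
pose W x := limn (fun n => ((g n x) ^+ 2)%:E).
have Fcv x : (g n x)%:E @[n --> \oo] --> F x.
  by apply: ereal_nondecreasing_cvgn => n m nm; rewrite lee_fin; exact: gh.
have W2 x : {homo (fun n => ((g n x) ^+ 2)%:E) : n m / (n <= m)%N >-> (n <= m)%E}.
  by move=> n m nm; rewrite lee_fin lerXn2r ?nnegrE// gh.
have Wcv x : W x = ereal_sup (range (fun n => ((g n x) ^+ 2)%:E)).
  by apply/cvg_lim => //; apply: ereal_nondecreasing_cvgn; exact: W2.
have gW n x : (((g n x) ^+ 2)%:E <= W x)%E by rewrite Wcv; apply: ereal_sup_ubound; exists n.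
have gF n x : ((g n x)%:E <= F x)%E by apply: ereal_sup_ubound; exists n.
have F0 x : (0 <= F x)%E by apply: le_trans (gF 0%N x); rewrite lee_fin.
have W0 x : (0 <= W x)%E by apply: le_trans (gW 0%N x); rewrite lee_fin sqr_ge0.
have m2 n : measurable_fun setT (fun x => ((g n x) ^+ 2)%:E).
  by apply/measurable_EFinP; apply: measurable_funX; exact: (lg n).1.
have mW : measurable_fun setT W.
  apply: (emeasurable_fun_cvg (fun n x => ((g n x) ^+ 2)%:E)) => // x _.
  by rewrite Wcv; apply: ereal_nondecreasing_cvgn; exact: W2.
have mF : measurable_fun setT F.
  apply: (emeasurable_fun_cvg (fun n x => (g n x)%:E)) => // n.
  by apply/measurable_EFinP; exact: (lg n).1.
have iW : (\int[mu]_x W x <= A%:E)%E.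
  have h := @cvg_monotone_convergence _ _ _ mu setT measurableT (fun n x => ((g n x) ^+ 2)%:E) m2.
  have {}h := h _ (fun x _ => W2 x).
  have {}h := h (fun n x _ => sqr_ge0 (g n x)).
  rewrite -(cvg_lim _ h)//; apply: lime_le; first by apply/cvg_ex; eexists; exact: h.
  by apply: nearW => n; rewrite -RintegralE ?lee_fin//; exact: (lg n).2.
have FW x : W x \is a fin_num -> (F x <= (Num.sqrt (fine (W x)))%:E)%E.
  move=> Wf; apply: ge_ereal_sup => _ [n _ <-]; rewrite lee_fin -(ger0_norm (g0 n x)) -sqrtr_sqr.
  by apply: ler_wsqrtr; rewrite -lee_fin fineK.
exists (fine \o F); split.
- split; first exact: measurableT_comp.
  apply/integrableP; split.
    by apply/measurable_EFinP; apply: measurable_funX; exact: measurableT_comp.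
  apply: (@le_lt_trans _ _ (\int[mu]_x W x)%E); last by apply: le_lt_trans iW _; exact: ltry.
  apply: ge0_le_integral => //.
    apply: measurableT_comp => //; apply/measurable_EFinP; apply: measurable_funX; exact: measurableT_comp.
  move=> x _ /=; rewrite ger0_norm ?sqr_ge0//.
  (* Where W is infinite the comparison is trivial; elsewhere F <= sqrt W. *)
  have [Wf|] := boolP (W x \is a fin_num); last by rewrite ge0_fin_numE// -leNgt leye_eq => /eqP ->; rewrite leey.
  have Ff : F x \is a fin_num by rewrite ge0_fin_numE//; apply: le_lt_trans (FW x Wf) (ltry _).
  rewrite -(fineK Wf) lee_fin -[leRHS]sqr_sqrtr ?fine_ge0// lerXn2r ?nnegrE ?fine_ge0 ?sqrtr_ge0//.
  by rewrite -lee_fin fineK// FW.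
- by move=> k x /=; rewrite /F (_ : (fun n => (g n (Defs.shift (int_rvec R k) x))%:E) = (fun n => (g n x)%:E))//; apply/funext => n; rewrite gp.
- by move=> x /=; exact: fine_ge0.
have iW' : mu.-integrable setT W.
  by apply/integrableP; split=> //; under eq_integral do rewrite gee0_abs//; exact: le_lt_trans iW (ltry _).
have := integrable_ae measurableT iW'; apply: filterS => x /(_ I) Wf.
have Ff : F x \is a fin_num by rewrite ge0_fin_numE//; apply: le_lt_trans (FW x Wf) (ltry _).
split=> [|n]; last by rewrite -lee_fin /= fineK.
by have := Fcv x; rewrite -{1}(fineK Ff) => /fine_cvgP[].
Qed.

Lemma dominated_l2 g f u : (forall n, l2 (g n)) -> l2 f -> (forall n x, 0 <= g n x) ->
  {ae mu, forall x, g n x @[n --> \oo] --> f x /\ forall n, g n x <= f x} -> l2 u ->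
  forall e, 0 < e -> exists n0, forall n, (n0 <= n)%N -> \int[mu]_x `|u x * (g n x - f x)| <= e.
Proof.
move=> lg lf g0 gf lu e e0.
have iuf : intg (fun x => `|u x * f x|) by apply: intg_norm; exact: l2M_intg.
have mu_ n : measurable_fun setT (fun x => (u x * g n x)%:E).
  by apply/measurable_EFinP; apply: measurable_funM; [exact: lu.1|exact: (lg n).1].
have muf : measurable_fun setT (fun x => (u x * f x)%:E).
  by apply/measurable_EFinP; apply: measurable_funM; [exact: lu.1|exact: lf.1].
have [||_ h _] := @dominated_convergence _ _ _ mu setT measurableT (fun n x => (u x * g n x)%:E)
   (fun x => (u x * f x)%:E) (fun x => `|u x * f x|%:E) mu_ muf _ iuf.
- apply: filterS gf => x [h _] _; apply: cvg_EFin; first by near=> n.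
  by apply: cvgM => //; exact: cvg_cst.
- apply: filterS gf => x [_ h] n _ /=; rewrite lee_fin !normrM ler_wpM2l//.
  by rewrite !ger0_norm// (le_trans (g0 n x)).
have [K HK] := cvge0_near h e0; exists K => n /HK /= h1.
rewrite -lee_fin RintegralE; last first.
  apply: intg_norm; apply: l2M_intg => //; rewrite (_ : (fun x => _) = fun x => g n x + -1 * f x).
    by apply: l2D => //; exact: l2Z.
  by apply/funext => x; rewrite mulN1r.
apply: le_trans h1; rewrite le_eqVlt; apply/orP; left; apply/eqP.
by apply: eq_integral => x _; rewrite mulrBr.
Unshelve. all: by end_near.
Qed.

End monotone_limits.

Section gliding_hump.
Local Open Scope complex_scope.
Context (R : realType) (N : nat).
Local Notation rv := (rvec R N).
Local Notation mu := (torus_measure R N).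
Implicit Types (g f b u w : rv -> R) (B C s a : R).

(** The constant m is free, rather than the mean of f: this form adds up along sums and passes to
    limits directly, at the price of a factor 2 in [bmo_fun_little]. *)
Definition rect_osc B f : Prop := forall P, rectangles P ->
  exists m, \int[mu]_x (`|f x - m| * \1_P x) <= B * vol P.

(** Membership asks for some oscillation bound, while [bmo_test] below fixes it, adding an L^2 bound
    and a sign. *)
Definition bmo_fun f : Prop := [/\ zperiodic f, l2 f & exists B, rect_osc B f].

Definition bmo_test C b : Prop := [/\ zperiodic b, l2 b, forall x, 0 <= b x,
  \int[mu]_x (b x ^+ 2) <= C & rect_osc C b].

Lemma le_Rintegral_norm g f : intg g -> intg f -> (forall x, `|g x| <= f x) ->
  `|\int[mu]_x g x| <= \int[mu]_x f x.
Proof.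
move=> ig jf gf; apply: le_trans (le_normr_Rintegral measurableT ig) _.
by apply: le_Rintegral => //; exact: intg_norm.
Qed.

Lemma pairing_bound u b C : l2 u -> l2 b -> \int[mu]_x (b x ^+ 2) <= C ->
  `|\int[mu]_x (u x * b x)| <= (\int[mu]_x (u x ^+ 2) + C) / 2.
Proof.
move=> lu lb bC; apply: (@le_trans _ _ (\int[mu]_x (2^-1 * (u x ^+ 2 + b x ^+ 2)))).
  apply: le_Rintegral_norm; first exact: l2M_intg.
    by apply: intgZ; apply: intgD; [exact: lu.2|exact: lb.2].
  move=> x; rewrite normrM -[u x ^+ 2]real_normK ?num_real// -[b x ^+ 2]real_normK ?num_real//.
  have := sqr_ge0 (`|u x| - `|b x|); nra.
rewrite RintegralZl//; last by apply: intgD; [exact: lu.2|exact: lb.2].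
by rewrite RintegralD//; [rewrite mulrC ler_pM2r ?invr_gt0// lerD2l|exact: lu.2|exact: lb.2].
Qed.

(* The weight w makes the L^2 bound additive along the sequence of partial sums:
   g = sum a_i b_i satisfies g^2 <= (sum a_i) (sum a_i b_i^2). *)
Definition admissible C s g : Prop := [/\ zperiodic g, l2 g, forall x, 0 <= g x,
  exists w, [/\ intg w, forall x, 0 <= w x, forall x, g x ^+ 2 <= s * w x & \int[mu]_x w x <= s * C] &
  rect_osc (s * C) g].

Lemma admissible0 C : 0 <= C -> admissible C 0 (fun=> 0).
Proof.
move=> C0; split=> //.
- by apply: (@l2_bounded _ _ _ 0) => // x; rewrite normr0.
- exists (fun=> 0); split=> //; first exact: intg_cst.
  by rewrite mul0r Rintegral_cst// mul0r.
- move=> P rP; exists 0; rewrite mul0r mul0r (_ : (fun x => _) = fun=> 0); first by rewrite Rintegral_cst// mul0r.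
  by apply/funext => x; rewrite subrr normr0 mul0r.
Qed.

Lemma intg_osc f (m : R) P : rectangles P -> intg f -> intg (fun x => `|f x - m| * \1_P x).
Proof.
move=> rP jf; apply: (intgM (g := fun x => `|f x - m|) (f := \1_P)); [|exact: measurable_indic_rectangle|exact: indic_bounded].
by apply: intg_norm; apply: intgB => //; exact: intg_cst.
Qed.

Lemma admissibleD C s s' a g b : 0 <= s -> 0 <= C -> admissible C s g -> bmo_test C b -> 0 <= a -> s + a <= s' ->
  admissible C s' (fun x => g x + a * b x).
Proof.
move=> s0 C0 [gp lg g0 [w [iw w0 gw wC]] go] [bp lb b0 bC bo] a0 ss; split.
- by move=> k x; rewrite gp bp.
- by apply: l2D => //; exact: l2Z.
- by move=> x; rewrite addr_ge0// mulr_ge0.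
- exists (fun x => w x + a * b x ^+ 2).
  have ib : intg (fun x => a * b x ^+ 2) by apply: intgZ; exact: lb.2.
  split; first exact: intgD.
  + by move=> x; rewrite addr_ge0// mulr_ge0// sqr_ge0.
  + move=> x; apply: (@le_trans _ _ ((s + a) * (w x + a * b x ^+ 2))); last first.
      by rewrite ler_wpM2r// addr_ge0// mulr_ge0// sqr_ge0.
    have h1 : 0 <= s * b x ^+ 2 + w x by rewrite addr_ge0// mulr_ge0// sqr_ge0.
    (* AM-GM for s b^2 and w, as g^2 <= s w. *)
    have h2 : 2 * (g x * b x) <= s * b x ^+ 2 + w x.
      rewrite -(@ler_pXn2r _ 2)// ?nnegrE ?mulr_ge0//.
      have h3 : g x ^+ 2 * b x ^+ 2 <= s * w x * b x ^+ 2 by rewrite ler_wpM2r// sqr_ge0.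
      have := sqr_ge0 (s * b x ^+ 2 - w x).
      have -> : (2 * (g x * b x)) ^+ 2 = 4 * (g x ^+ 2 * b x ^+ 2) by ring.
      have -> : (s * b x ^+ 2 - w x) ^+ 2 = (s * b x ^+ 2 + w x) ^+ 2 - 4 * (s * w x * b x ^+ 2) by ring.
      by lra.
    have h4 := ler_wpM2l a0 h2; have := gw x.
    have -> : (g x + a * b x) ^+ 2 = g x ^+ 2 + a * (2 * (g x * b x)) + a ^+ 2 * b x ^+ 2 by ring.
    have -> : (s + a) * (w x + a * b x ^+ 2) = s * w x + a * (s * b x ^+ 2 + w x) + a ^+ 2 * b x ^+ 2 by ring.
    by lra.
  + rewrite RintegralD// RintegralZl//; last exact: lb.2.
    apply: (@le_trans _ _ ((s + a) * C)); last by rewrite ler_wpM2r.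
    by rewrite mulrDl; apply: lerD => //; exact: ler_wpM2l.
- move=> P rP; have [m hm] := go P rP; have [m' hm'] := bo P rP.
  have V0 := ltW (vol_gt0 rP).
  have i1 := intg_osc m rP (l2_intg lg); have i2 := intg_osc m' rP (l2_intg lb).
  exists (m + a * m').
  apply: (@le_trans _ _ (\int[mu]_x (`|g x - m| * \1_P x + a * (`|b x - m'| * \1_P x)))).
    apply: le_Rintegral => //.
    + by apply: intg_osc => //; apply: intgD; [exact: l2_intg|apply: intgZ; exact: l2_intg].
    + by apply: intgD => //; exact: intgZ.
    move=> x _; rewrite mulrA -mulrDl ler_wpM2r ?indicE//.
    rewrite (_ : _ - _ = (g x - m) + a * (b x - m')); last by ring.
    by apply: le_trans (ler_normD _ _) _; rewrite normrM (ger0_norm a0).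
  rewrite RintegralD//; last exact: intgZ.
  rewrite RintegralZl//; apply: le_trans (lerD hm (ler_wpM2l a0 hm')) _.
  by rewrite !mulrA -mulrDl ler_wpM2r// -mulrDl ler_wpM2r.
Qed.

(** Each rectangle P selects its own index n, for which the L^1 distance of g n to the limit is at
    most [vol P]; this adds 1 to the oscillation constant 2C of g n. *)
Lemma admissible_limit C (g : nat -> rv -> R) : 0 <= C -> (forall n, admissible C 2 (g n)) ->
  (forall n x, g n x <= g n.+1 x) -> exists2 f, bmo_fun f &
  forall u e, l2 u -> 0 < e -> exists n0, forall n, (n0 <= n)%N ->
    `|\int[mu]_x (u x * g n x) - \int[mu]_x (u x * f x)| <= e.
Proof.
move=> C0 ga gS.
have lg n : l2 (g n) by have [] := ga n.
have g0 n x : 0 <= g n x by have [] := ga n.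
have [||f [lf fp f0 fl]] := monotone_l2 (A := 4 * C) lg _ g0 gS.
- by move=> n; have [] := ga n.
- move=> n; have [_ _ _ [w [iw w0 gw wC]] _] := ga n.
  apply: (@le_trans _ _ (\int[mu]_x (2 * w x))).
    by apply: le_Rintegral => //; [exact: (lg n).2|exact: intgZ].
  by rewrite RintegralZl//; lra.
have D := dominated_l2 lg lf g0 fl.
have lB n : l2 (fun x => g n x - f x).
  rewrite (_ : (fun x => _) = fun x => g n x + -1 * f x); last by apply/funext => x; rewrite mulN1r.
  by apply: l2D => //; exact: l2Z.
exists f.
  split=> //; exists (2 * C + 1) => P rP; have V0 := vol_gt0 rP.
  have l1 : l2 (fun _ : rv => 1 : R) by apply: (@l2_bounded _ _ _ 1) => // x; rewrite normr1.
  have [n /(_ n (leqnn n)) hn] := D _ l1 _ V0.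
  have [_ _ _ _ /(_ P rP)[m hm]] := ga n; exists m.
  apply: (@le_trans _ _ (\int[mu]_x (`|g n x - m| * \1_P x + `|1 * (g n x - f x)|))).
    apply: le_Rintegral => //.
    + by apply: intg_osc => //; exact: l2_intg.
    + apply: intgD; first by apply: intg_osc => //; exact: l2_intg.
      by apply: intg_norm; apply: l2M_intg.
    move=> x _; rewrite indicE; case: (x \in P); rewrite ?mulr1 ?mulr0 ?add0r// mul1r.
    rewrite (_ : f x - m = (g n x - m) - (g n x - f x)); last by ring.
    exact: ler_normB.
  rewrite RintegralD//; last by apply: intg_norm; apply: l2M_intg.
    by rewrite mulrDl mul1r lerD.
  by apply: intg_osc => //; exact: l2_intg.
move=> u e lu e0; have [n0 H] := D u lu e e0; exists n0 => n /H; apply: le_trans.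
rewrite -RintegralB//; [|exact: l2M_intg|exact: l2M_intg].
rewrite (_ : (fun x => _) = fun x => u x * (g n x - f x)); last by apply/funext => x; rewrite mulrBr.
by apply: le_Rintegral_norm => //; [exact: l2M_intg|apply: intg_norm; exact: l2M_intg].
Qed.

(* At stage n, c n is fixed before the pair b n, u n is chosen, and the n-th
   coefficient is c n or 0, whichever makes the pairing of g n.+1 with u n large;
   c n.+1 is then so small that no later term can spoil that pairing. *)
Lemma uniform_boundedness (U : set (rv -> R)) C : 0 <= C -> (forall u, U u -> l2 u) ->
  (forall b, bmo_fun b -> exists K, forall u, U u -> `|\int[mu]_x (u x * b x)| <= K) ->
  exists K, forall b u, bmo_test C b -> U u -> `|\int[mu]_x (u x * b x)| <= K.
Proof.
move=> C0 lU H; apply: contrapT => /forallNP nK.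
have pickK K : exists p : (rv -> R) * (rv -> R), [/\ bmo_test C p.1, U p.2 & K < `|\int[mu]_x (p.2 x * p.1 x)|].
  apply: contrapT => /forallNP h; apply: (nK K) => b u tb Uu.
  by rewrite leNgt; apply/negP => h'; apply: (h (b, u)).
have [pick hpick] := choice pickK.
(* By [pairing_bound], A u dominates the pairing of u with every test function. *)
pose A u := (\int[mu]_x (u x ^+ 2) + C) / 2.
(* Multiplied by c the chosen pairing exceeds 2(n+2). So if the pairing with g n is below n + 2,
   adding c b lifts it above n + 2. *)
pose pk n c := pick (2 * n.+2%:R / c).
pose step n (p : (rv -> R) * R) : (rv -> R) * R :=
  ((fun x => p.1 x + (if `|\int[mu]_x ((pk n p.2).2 x * p.1 x)| < n.+2%:R then p.2 else 0) * (pk n p.2).1 x),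
   p.2 / (2 * (1 + A (pk n p.2).2))).
pose st := fix st n := if n is k.+1 then step k (st k) else ((fun=> 0), 1).
pose c n := (st n).2; pose g n := (st n).1.
pose b n := (pk n (c n)).1; pose u n := (pk n (c n)).2.
pose a n := if `|\int[mu]_x (u n x * g n x)| < n.+2%:R then c n else 0.
have gS n : g n.+1 = fun x => g n x + a n * b n x by [].
have cS n : c n.+1 = c n / (2 * (1 + A (u n))) by [].
have tb n : bmo_test C (b n) by have [] := hpick (2 * n.+2%:R / c n).
have Uu n : U (u n) by have [] := hpick (2 * n.+2%:R / c n).
have hub n : 2 * n.+2%:R / c n < `|\int[mu]_x (u n x * b n x)| by have [] := hpick (2 * n.+2%:R / c n).
have lb n : l2 (b n) by have [] := tb n.
have lu n : l2 (u n) by exact: lU.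
have A0 n : 0 <= A (u n).
  by rewrite divr_ge0// addr_ge0//; apply: Rintegral_ge0 => // x _; exact: sqr_ge0.
have c0 n : 0 < c n.
  by elim: n => [|n IH]; [exact: ltr01|rewrite cS divr_gt0// mulr_gt0// ltr_wpDr].
have cle n : c n.+1 <= c n / 2.
  rewrite cS ler_pM2l// lef_pV2 ?posrE ?mulr_gt0 ?ltr_wpDr//.
  by rewrite ler_peMr// lerDl.
have c1 n : c n <= 1.
  elim: n => [|n IH]; first exact: lexx.
  by apply: le_trans (cle n) _; have := c0 n; lra.
have cA n : 2 * c n.+1 * A (u n) <= 1.
  have -> : 2 * c n.+1 * A (u n) = c n * (A (u n) / (1 + A (u n))).
    by rewrite cS; field; rewrite gt_eqF// ltr_wpDr.
  apply: mulr_ile1 => //; first exact: ltW.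
    by rewrite divr_ge0// addr_ge0.
  by rewrite ler_pdivrMr ?ltr_wpDr// mul1r lerDr.
have a0 n : 0 <= a n by rewrite /a; case: ifP => // _; exact: ltW.
have ac n : a n <= c n by rewrite /a; case: ifP => // _; exact: ltW.
(* As c at least halves at each step, c n <= 2 c n - 2 c n.+1: the coefficients a fit a telescoping
   budget of total 2. *)
have adm n : admissible C (2 - 2 * c n) (g n).
  elim: n => [|n IH].
    by rewrite (_ : 2 - 2 * c 0%N = 0); [exact: admissible0|rewrite /c /=; lra].
  rewrite gS; apply: (admissibleD _ C0 IH (tb n) (a0 n)).
    by have := c1 n; lra.
  by have := cle n; have := ac n; lra.
have adm2 n : admissible C 2 (g n).
  rewrite (_ : g n = fun x => g n x + 0 * b n x); last by apply/funext => x; rewrite mul0r addr0.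
  apply: (admissibleD _ C0 (adm n) (tb n) (lexx 0)); first by have := c1 n; lra.
  by have := c0 n; lra.
have lg n : l2 (g n) by have [] := adm n.
have [|f bf fl] := admissible_limit C0 adm2.
  move=> n x; rewrite gS lerDl mulr_ge0//; by have [] := tb n.
have [K HK] := H f bf.
have intS n v : l2 v -> \int[mu]_x (v x * g n.+1 x) = \int[mu]_x (v x * g n x) + a n * \int[mu]_x (v x * b n x).
  move=> lv; rewrite -RintegralZl//; last exact: l2M_intg.
  rewrite -RintegralD//; [|exact: l2M_intg|by apply: intgZ; exact: l2M_intg].
  by apply: eq_Rintegral => x _; rewrite gS; ring.
have [n Kn] : exists n : nat, K < n%:R.
  by exists (Num.truncn `|K|).+1; apply: le_lt_trans (ler_norm K) _; exact: truncnS_gt.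
pose I m := \int[mu]_x (u n x * g m x).
have big : n.+2%:R <= `|I n.+1|.
  rewrite /I intS// /a; case: ifPn => [h|]; last by rewrite -leNgt mul0r addr0.
  have h2 : 2 * n.+2%:R < c n * `|\int[mu]_x (u n x * b n x)| by rewrite [ltRHS]mulrC -ltr_pdivrMr.
  rewrite addrC; apply: le_trans (lerB_normD _ _); rewrite normrM gtr0_norm//.
  by move: h h2; set p := n.+2%:R; lra.
(* The same telescoping; together with [cA] it bounds all later changes of the n-th pairing by 1. *)
have tail j : `|I (n.+1 + j)%N - I n.+1| <= A (u n) * (2 * c n.+1 - 2 * c (n.+1 + j)%N).
  elim: j => [|j IH]; first by rewrite addn0 !subrr normr0 mulr0.
  rewrite addnS; set m := (n.+1 + j)%N in IH *.
  have e : I m.+1 = I m + a m * \int[mu]_x (u n x * b m x) := intS m (u n) (lu n).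
  rewrite e addrAC.
  apply: le_trans (ler_normD _ _) _; rewrite normrM (ger0_norm (a0 m)).
  have hA : `|\int[mu]_x (u n x * b m x)| <= A (u n) by apply: pairing_bound => //; have [] := tb m.
  have := ler_pM (a0 m) (normr_ge0 _) (ac m) hA.
  have := ler_wpM2l (A0 n) (cle m); move: IH; lra.
have [n0 hn0] := fl (u n) 1 (lu n) ltr01.
have h1 := hn0 (n.+1 + n0)%N (leq_addl _ _); have h2 := tail n0.
have h3 := HK (u n) (Uu n); have h4 := cA n; have h5 := mulr_ge0 (A0 n) (ltW (c0 (n.+1 + n0)%N)).
move: h1; rewrite -/(I (n.+1 + n0)%N) => h1.
set J := \int[mu]_x (u n x * f x) in h1 h3; set J' := I (n.+1 + n0)%N in h1 h2.
(* A loss of 1 in the tail and of 1 in the limit leaves n + 2 <= K + 2, against K < n. *)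
have h6 : `|I n.+1| <= `|J| + `|J' - J| + `|J' - I n.+1|.
  rewrite [X in `|X| <= _](_ : _ = J + (J' - J) - (J' - I n.+1)); last by ring.
  by apply: le_trans (ler_normB _ _) _; apply: lerD => //; exact: ler_normD.
move: big; rewrite -[n.+2%:R]natr1 -[n.+1%:R]natr1 => big.
move: Kn h1 h2 h3 h4 h5 h6 big; rewrite mulrBr; lra.
Qed.

End gliding_hump.

(** * Uniform Carleson bounds over test functions *)

Section uniform_carleson.
Local Open Scope complex_scope.
Context (R : realType) (N : nat).
Local Notation rv := (rvec R N).
Local Notation mu := (torus_measure R N).
Implicit Types (g f b u psi : rv -> R) (Q : dyadic_rect N) (F : seq (dyadic_rect N)) (lam : dyadic_rect N -> R).

Lemma cabs_real (t : R) : cabs t%:C = `|t|.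
Proof. by rewrite cabsE /= expr0n addr0 sqrtr_sqr. Qed.

(** The mean over P differs from any admissible constant m by at most B, hence the constant 2 B. *)
Lemma bmo_fun_little f : bmo_fun f -> little_bmo R N (fun x => (f x)%:C).
Proof.
move=> [fp lf [B fB]]; have jf := l2_intg lf; apply/little_bmoP; split.
  apply/Lp2P; split=> //=; last by apply: (@l2_bounded _ _ _ 0) => // x; rewrite normr0.
  by split=> [k x||] //=; [rewrite fp|exact: lf.1].
exists (2 * B) => P rP; have V0 := vol_gt0 rP.
have [m hm] := fB P rP.
have mE : mean P (fun x => (f x)%:C) = ((vol P)^-1 * \int[mu]_x (f x * \1_P x))%:C.
  apply/eqP; rewrite eq_complex Re_mean Im_mean /= eqxx /=.
  by rewrite (_ : (fun x => _) = fun=> 0) ?Rintegral_cst// ?mul0r ?mulr0//; apply/funext => x; rewrite mul0r.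
rewrite {}mE; set a := _ * _.
have i1 : intg (fun x => \1_P x : R) by apply: intg_bounded; [exact: measurable_indic_rectangle|exact: indic_bounded].
have i2 : intg (fun x => f x * \1_P x) by apply: intgM => //; [exact: measurable_indic_rectangle|exact: indic_bounded].
have i3 := intg_osc m rP jf.
have am : `|m - a| * vol P <= B * vol P.
  have -> : `|m - a| * vol P = `|\int[mu]_x ((f x - m) * \1_P x)|.
    rewrite distrC -{1}[vol P](ger0_norm (ltW V0)) -normrM.
    rewrite (_ : (fun x => _) = fun x => f x * \1_P x - m * \1_P x); last by apply/funext => x; rewrite mulrBl.
    rewrite RintegralB//; last exact: intgZ.
    rewrite RintegralZl// -volE; last exact: measurable_rectangle.
    by rewrite mulrBl /a mulrAC mulVf ?gt_eqF// mul1r.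
  apply: le_trans hm; apply: le_Rintegral_norm => //.
    by apply: intgM; [apply: intgB => //; exact: intg_cst|exact: measurable_indic_rectangle|exact: indic_bounded].
  by move=> x; rewrite normrM indicE; case: (x \in P); rewrite ?normr1 ?normr0.
apply: (@le_trans _ _ (\int[mu]_x (`|f x - m| * \1_P x + `|m - a| * \1_P x))).
  apply: le_Rintegral => //.
  - apply: intgM; [|exact: measurable_indic_rectangle|exact: indic_bounded].
    rewrite (_ : (fun x => _) = fun x => `|f x - a|).
      by apply: intg_norm; apply: intgB => //; exact: intg_cst.
    by apply/funext => x; rewrite -rmorphB cabs_real.
  - by apply: intgD => //; exact: intgZ.
  move=> x _; rewrite -mulrDl ler_wpM2r ?indicE// -rmorphB cabs_real.
  by rewrite (_ : f x - a = (f x - m) + (m - a)); [exact: ler_normD|ring].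
rewrite RintegralD//; last exact: intgZ.
rewrite RintegralZl// -volE; last exact: measurable_rectangle.
by rewrite -mulrA mulr_natl mulr2n lerD.
Qed.

Lemma haar_sum_bounded F lam : measurable_fun setT (fun x : rv => \sum_(Q <- F) lam Q * haar Q x) /\
  exists M, forall x : rv, `|\sum_(Q <- F) lam Q * haar Q x| <= M.
Proof.
split; first by apply: measurable_sum => Q; apply: measurable_funM => //; exact: measurable_haar.
elim: F => [|Q F [M HM]]; first by exists 0 => x; rewrite big_nil normr0.
have [M' HM'] := bounded_haar R Q; exists (`|lam Q| * M' + M) => x.
by rewrite big_cons; apply: le_trans (ler_normD _ _) _; rewrite normrM lerD// ler_wpM2l.
Qed.

Lemma haar_sum_pairing psi b F lam : l2 psi -> l2 b ->
  \int[mu]_x (psi x * (\sum_(Q <- F) lam Q * haar Q x) * b x) =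
  \sum_(Q <- F) lam Q * hc (fun x => psi x * b x) Q.
Proof.
move=> lpsi lb; have ipb := l2M_intg lpsi lb.
have ih Q : intg (fun x => lam Q * (psi x * b x * haar Q x)).
  by apply: intgZ; apply: intgM => //; [exact: measurable_haar|exact: bounded_haar].
elim: F => [|Q F IH].
  rewrite big_nil (_ : (fun x => _) = fun=> 0) ?Rintegral_cst ?mul0r//.
  by apply/funext => x; rewrite big_nil mulr0 mul0r.
rewrite big_cons -IH /hc -RintegralZl//; last by apply: intgM => //; [exact: measurable_haar|exact: bounded_haar].
rewrite -RintegralD; [|by []|exact: ih|].
  by apply: eq_Rintegral => x _; rewrite big_cons; ring.
  have [mS bS] := haar_sum_bounded F lam.
  rewrite (_ : (fun x => _) = fun x => psi x * b x * (\sum_(Q <- F) lam Q * haar Q x)).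
    exact: intgM.
  by apply/funext => x; rewrite mulrAC.
Qed.

(* Applies uniform_boundedness to psi H, for H in the unit balls of the spans of
   the Haar functions of F, normed by lam |-> (sum lam^2 mu(runion F))^(1/2). *)
Lemma uniform_carleson psi C : 0 <= C -> l2 psi ->
  (forall b, bmo_fun b -> carleson (fun x => psi x * b x)) ->
  exists2 K, 0 <= K & forall b, bmo_test C b -> forall F, uniq F ->
    \sum_(Q <- F) hc (fun x => psi x * b x) Q ^+ 2 <= K * fine (mu (runion F)).
Proof.
move=> C0 lpsi H.
pose U : set (rv -> R) := [set u | exists F lam, [/\ uniq F,
  \sum_(Q <- F) lam Q ^+ 2 * fine (mu (runion F)) <= 1 &
  u = fun x => psi x * (\sum_(Q <- F) lam Q * haar Q x)]].
have lU u : U u -> l2 u.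
  move=> [F [lam [_ _ ->]]]; have [mS [M HM]] := haar_sum_bounded F lam.
  exact: (l2M_bounded lpsi mS HM).
have [|K HK] := uniform_boundedness C0 lU.
  move=> b bb; have [K K0 HK] := H b bb; have [_ lb _] := bb.
  exists ((1 + K) / 2) => _ [F [lam [uF lF ->]]].
  rewrite haar_sum_pairing//; move: (HK F uF) lF; set V := fine _ => yF lF.
  have [F0|[Q0 QF]] : F = [::] \/ exists Q, Q \in F.
    by case: F {uF lF yF V} => [|Q F]; [left|right; exists Q; exact: mem_head].
    by rewrite F0 big_nil normr0 divr_ge0// addr_ge0.
  have V0 : 0 < V by exact: runion_gt0 QF.
  apply: le_trans (ler_norm_sum _ _ _) _.
  (* AM-GM weighted by V, so that one part matches the normalization of lam and the other the
     Carleson bound. *)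
  apply: (@le_trans _ _ (\sum_(Q <- F) 2^-1 * (lam Q ^+ 2 * V + V^-1 * hc (fun x => psi x * b x) Q ^+ 2))).
    apply: ler_sum => Q _; rewrite normrM; set y := hc _ Q.
    rewrite -[lam Q ^+ 2]real_normK ?num_real// -[y ^+ 2]real_normK ?num_real//.
    set p := `|lam Q|; set q := `|y|.
    rewrite (_ : p ^+ 2 * V + V^-1 * q ^+ 2 = V^-1 * (p * V - q) ^+ 2 + 2 * (p * q)).
      have : 0 <= V^-1 * (p * V - q) ^+ 2 by apply: mulr_ge0; [rewrite invr_ge0 ltW|exact: sqr_ge0].
      by set z := _ * _ ^+ 2; lra.
    by field; rewrite gt_eqF.
  rewrite -mulr_sumr big_split /= -mulr_sumr [leRHS]mulrC ler_pM2l ?invr_gt0//.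
  by apply: lerD => //; rewrite mulrC ler_pdivrMr.
exists (K ^+ 2); first exact: sqr_ge0.
move=> b tb F uF; have [_ lb _ _ _] := tb.
set y := hc _; set V := fine _; set S := \sum_(Q <- F) _.
have S0 : 0 <= S by apply: sumr_ge0 => Q _; exact: sqr_ge0.
have [F0|[Q0 QF]] : F = [::] \/ exists Q, Q \in F.
  by case: F {uF V S S0} => [|Q F]; [left|right; exists Q; exact: mem_head].
  by rewrite /S F0 big_nil mulr_ge0 ?sqr_ge0// fine_ge0.
have V0 : 0 < V by exact: runion_gt0 QF.
have [Sz|Sn] := eqVneq S 0; first by rewrite Sz mulr_ge0 ?sqr_ge0// ltW.
have Sp : 0 < S by rewrite lt_neqAle eq_sym Sn.
pose t := (Num.sqrt (S * V))^-1.
have SV : 0 < S * V by exact: mulr_gt0.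
have t0 : 0 < t by rewrite invr_gt0 sqrtr_gt0.
have t2 : t ^+ 2 = (S * V)^-1 by rewrite exprVn sqr_sqrtr// ltW.
(* The extremal choice in Cauchy-Schwarz, normalized to the unit sphere by t. *)
pose lam Q := t * y Q.
have e1 : \sum_(Q <- F) lam Q ^+ 2 * V = 1.
  rewrite -mulr_suml (eq_bigr (fun Q => t ^+ 2 * y Q ^+ 2)); last by move=> Q _; rewrite exprMn.
  by rewrite -mulr_sumr -/S t2 -mulrA mulVf// gt_eqF.
have := HK b (fun x => psi x * (\sum_(Q <- F) lam Q * haar Q x)) tb.
have UU : U (fun x => psi x * (\sum_(Q <- F) lam Q * haar Q x)) by exists F, lam; split=> //; rewrite e1.
move=> /(_ UU); rewrite haar_sum_pairing//.
rewrite (eq_bigr (fun Q => t * y Q ^+ 2)); last by move=> Q _; rewrite /lam -mulrA.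
have tS0 : 0 <= t * S by apply: mulr_ge0 => //; exact: ltW.
rewrite -mulr_sumr -/S ger0_norm// => tSK.
have K0 : 0 <= K by apply: le_trans tSK.
have e2 : (t * S) ^+ 2 = S / V by rewrite exprMn t2; field; rewrite Sn gt_eqF.
rewrite -ler_pdivrMr// -e2; apply: lerXn2r => //; by rewrite nnegrE.
Qed.

End uniform_carleson.

(** * Multipliers are bounded *)

Section haar_tests.
Local Open Scope complex_scope.
Context (R : realType) (N : nat).
Local Notation rv := (rvec R N).
Local Notation mu := (torus_measure R N).
Implicit Types (g f b u psi : rv -> R) (Q : dyadic_rect N) (F : seq (dyadic_rect N)) (I : dyadic).

(** Arcs instead of intervals make this periodic, a function on the circle, whereas [haar1] vanishes
    outside [0, 1). *)
Definition sgn1 I (t : R) : R :=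
  \1_(Defs.arc (dmid R I) (dright R I)) t - \1_(Defs.arc (dleft R I) (dmid R I)) t.

Definition haar_sgn Q (x : rv) : R := \prod_(i < N) sgn1 (tnth Q i) (tnth x i).

Lemma dyadic_bounds I : [/\ 0 <= dleft R I, dleft R I < dmid R I, dmid R I < dright R I & dright R I <= 1].
Proof.
have d0 := dlen_gt0 R I; rewrite /dright /dmid; split.
- by rewrite /dleft mulr_ge0// ltW.
- by rewrite ltrDl divr_gt0.
- by rewrite ltrD2l ltr_pdivrMr// mulr_natr mulr2n ltrDl.
- case: I {d0} => j k; rewrite /dleft /dlen /=.
  rewrite -[X in _ + X]mul1r -mulrDl exprVn ler_pdivrMr ?exprn_gt0// mul1r.
  by rewrite natr1 -natrX ler_nat.
Qed.

Lemma indic_arc01 (a c t : R) : 0 <= a -> c <= 1 -> 0 <= t < 1 ->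
  \1_(Defs.arc a c) t = (a <= t < c)%R%:R :> R.
Proof.
move=> a0 c1 t01; rewrite indicE; congr (nat_of_bool _)%:R.
by apply/idP/idP => [/set_mem /arc01 ->//|h]; apply/mem_set/arc01.
Qed.

Lemma haar1_sgn I (t : R) : 0 <= t < 1 -> haar1 I t = (Num.sqrt (dlen R I))^-1 * sgn1 I t.
Proof.
move=> t01; have [l0 lm mr r1] := dyadic_bounds I.
rewrite /haar1 /sgn1 !indic_arc01//; last 2 first.
- exact: ltW (lt_le_trans mr r1).
- exact: le_trans l0 (ltW lm).
by rewrite !indicE !mem_setE !in_itv.
Qed.

Lemma sgn1_sqr I (t : R) : 0 <= t < 1 -> sgn1 I t * sgn1 I t = (dleft R I <= t < dright R I)%R%:R.
Proof.
move=> t01; have [l0 lm mr r1] := dyadic_bounds I.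
rewrite /sgn1 !indic_arc01//; last 2 first.
- exact: ltW (lt_le_trans mr r1).
- exact: le_trans l0 (ltW lm).
have [h1|h1] := leP (dmid R I) t.
  rewrite (le_trans (ltW lm) h1) /= subr0; case: (t < _); rewrite ?mulr1 ?mulr0//.
rewrite (lt_trans h1 mr) /= andbT sub0r mulrNN; case: (_ <= t); rewrite ?mulr1 ?mulr0//.
Qed.

(* Hence testing psi against 1 + haar_sgn Q detects the mean of psi over Q. *)
Lemma haar_sgnP Q x : cube R N x -> haar_sgn Q x * haar Q x = (hscale R Q)^-1 * \1_(rect_set Q) x.
Proof.
move=> Cx; have t01 i : 0 <= tnth x i < 1 by have := Cx i; rewrite /= in_itv.
rewrite /haar_sgn /haar -big_split /=.
rewrite (eq_bigr (fun i => (Num.sqrt (dlen R (tnth Q i)))^-1 *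
   (dleft R (tnth Q i) <= tnth x i < dright R (tnth Q i))%R%:R)); last first.
  by move=> i _; rewrite haar1_sgn// mulrCA sgn1_sqr.
rewrite big_split /= -prodfV /hscale big_tuple; congr (_ * _).
rewrite indicE; case: (boolP (x \in rect_set Q)) => [/set_mem Qx|xQ].
  by rewrite big1// => i _; have := Qx i; rewrite /= in_itv /= => ->.
have [i hi] : exists i, ~~ (dleft R (tnth Q i) <= tnth x i < dright R (tnth Q i)).
  apply/existsP; move: xQ; apply: contraR; rewrite negb_exists => /forallP h.
  by apply/mem_set => i; rewrite /= in_itv /=; have := h i; rewrite negbK.
by rewrite (bigD1 i)//= (negbTE hi) mul0r.
Qed.

Lemma sgn1_le1 I t : `|sgn1 I t| <= 1.
Proof.
rewrite /sgn1 !indicE; case: (t \in _); case: (t \in _); rewrite ?subrr ?subr0 ?sub0r ?normrN ?normr0 ?normr1//.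
Qed.

Lemma haar_sgn_le1 Q x : `|haar_sgn Q x| <= 1.
Proof. by rewrite /haar_sgn normr_prod; apply: prodr_ile1 => i; rewrite normr_ge0 sgn1_le1. Qed.

Lemma haar_sgn_periodic Q : zperiodic (haar_sgn Q).
Proof.
move=> k x; apply: eq_bigr => i _; rewrite !tnth_mktuple /sgn1 !indicE.
by congr (_ - _); congr (nat_of_bool _)%:R; apply/idP/idP => /set_mem h; apply/mem_set; move: h => /arc_addz h //; apply/arc_addz.
Qed.

Lemma measurable_haar_sgn Q : measurable_fun setT (haar_sgn Q).
Proof.
apply: measurable_prod => i _.
apply: (@measurableT_comp _ _ _ _ _ _ (sgn1 (tnth Q i)) _ (fun x : rv => tnth x i)).
  by apply: measurable_funB; apply: measurable_indic; exact: measurable_arc.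
exact: measurable_tnth.
Qed.

Lemma bounded_bmo_test b : zperiodic b -> measurable_fun setT b -> (forall x, 0 <= b x <= 2) -> bmo_test 4 b.
Proof.
move=> bp mb b02.
have bN x : `|b x| <= 2 by have /andP[b0 b2] := b02 x; rewrite ger0_norm.
have lb := l2_bounded mb bN.
split=> //; first by move=> x; have /andP[] := b02 x.
  apply: (@le_trans _ _ (\int[mu]_x (4 : R))); last by rewrite Rintegral_cst// ler_piMr// fine_mu_le1.
  apply: le_Rintegral => //; [exact: lb.2|exact: intg_cst|].
  by move=> x _; have /andP[b0 b2] := b02 x; rewrite expr2 (_ : 4 = 2 * 2 :> R) ?ler_pM//; ring.
move=> P rP; exists 0; have mP := measurable_rectangle rP.
have iP : intg (fun x => \1_P x : R) by apply: intg_bounded; [exact: measurable_indic_rectangle|exact: indic_bounded].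
rewrite volE// -RintegralZl//; apply: le_Rintegral => //; first by apply: intg_osc => //; exact: l2_intg.
  exact: intgZ.
by move=> x _; rewrite subr0 ler_wpM2r ?indicE//; apply: le_trans (bN x) _; rewrite ler_nat.
Qed.

(** [haar_sgn] takes negative values, so the test function is 1 + [haar_sgn]; the contribution of
    the 1 is [hc psi Q], itself bounded by testing on 1 alone. *)
Lemma bounded_means psi : l2 psi ->
  (forall b, bmo_fun b -> carleson (fun x => psi x * b x)) ->
  exists2 M, 0 <= M & forall Q, `|rmean psi Q| <= M.
Proof.
move=> lpsi H; have [K K0 HK] := uniform_carleson (ler0n R 4) lpsi H.
exists (Num.sqrt (4 * K)); first exact: sqrtr_ge0.
move=> Q; have ipsi := l2_intg lpsi.
have V : fine (mu (runion [:: Q])) = rvol R Q.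
  rewrite (_ : runion [:: Q] = rect_set Q) ?mu_rect//.
  rewrite predeqE => x; split=> [[Q' /=]|Qx]; first by rewrite inE => /eqP ->.
  by exists Q => //=; rewrite inE.
have k1 : hc psi Q ^+ 2 <= K * rvol R Q.
  have := HK (fun=> 1); rewrite (_ : (fun x => psi x * 1) = psi); last by apply/funext => x; rewrite mulr1.
  move=> h; have {}h := h (bounded_bmo_test _ _ _).
  have := h (fun _ _ => erefl) (measurable_cst _) _ [:: Q] isT; rewrite big_seq1 V; apply.
  by move=> x; rewrite ler01 ler1n.
have iS : intg (fun x => psi x * haar_sgn Q x).
  by apply: intgM => //; [exact: measurable_haar_sgn|exists 1 => x; exact: haar_sgn_le1].
have k2 : (hc psi Q + hscale R Q * rmean psi Q) ^+ 2 <= K * rvol R Q.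
  have -> : hc psi Q + hscale R Q * rmean psi Q = hc (fun x => psi x * (1 + haar_sgn Q x)) Q.
    rewrite (_ : (fun x => psi x * _) = fun x => psi x + psi x * haar_sgn Q x); last by apply/funext => x; ring.
    rewrite hcD//; congr (_ + _); rewrite /rmean /hc -hscale_sqr.
    have s0 : hscale R Q != 0 by rewrite -sqrf_eq0 hscale_sqr gt_eqF// rvol_gt0.
    rewrite (_ : _ * (_ * _) = (hscale R Q)^-1 * \int[mu]_x (psi x * \1_(rect_set Q) x)); last by field.
    rewrite -RintegralZl//; last by apply: intgM => //; [exact: measurable_indic_rect|exact: indic_bounded].
    apply: eq_cube.
    - by apply: measurable_funM => //; apply: measurable_funM; [exact: lpsi.1|exact: measurable_indic_rect].
    - by apply: measurable_funM; [exact: intg_measurable iS|exact: measurable_haar].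
    by move=> x Cx; rewrite -[RHS]mulrA haar_sgnP// mulrCA.
  have := HK (fun x => 1 + haar_sgn Q x) _ [:: Q] isT; rewrite big_seq1 V; apply.
  apply: bounded_bmo_test.
  - by move=> k x; rewrite haar_sgn_periodic.
  - by apply: measurable_funD => //; exact: measurable_haar_sgn.
  - by move=> x; have := haar_sgn_le1 Q x; rewrite ler_norml => /andP[h1 h2]; apply/andP; split; lra.
rewrite -(ger0_norm (sqrtr_ge0 _)) -ler_sqr ?nnegrE ?normr_ge0// !real_normK ?num_real//.
rewrite sqr_sqrtr ?mulr_ge0// -(ler_pM2l (rvol_gt0 R Q)) -{1}hscale_sqr -exprMn.
(* The bounds on z and z + y give y^2 <= 2 (z+y)^2 + 2 z^2, the difference being the square (y +
   2z)^2; hence 4 K. *)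
set y := _ * rmean _ _ in k2 *; move: k1 k2; set z := hc _ _ => k1 k2.
have := sqr_ge0 (y + 2 * z); nra.
Qed.

(** The set A where psi exceeds M by 1/(n+1) is tested through the conditional expectation of its
    indicator: on the grid, psi is seen only through its means, so the integral of psi over A is at
    most M mu(A), which forces mu(A) = 0. *)
Lemma ae_le_of_means psi (M : R) : intg psi -> (forall Q, rmean psi Q <= M) ->
  {ae mu, forall x, psi x <= M}.
Proof.
move=> ipsi HM; have mpsi := intg_measurable ipsi.
pose A n := [set x | M + n.+1%:R^-1 < psi x].
have mA n : measurable (A n).
  have := mpsi measurableT _ (measurable_itv `]M + n.+1%:R^-1, +oo[).
  congr measurable; rewrite predeqE => x; split=> [[_ /=]|/= h]; rewrite /= ?in_itv /= andbT//.
have A0 n : mu (A n) = 0%E.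
  pose phi : rv -> R := \1_(A n).
  have mphi : measurable_fun setT phi by exact: measurable_indic.
  have phi1 x : `|phi x| <= 1 by rewrite /phi indicE; case: (_ \in _); rewrite ?normr1 ?normr0.
  have iphi : intg phi by apply: intg_bounded => //; exists 1.
  have iAp : intg (fun x => phi x * psi x).
    rewrite (_ : (fun x => _) = fun x => psi x * phi x); last by apply/funext => x; rewrite mulrC.
    by apply: intgM => //; exact: indic_bounded.
  have key : \int[mu]_x (phi x * psi x) <= M * fine (mu (A n)).
    apply/ler_addgt0Pl => e e0.
    have [m /(_ m (leqnn m))] := cexp_weak iphi ler01 phi1 ipsi e0.
    have -> : \int[mu]_x (cexp m phi x * psi x) = Lam m psi (disc m phi).
      by apply: eq_Rintegral => x _; rewrite mulrC.
    rewrite Lam_EN// => h.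
    have h2 : EN m N (fun c => disc m psi c * disc m phi c) <= M * fine (mu (A n)).
      rewrite -RintegralEindic// (_ : \int[mu]_x _ = Lam m phi (fun=> 1)); last first.
        by apply: eq_Rintegral => x _; rewrite mulr1.
      rewrite Lam_EN// /EN -(lin_avN R _).2; apply: le_EN => c sc vc.
      have [Q _ ->] := disc_rmean ipsi sc vc; rewrite mulr1 ler_wpM2r//.
      rewrite -(disc_cst (R := R) 0 sc vc); apply: le_disc => //; first exact: intg_cst.
    move: h; rewrite ler_norml => /andP[h _]; move: h h2; lra.
  have h3 : (M + n.+1%:R^-1) * fine (mu (A n)) <= \int[mu]_x (phi x * psi x).
    rewrite -RintegralEindic// -RintegralZl//; apply: le_Rintegral => //; first exact: intgZ.
    move=> x _; rewrite -/(phi x) [leLHS]mulrC /phi indicE.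
    by case: (boolP (x \in A n)) => [/set_mem /= h|_]; rewrite ?mul1r ?mul0r// ltW.
  have h4 : fine (mu (A n)) <= 0.
    have p0 : 0 < (n.+1%:R : R)^-1 by rewrite invr_gt0.
    by rewrite -(pmulr_rle0 _ p0); move: (le_trans h3 key); rewrite mulrDl gerDl.
  have f0 : fine (mu (A n)) = 0 by apply/eqP; rewrite eq_le h4 fine_ge0.
  by rewrite -[LHS]fineK ?f0// fin_num_measure.
have : {ae mu, forall x, forall n, psi x <= M + n.+1%:R^-1}.
  apply/ae_foralln => n; exists (A n); split=> //; first exact: A0.
  by move=> x /= /negP; rewrite -ltNge.
apply: filterS => x h; apply/ler_addgt0Pl => e e0.
have [n _ /(_ n (leqnn n)) /= nE] := near_infty_natSinv_lt (PosNum e0).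
by apply: le_trans (h n) _; rewrite addrC lerD2r ltW.
Qed.

Lemma ae_bounded psi : l2 psi ->
  (forall b, bmo_fun b -> carleson (fun x => psi x * b x)) ->
  exists M, {ae mu, forall x, `|psi x| <= M}.
Proof.
move=> lpsi H; have [M M0 HM] := bounded_means lpsi H; have ipsi := l2_intg lpsi.
have h1 : {ae mu, forall x, psi x <= M}.
  by apply: ae_le_of_means => // Q; apply: le_trans (HM Q); exact: ler_norm.
have h2 : {ae mu, forall x, -1 * psi x <= M}.
  apply: ae_le_of_means => [|Q]; first exact: intgZ.
  by rewrite rmeanZ// mulN1r; apply: le_trans (HM Q); rewrite -normrN ler_norm.
exists M; apply: filterS2 h1 h2 => x a1 a2; rewrite ler_norml a1 andbT; move: a2; lra.
Qed.

End haar_tests.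

(** * Multipliers belong to LMO *)

Section circle_tents.
Context (R : realType).
Implicit Types (c t a : R) (k : int) (i n : nat).

(** Distance from t to c + Z. The two lemmas that follow present it as an attained minimum over
    integers, from which periodicity and the Lipschitz bound follow. *)
Definition circle_dist c t : R :=
  Num.min (t - c - (Num.floor (t - c))%:~R) (1 - (t - c - (Num.floor (t - c))%:~R)).

Lemma circle_dist_le c t k : circle_dist c t <= `|t - c - k%:~R|.
Proof.
have h1 := floor_le_tmp (t - c); have h2 := floorD1_gt (t - c).
rewrite /circle_dist; set f := Num.floor (t - c) in h1 h2 *.
rewrite intrD in h2; set y := t - c in h1 h2 *.
have [kf|kf] := leP k f.
  have kf' : k%:~R <= f%:~R :> R by rewrite ler_int.
  rewrite ger0_norm; last by lra.
  by rewrite ge_min; apply/orP; left; lra.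
have kf' : f%:~R + 1 <= k%:~R :> R by rewrite -(intrD _ f 1) ler_int; lia.
rewrite ler0_norm; last by move: h2; lra.
by rewrite ge_min; apply/orP; right; lra.
Qed.

Lemma circle_dist_ex c t : exists k, circle_dist c t = `|t - c - k%:~R|.
Proof.
have h1 := floor_le_tmp (t - c); have h2 := floorD1_gt (t - c).
rewrite /circle_dist; set f := Num.floor (t - c) in h1 h2 *.
rewrite intrD in h2; set y := t - c in h1 h2 *.
have [h|h] := leP (y - f%:~R) (1 - (y - f%:~R)).
  by exists f; rewrite ger0_norm//; lra.
by exists (f + 1); rewrite intrD ler0_norm; lra.
Qed.

Lemma circle_dist_addz c t k : circle_dist c (t + k%:~R) = circle_dist c t.
Proof.
apply/eqP; rewrite eq_le; apply/andP; split.
  have [j ->] := circle_dist_ex c t.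
  rewrite (_ : t - c - _ = t + k%:~R - c - (j + k)%:~R) ?circle_dist_le// intrD; ring.
have [j ->] := circle_dist_ex c (t + k%:~R).
rewrite (_ : t + k%:~R - c - _ = t - c - (j - k)%:~R) ?circle_dist_le// intrB; ring.
Qed.

Lemma circle_dist_lip c t t' : `|circle_dist c t - circle_dist c t'| <= `|t - t'|.
Proof.
have key u v : circle_dist c u - circle_dist c v <= `|u - v|.
  have [k ->] := circle_dist_ex c v; rewrite lerBlDr; apply: le_trans (circle_dist_le c u k) _.
  by rewrite (_ : u - c - _ = (u - v) + (v - c - k%:~R)) ?ler_normD//; ring.
by rewrite ler_norml key andbT lerNl opprB distrC key.
Qed.

(** Equal to 1 within distance 2^-i of c and to 0 beyond 2 (2^-i), with slope 2^i in between. *)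
Definition tent i c t : R := Num.min 1 (Num.max 0 (2 - 2 ^+ i * circle_dist c t)).

Lemma tent01 i c t : 0 <= tent i c t <= 1.
Proof. by rewrite /tent le_min ge_min ler01 lexx le_max lexx. Qed.

Lemma tent_lip i c t t' : `|tent i c t - tent i c t'| <= 2 ^+ i * `|t - t'|.
Proof.
apply: (@le_trans _ _ `|2 ^+ i * circle_dist c t - 2 ^+ i * circle_dist c t'|); last first.
  by rewrite -mulrBr normrM ger0_norm ?exprn_ge0// ler_wpM2l ?exprn_ge0// circle_dist_lip.
rewrite /tent; set u := _ * circle_dist c t; set v := _ * _.
rewrite /Num.min /Num.max; repeat case: ifPn => //; rewrite -?leNgt => *.
all: rewrite ?subrr ?normr0 //; rewrite ler_norml; apply/andP; split.
all: have := ler_norm (u - v); have := ler_norm (v - u); rewrite (distrC v u) => *; lra.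
Qed.

Lemma tent_addz i c t k : tent i c (t + k%:~R) = tent i c t.
Proof. by rewrite /tent circle_dist_addz. Qed.

Lemma measurable_tent i c : measurable_fun setT (tent i c).
Proof.
apply: continuous_measurable_fun => t; apply/cvgrPdist_le => e e0.
have d0 : 0 < e / 2 ^+ i by rewrite divr_gt0// exprn_gt0.
near=> u; apply: le_trans (tent_lip _ _ _ _) _; rewrite mulrC -ler_pdivlMr ?exprn_gt0//.
Unshelve. all: by end_near.
Qed.

Lemma tent_eq1 i c t : 2 ^+ i * circle_dist c t <= 1 -> tent i c t = 1.
Proof. by move=> h; rewrite /tent; apply/min_idPl; rewrite le_max; apply/orP; right; lra. Qed.

Lemma tent_arc i c t : tent i c t <= \1_(Defs.arc (c - 2 * 2^-1 ^+ i) (c + 2 * 2^-1 ^+ i)) t.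
Proof.
rewrite indicE; case: (boolP (t \in _)) => h; first by have /andP[] := tent01 i c t.
rewrite /tent ge_min; apply/orP; right; rewrite ge_max lexx /= leNgt; apply/negP => h2.
case/negP: h; apply/mem_set; have [k dk] := circle_dist_ex c t.
have h3 : `|t - c - k%:~R| < 2 * 2^-1 ^+ i.
  by rewrite -dk exprVn ltr_pdivlMr ?exprn_gt0// mulrC; lra.
exists (- k); move: h3; rewrite mulrNz ltr_norml => /andP[h3 h4].
by apply/andP; split; [apply: ltW|]; lra.
Qed.

Lemma uniform_arc_le c (r : R) : 0 < r ->
  fine (uniform_prob (@ltr01 R) (Defs.arc (c - r) (c + r))) <= 2 * r.
Proof.
move=> r0; have [h|h] := leP (2 * r) 1.
  by rewrite uniform_arc /=; lra.
have mA : measurable (Defs.arc (c - r) (c + r)) by exact: measurable_arc.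
by apply: le_trans (ltW h); rewrite -lee_fin fineK ?fin_num_measure// probability_le1.
Qed.

(** For an interval of length s about 2^-k, wide tents (i <= k) oscillate by at most 2^i s and
    narrow ones have mean at most 4 (2^-i) / s. The two geometric sums are at most 2 and 8. *)
Lemma sum_pow_le n (k : nat) (s : R) : 0 < s -> 2^-1 ^+ k.+1 <= s -> s <= 2^-1 ^+ k ->
  \sum_(i < n) (if (i <= k)%N then 2 ^+ i * s else 4 * 2^-1 ^+ i / s) <= 10.
Proof.
move=> s0 sk ks.
have e1 : \sum_(i < n) (if (i <= k)%N then 2 ^+ i else 0) <= 2 ^+ k.+1 :> R.
  have : \sum_(i < n) (if (i <= k)%N then 2 ^+ i else 0) + 1 <= (if (n <= k.+1)%N then 2 ^+ n else 2 ^+ k.+1) :> R.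
    elim: n => [|n IH]; first by rewrite big_ord0 add0r.
    rewrite big_ord_recr /= ltnS; move: IH; case: (ltngtP n k.+1) => h IH.
    - have h1 : (n <= k)%N by rewrite -ltnS.
      by rewrite h1 exprS; move: IH; lra.
    - by rewrite leqNgt (ltnW h) /= addr0.
    - by rewrite h ltnn addr0; rewrite h in IH.
  case: ifP => h; last by lra.
  have : 2 ^+ n <= 2 ^+ k.+1 :> R by rewrite ler_eXn2l// ltr1n.
  by lra.
have e2 : \sum_(i < n) (if (i <= k)%N then 0 else 2^-1 ^+ i) <= 2^-1 ^+ k :> R.
  have : \sum_(i < n) (if (i <= k)%N then 0 else 2^-1 ^+ i) <= (if (n <= k.+1)%N then 0 else 2^-1 ^+ k - 2^-1 ^+ n.-1) :> R.
    elim: n {e1} => [|n IH]; first by rewrite big_ord0.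
    rewrite big_ord_recr /= ltnS; move: IH; case: (ltngtP n k.+1) => h IH.
    - have h1 : (n <= k)%N by rewrite -ltnS.
      by rewrite h1 addr0.
    - rewrite leqNgt (ltnW h) /=; case: n h IH => // n h; rewrite /= exprS; lra.
    - by rewrite h ltnn; rewrite h /= in IH; rewrite exprS; have := exprn_gt0 k (_ : 0 < 2^-1 :> R); rewrite invr_gt0 => /(_ (ltr0Sn _ _)); lra.
  case: ifP => _ h; apply: le_trans h _; first by rewrite exprn_ge0// invr_ge0.
  by rewrite gerBl exprn_ge0// invr_ge0.
have -> : \sum_(i < n) (if (i <= k)%N then 2 ^+ i * s else 4 * 2^-1 ^+ i / s) =
   s * \sum_(i < n) (if (i <= k)%N then 2 ^+ i else 0) + 4 / s * \sum_(i < n) (if (i <= k)%N then 0 else 2^-1 ^+ i).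
  rewrite !mulr_sumr -big_split /=; apply: eq_bigr => i _; case: ifP => _; rewrite mulr0 ?addr0 ?add0r ?[s * _]mulrC//.
  by rewrite mulrAC.
have h1 : s * \sum_(i < n) (if (i <= k)%N then 2 ^+ i else 0) <= 2.
  apply: le_trans (ler_wpM2l (ltW s0) e1) _.
  apply: le_trans (ler_wpM2r _ ks) _; first by rewrite exprn_ge0.
  by rewrite exprS mulrCA exprVn mulVf ?mulr1// gt_eqF// exprn_gt0.
have h2 : 4 / s * \sum_(i < n) (if (i <= k)%N then 0 else 2^-1 ^+ i) <= 8.
  apply: le_trans (ler_wpM2l _ e2) _; first by rewrite divr_ge0// ltW.
  by rewrite mulrAC ler_pdivrMr//; move: sk; rewrite exprS; lra.
by lra.
Qed.

Lemma sum_odd_pow n : \sum_(i < n) (i.*2.+1)%:R * (4 * 2^-1 ^+ i) <= 24 :> R.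
Proof.
have : \sum_(i < n) (i.*2.+1)%:R * (4 * 2^-1 ^+ i) = 24 - (16 * n%:R + 24) * 2^-1 ^+ n :> R.
  elim: n => [|n IH]; first by rewrite big_ord0 expr0; lra.
  rewrite big_ord_recr /= IH exprS -[n.*2.+1%:R]natr1 -[n.+1%:R]natr1 -muln2 natrM; field => //.
move=> ->; rewrite gerBl mulr_ge0// ?exprn_ge0 ?invr_ge0// addr_ge0// mulr_ge0//.
Qed.

End circle_tents.

(** * Truncated logarithms in one variable as test functions *)

Section log_tests.
Context (R : realType) (N : nat).
Local Notation rv := (rvec R N).
Local Notation mu := (torus_measure R N).
Implicit Types (b psi : rv -> R) (Q : dyadic_rect N) (F : seq (dyadic_rect N)) (P : set rv) (l : 'I_N) (i n : nat).

(* Comparable to log (1 / (d + 2^-n)), d the distance from x_l to c on the circle: bounded mean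
   oscillation uniformly in n and c. *)
Definition log_test l n c (x : rv) : R := \sum_(i < n.+1) tent i c (tnth x l).

Lemma measurable_tent_tnth l i c : measurable_fun setT (fun x : rv => tent i c (tnth x l)).
Proof.
apply: (@measurableT_comp _ _ _ _ _ _ (tent i c) _ (fun x : rv => tnth x l)).
  exact: measurable_tent.
exact: measurable_tnth.
Qed.

Lemma bounded_tent_tnth l i c (x : rv) : `|tent i c (tnth x l)| <= 1.
Proof. by have /andP[b0 b1] := tent01 i c (tnth x l); rewrite ger0_norm. Qed.

Lemma intg_tent l i c : intg (fun x : rv => tent i c (tnth x l)).
Proof. by apply: intg_bounded; [exact: measurable_tent_tnth|exists 1 => x; exact: bounded_tent_tnth]. Qed.

(** The tent is at most 1 and lives on an arc of length 4 (2^-i) in the l-th variable; the other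
    sides factor out. *)
Lemma tent_mean l i c (a b : rv) : (forall j, tnth a j < tnth b j <= tnth a j + 1) ->
  \int[mu]_x (tent i c (tnth x l) * \1_(arcbox a b) x) <=
  4 * 2^-1 ^+ i / (tnth b l - tnth a l) * vol (arcbox a b).
Proof.
move=> ab; have rP : rectangles (arcbox a b) by exists a, b.
pose r : R := 2 * 2^-1 ^+ i; have r0 : 0 < r by rewrite mulr_gt0// exprn_gt0// invr_gt0.
pose A j := if j == l then Defs.arc (tnth a j) (tnth b j) `&` Defs.arc (c - r) (c + r) else Defs.arc (tnth a j) (tnth b j).
have mA j : measurable (A j).
  by rewrite /A; case: ifP => _; [apply: measurableI|]; exact: measurable_arc.
have mB : measurable (box A) by exact: measurable_box.
apply: (@le_trans _ _ (\int[mu]_x (\1_(box A) x : R))).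
  apply: le_Rintegral => //.
  - by apply: intgM; [exact: intg_tent|exact: measurable_indic_rectangle|exact: indic_bounded].
  - by apply: intg_bounded; [exact: measurable_indic|exact: indic_bounded].
  move=> x _; have /andP[b0 b1] := tent01 i c (tnth x l).
  rewrite [\1_(arcbox a b) x]indicE; case: (boolP (x \in arcbox a b)) => [/set_mem Px|_]; last by rewrite mulr0 indicE.
  rewrite mulr1; have := tent_arc i c (tnth x l); rewrite -/r !indicE.
  case: (boolP (tnth x l \in _)) => [/set_mem h _|_ /le_trans]; last by apply.
  apply: le_trans b1 _; rewrite mem_set// => j; rewrite /A; case: eqP => [->|_]; [split=> //|]; exact: Px.
rewrite RintegralEindic// torus_box//= (bigD1 l)//= {1}/A eqxx.
rewrite (vol_arcbox ab) [X in _ <= _ * X](bigD1 l)//= mulrA divfK; last first.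
  by rewrite gt_eqF// subr_gt0; case/andP: (ab l).
rewrite [X in _ * X](eq_bigr (fun j => tnth b j - tnth a j)); last first.
  move=> j /negPf jl; rewrite /A jl.
  by have /andP[h1 h2] := ab j; rewrite uniform_arc.
apply: ler_wpM2r.
  by apply: prodr_ge0 => j _; rewrite subr_ge0; case/andP: (ab j) => /ltW.
have -> : 4 * 2^-1 ^+ i = 2 * r by rewrite /r; ring.
apply: le_trans (uniform_arc_le c r0).
have mC : measurable (Defs.arc (c - r) (c + r)) by exact: measurable_arc.
have mD : measurable (Defs.arc (tnth a l) (tnth b l) `&` Defs.arc (c - r) (c + r)).
  by apply: measurableI => //; exact: measurable_arc.
apply: fine_le; [exact: fin_num_measure|exact: fin_num_measure|].
by apply: le_measure; rewrite ?inE// => t [].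
Qed.

Lemma tent_integral l i c : \int[mu]_x tent i c (tnth x l) <= 4 * 2^-1 ^+ i.
Proof.
pose a : rv := [tuple 0 | _ < N]; pose b : rv := [tuple 1 | _ < N].
have ab j : tnth a j < tnth b j <= tnth a j + 1 by rewrite !tnth_mktuple add0r ltr01 lexx.
have := tent_mean l i c ab.
rewrite vol_arcbox// big1 => [|j _]; last by rewrite !tnth_mktuple subr0.
rewrite !tnth_mktuple subr0 divr1 mulr1; apply: le_trans.
rewrite le_eqVlt; apply/orP; left; apply/eqP; apply: eq_cube.
- exact: measurable_tent_tnth.
- apply: measurable_funM; first exact: measurable_tent_tnth.
  by apply: measurable_indic_rectangle; exists a, b.
move=> x Cx; rewrite indicE mem_set ?mulr1// => j; rewrite !tnth_mktuple.
by apply/arc01 => //; have := Cx j; rewrite /= in_itv.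
Qed.

Lemma measurable_log_test l n c : measurable_fun setT (log_test l n c).
Proof. by apply: measurable_sum => i; exact: measurable_tent_tnth. Qed.

Lemma log_test_ge0 l n c x : 0 <= log_test l n c x.
Proof. by apply: sumr_ge0 => i _; have /andP[] := tent01 i c (tnth x l). Qed.

Lemma tent_sum_le n c (t : R) : 0 <= \sum_(i < n) tent i c t <= n%:R.
Proof.
apply/andP; split; first by apply: sumr_ge0 => i _; have /andP[] := tent01 i c t.
rewrite -[n in n%:R]card_ord -sumr_const.
by apply: ler_sum => i _; have /andP[] := tent01 i c t.
Qed.

Lemma l2_log_test l n c : l2 (log_test l n c).
Proof.
apply: (@l2_bounded _ _ _ n.+1%:R); first exact: measurable_log_test.
by move=> x; have /andP[h0 h1] := tent_sum_le n.+1 c (tnth x l); rewrite ger0_norm.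
Qed.

Lemma intg_sum (m : nat) (g : nat -> rv -> R) : (forall i, intg (g i)) ->
  intg (fun x => \sum_(i < m) g i x) /\
  \int[mu]_x (\sum_(i < m) g i x) = \sum_(i < m) \int[mu]_x g i x.
Proof.
move=> ig; elim: m => [|m [IH1 IH2]].
  rewrite (_ : (fun x => _) = fun=> 0); last by apply/funext => x; rewrite big_ord0.
  by rewrite big_ord0 Rintegral_cst// mul0r; split=> //; exact: intg_cst.
split.
  rewrite (_ : (fun x => _) = fun x => \sum_(i < m) g i x + g m x); last by apply/funext => x; rewrite big_ord_recr.
  exact: intgD.
rewrite big_ord_recr /= -IH2 -RintegralD//; last exact: ig.
by apply: eq_Rintegral => x _; rewrite big_ord_recr.
Qed.

(** Since 0 <= tent <= 1, adding the i-th tent to a sum of i tents increases the square by at most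
    (2i + 1) tent; 24 is the value of the resulting series. *)
Lemma log_test_sqr l n c : \int[mu]_x (log_test l n c x ^+ 2) <= 24.
Proof.
have [ig eg] := @intg_sum n.+1 (fun i x => (i.*2.+1)%:R * tent i c (tnth x l)) (fun i => intgZ _ (intg_tent l i c)).
apply: (@le_trans _ _ (\int[mu]_x (\sum_(i < n.+1) (i.*2.+1)%:R * tent i c (tnth x l)))).
  apply: le_Rintegral => //; first exact: (l2_log_test l n c).2.
  move=> x _; rewrite /log_test; elim: n.+1 => [|m IH]; first by rewrite !big_ord0 expr0n.
  rewrite !big_ord_recr /= sqrrD -addrA; apply: lerD => //.
  have /andP[s0 sm] := tent_sum_le m c (tnth x l); have /andP[b0 b1] := tent01 m c (tnth x l).
  rewrite -[m.*2.+1%:R]natr1 -muln2 natrM; move: s0 sm b0 b1; set s := \sum_(_ < m) _; set p := tent _ _ _.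
  rewrite -mulr_natr; nra.
rewrite eg; apply: le_trans (sum_odd_pow R n.+1); apply: ler_sum => i _.
by rewrite RintegralZl//; [rewrite ler_wpM2l// tent_integral|exact: intg_tent].
Qed.

Lemma log_test_osc l n c : rect_osc 10 (log_test l n c).
Proof.
move=> P rP; have [a [b [ab PE]]] := rP.
have /andP[abl abl1] := ab l; set s := tnth b l - tnth a l.
have s0 : 0 < s by rewrite subr_gt0.
have s1 : s <= 1 by rewrite lerBlDl.
have [k [sk ks]] := half_pow_bracket s0 s1.
(* Wide tents are compared with their value at the left end of the l-th side, narrow ones with 0. *)
exists (\sum_(i < n.+1) (if (i <= k)%N then tent i c (tnth a l) else 0)).
pose g i (x : rv) := (if (i <= k)%N then 2 ^+ i * s else tent i c (tnth x l)) * \1_P x.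
have ig i : intg (g i).
  rewrite /g; case: (i <= k)%N.
    by apply: intgZ; apply: intg_bounded; [exact: measurable_indic_rectangle|exact: indic_bounded].
  by apply: intgM; [exact: intg_tent|exact: measurable_indic_rectangle|exact: indic_bounded].
have [isum eS] := intg_sum n.+1 ig.
apply: (@le_trans _ _ (\int[mu]_x (\sum_(i < n.+1) g i x))).
  apply: le_Rintegral => //; first by apply: intg_osc => //; apply: l2_intg; exact: l2_log_test.
  move=> x _; rewrite -mulr_suml indicE.
  case: (boolP (x \in P)) => [/set_mem|_]; last by rewrite !mulr0.
  rewrite PE !mulr1 => Px; rewrite /log_test -sumrB.
  apply: le_trans (ler_norm_sum _ _ _) _; apply: ler_sum => i _.
  case: ifP => ik; last by rewrite subr0; have /andP[b0 _] := tent01 i c (tnth x l); rewrite ger0_norm.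
  (* z brings x_l into [a_l, b_l), within s of a_l. *)
  have [z /andP[z1 z2]] := Px l; rewrite -(tent_addz i c (tnth x l) z).
  apply: le_trans (tent_lip _ _ _ _) _; rewrite ler_wpM2l ?exprn_ge0//.
  by rewrite ger0_norm ?subr_ge0// lerB// ltW.
rewrite eS; apply: (@le_trans _ _ (\sum_(i < n.+1) (if (i <= k)%N then 2 ^+ i * s else 4 * 2^-1 ^+ i / s) * vol P)).
  apply: ler_sum => i _; rewrite /g; case: (nat_of_ord i <= k)%N; last by rewrite PE; exact: tent_mean.
  rewrite RintegralZl//; last by apply: intg_bounded; [exact: measurable_indic_rectangle|exact: indic_bounded].
  by rewrite -volE//; exact: measurable_rectangle.
by rewrite -mulr_suml ler_wpM2r ?sum_pow_le// ltW// vol_gt0.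
Qed.

Lemma bmo_test_log l n c : bmo_test 24 (log_test l n c).
Proof.
split.
- by move=> k x; apply: eq_bigr => i _; rewrite !tnth_mktuple tent_addz.
- exact: l2_log_test.
- exact: log_test_ge0.
- exact: log_test_sqr.
move=> P rP; have [m hm] := log_test_osc l n c rP; exists m; apply: le_trans hm _.
by rewrite ler_wpM2r ?ler_nat// ltW// vol_gt0.
Qed.

Lemma haar_out Q x : ~ rect_set Q x -> haar Q x = 0 :> R.
Proof.
move=> nQ; have [i hi] : exists i : 'I_N, ~~ (dleft R (tnth Q i) <= tnth x i < dright R (tnth Q i)).
  apply/existsP; apply: contraT; rewrite negb_exists => /forallP h.
  by case: nQ => i; rewrite /= in_itv /=; have := h i; rewrite negbK.
have [l0 lm mr r1] := dyadic_bounds R (tnth Q i).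
rewrite /haar (bigD1 i)//= /haar1 !indicE !mem_setE !in_itv /=.
move: hi; rewrite negb_and -ltNge -leNgt => /orP[h|h].
  rewrite [_ <= _ < dright _ _]andbC leNgt (lt_trans h lm) andbF /=.
  by rewrite [dleft _ _ <= _]leNgt h /= subrr mulr0 mul0r.
by rewrite [_ < dright _ _]ltNge h andbF [_ < dmid _ _]ltNge (le_trans (ltW mr) h) andbF subrr mulr0 mul0r.
Qed.

Definition ancestor n (I : dyadic) : nat := (tagged I %/ 2 ^ (tag I - n))%N.

Lemma ancestor_lt n (I : dyadic) : (n <= tag I)%N -> (ancestor n I < 2 ^ n)%N.
Proof. by move=> nI; rewrite /ancestor ltn_divLR ?expn_gt0// -expnD subnKC//; exact: ltn_ord. Qed.

Lemma ancestor_itv n (I : dyadic) (t : R) : (n <= tag I)%N -> dleft R I <= t < dright R I ->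
  (ancestor n I)%:R * 2^-1 ^+ n <= t < (ancestor n I).+1%:R * 2^-1 ^+ n.
Proof.
case: I => j k /= nj; rewrite /ancestor /dright /dleft /dlen /= => /andP[h1 h2].
have p0 : 0 < 2^-1 ^+ j :> R by rewrite exprn_gt0// invr_gt0.
have e : 2^-1 ^+ n = (2 ^ (j - n))%:R * 2^-1 ^+ j :> R.
  by rewrite -{2}(subnK nj) exprD mulrA natrX -exprMn mulfV// expr1n mul1r.
apply/andP; split.
  apply: le_trans h1; rewrite e mulrA -natrM ler_pM2r// ler_nat; exact: leq_trunc_div.
apply: lt_le_trans h2 _; rewrite -[X in _ + X]mul1r -mulrDl e mulrA -natrM ler_pM2r// natr1 ler_nat.
by rewrite -ltn_divLR ?expn_gt0.
Qed.

(** Every point of the ancestor lies within 2^-n of its midpoint, where all n + 1 tents are 1. *)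
Lemma log_test_ancestor l n Q x : (n <= tag (tnth Q l))%N -> rect_set Q x ->
  log_test l n ((ancestor n (tnth Q l))%:R * 2^-1 ^+ n + 2^-1 ^+ n / 2) x = n.+1%:R.
Proof.
move=> nQ Qx; have /andP[h1 h2] : dleft R (tnth Q l) <= tnth x l < dright R (tnth Q l).
  by have := Qx l; rewrite /= in_itv.
have /andP[{}h1 {}h2] := ancestor_itv nQ (introT andP (conj h1 h2)).
rewrite /log_test (eq_bigr (fun=> 1)) ?sumr_const ?card_ord// => i _; apply: tent_eq1.
set a := (ancestor _ _)%:R in h1 *.
have p0 : 0 < 2^-1 ^+ n :> R by rewrite exprn_gt0// invr_gt0.
rewrite -natr1 mulrDl mul1r in h2.
have h3 := circle_dist_le (a * 2^-1 ^+ n + 2^-1 ^+ n / 2) (tnth x l) 0.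
have h4 : `|tnth x l - (a * 2^-1 ^+ n + 2^-1 ^+ n / 2) - 0%:~R| <= 2^-1 ^+ n.
  move: h1 h2 p0; rewrite subr0 -/a; set p := 2^-1 ^+ n; set q := a * p => h1 h2 p0.
  by rewrite ler_norml; apply/andP; split; lra.
apply: le_trans (ler_wpM2l _ (le_trans h3 h4)) _; first by rewrite exprn_ge0.
rewrite exprVn ler_pdivrMr ?exprn_gt0// mul1r ler_eXn2l ?ltr1n//.
by rewrite -ltnS ltn_ord.
Qed.

(* The rectangles of F are grouped according to the ancestor J of level n of their
   l-th side; the log_test centered at J is the constant n + 1 on each of them. *)
Lemma level_carleson psi : l2 psi ->
  (forall b, bmo_fun b -> carleson (fun x => psi x * b x)) ->
  exists2 K, 0 <= K & forall l n F, uniq F -> (forall Q, Q \in F -> (n <= tag (tnth Q l))%N) ->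
    \sum_(Q <- F) hc psi Q ^+ 2 <= K / n.+1%:R ^+ 2 * fine (mu (runion F)).
Proof.
move=> lpsi H; have [K K0 HK] := uniform_carleson (ler0n R 24) lpsi H.
exists K => // l n F uF Fn.
have n0 : 0 < n.+1%:R ^+ 2 :> R by rewrite exprn_gt0.
pose FJ (j : nat) := [seq Q <- F | ancestor n (tnth Q l) == j].
have e1 : \sum_(Q <- F) hc psi Q ^+ 2 = \sum_(j < 2 ^ n) \sum_(Q <- FJ j) hc psi Q ^+ 2.
  under [RHS]eq_bigr do rewrite big_filter big_mkcond /=.
  rewrite exchange_big /= big_seq [RHS]big_seq; apply: eq_bigr => Q QF.
  rewrite (bigD1 (Ordinal (ancestor_lt (Fn Q QF))))//= eqxx big1 ?addr0// => j jQ.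
  by rewrite ifF//; apply/negbTE; apply: contraNneq jQ => e; apply/eqP/val_inj.
have e2 j : \sum_(Q <- FJ j) hc psi Q ^+ 2 <= K / n.+1%:R ^+ 2 * fine (mu (runion (FJ j))).
  set c := j%:R * 2^-1 ^+ n + 2^-1 ^+ n / 2 : R.
  have := HK _ (bmo_test_log l n c) (FJ j) (filter_uniq _ uF).
  rewrite mulrAC ler_pdivlMr//; apply: le_trans; rewrite mulr_suml big_seq [leRHS]big_seq.
  apply: ler_sum => Q; rewrite mem_filter => /andP[/eqP jQ QF].
  suff -> : hc (fun x => psi x * log_test l n c x) Q = hc psi Q * n.+1%:R by rewrite exprMn.
  rewrite /hc [RHS]mulrC -RintegralZl//; last first.
    by apply: intgM; [exact: l2_intg|exact: measurable_haar|exact: bounded_haar].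
  apply: eq_Rintegral => x _; have [Qx|nQ] := pselect (rect_set Q x); last by rewrite haar_out// !mulr0.
  by rewrite /c -jQ log_test_ancestor ?Fn//; ring.
rewrite e1; apply: (@le_trans _ _ (\sum_(j < 2 ^ n) K / n.+1%:R ^+ 2 * fine (mu (runion (FJ j))))).
  by apply: ler_sum => j _; exact: e2.
rewrite -mulr_sumr; apply: ler_wpM2l; first by rewrite divr_ge0// ltW.
have mF (G : seq (dyadic_rect N)) : measurable (runion G : set rv) by exact: measurable_runion.
have iF (G : seq (dyadic_rect N)) : intg (fun x : rv => \1_(runion G) x : R).
  by apply: intg_bounded; [apply: measurable_indic; exact: mF|exact: indic_bounded].
rewrite (eq_bigr (fun j : 'I_(2 ^ n) => \int[mu]_x (\1_(runion (FJ j)) x : R))); last first.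
  by move=> j _; rewrite RintegralEindic.
have [isum eS] := @intg_sum (2 ^ n) (fun j x => \1_(runion (FJ j)) x) (fun j => iF (FJ j)).
rewrite -eS -RintegralEindic//; apply: le_Rintegral => [|||x _]; [by []|exact: isum|exact: iF|].
(* The union of [FJ j] lies in the slab over the j-th interval of length 2^-n. The slabs are
   disjoint, so the indicators add up to at most that of [runion F]. *)
have inJ j : runion (FJ j) x -> runion F x /\ j%:R * 2^-1 ^+ n <= tnth x l < j.+1%:R * 2^-1 ^+ n.
  move=> [Q]; rewrite /= mem_filter => /andP[/eqP jQ QF] Qx; split; first by exists Q.
  by rewrite -jQ; apply: ancestor_itv; [exact: Fn|have := Qx l; rewrite /= in_itv].
have [[j jx]|nj] := pselect (exists j : 'I_(2 ^ n), runion (FJ j) x).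
  have [Fx /andP[h1 h2]] := inJ j jx.
  rewrite (bigD1 j)//= big1 => [|j' jj]; last first.
    rewrite indicE memNset// => /inJ[_ /andP[h3 h4]].
    have p0 : 0 < 2^-1 ^+ n :> R by rewrite exprn_gt0// invr_gt0.
    have := le_lt_trans h1 h4; have := le_lt_trans h3 h2; rewrite !ltr_pM2r// !ltr_nat !ltnS => a1 a2.
    by case/eqP: jj; apply/val_inj/eqP; rewrite eqn_leq a1 a2.
  by rewrite addr0 !indicE !mem_set.
rewrite big1 => [|j _]; first by rewrite indicE.
by rewrite indicE memNset// => jx; apply: nj; exists j.
Qed.

End log_tests.

(** * From multipliers to bounded functions in LMO, over all translated grids *)

Section subset.
Local Open Scope complex_scope.
Context (R : realType) (N : nat).
Local Notation rv := (rvec R N).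
Local Notation mu := (torus_measure R N).
Implicit Types (b : rv -> R) (phi psi : rv -> R[i]) (Q : dyadic_rect N) (F : seq (dyadic_rect N)).

Lemma bmo_fun1 : bmo_fun (fun _ : rv => 1 : R).
Proof.
split=> //; first by apply: (@l2_bounded _ _ _ 1) => // x; rewrite normr1.
exists 0 => P rP; exists 1; rewrite mul0r (_ : (fun x => _) = fun=> 0) ?Rintegral_cst ?mul0r//.
by apply/funext => x; rewrite subrr normr0 mul0r.
Qed.

(** Multiplying by b moved back by a and then translating by a leaves b itself, so every translated
    grid sees the same test functions. *)
Lemma multiplier_translate phi (a : rv) b : multipliers (little_bmo R N) (product_BMO R N) phi ->
  unit_cube a -> bmo_fun b -> BMOd (fun x => translate a phi x * (b x)%:C).
Proof.
move=> mphi ua /bmo_fun_little bb.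
pose a' : rv := [tuple - tnth a i | i < N].
have := mphi _ (little_bmo_translate a' bb) a ua; rewrite /=; congr BMOd; apply/funext => x.
rewrite /translate /=; congr (_ * (b _)%:C); apply: eq_from_tnth => i.
by rewrite !tnth_mktuple addrK.
Qed.

(** Real test functions separate the real and imaginary parts of phi, and the test function 1 puts
    phi in L^2. *)
Lemma multiplier_parts phi (a : rv) : multipliers (little_bmo R N) (product_BMO R N) phi -> unit_cube a ->
  [/\ Lp_torus R N 2%:E (translate a phi),
    forall b, bmo_fun b -> carleson (fun x => complex.Re (translate a phi x) * b x) &
    forall b, bmo_fun b -> carleson (fun x => complex.Im (translate a phi x) * b x)].
Proof.
move=> mphi ua.
have H b : bmo_fun b -> [/\ Lp_torus R N 2%:E (fun x => translate a phi x * (b x)%:C),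
    carleson (fun x => complex.Re (translate a phi x) * b x) &
    carleson (fun x => complex.Im (translate a phi x) * b x)].
  move=> bb; have /BMOd_carleson[l2b c1 c2] := multiplier_translate mphi ua bb; split=> //.
    by move: c1; congr carleson; apply/funext => x; rewrite cReM /= mulr0 subr0.
  by move: c2; congr carleson; apply/funext => x; rewrite cImM /= mulr0 add0r.
split; last 2 first.
- by move=> b /H[].
- by move=> b /H[].
have [h _ _] := H _ bmo_fun1; move: h; congr Lp_torus.
by apply/funext => x; rewrite (_ : 1%:C = 1)// mulr1.
Qed.

Lemma translate0 phi : translate [tuple 0 | i < N] phi = phi.
Proof.
apply/funext => x; rewrite /translate /=; congr phi; apply: eq_from_tnth => i.
by rewrite !tnth_mktuple addr0.
Qed.

Lemma multiplier_bounded phi : multipliers (little_bmo R N) (product_BMO R N) phi ->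
  Lp_torus R N +oo%E phi.
Proof.
move=> mphi; pose a : rv := [tuple 0 | i < N].
have ua : unit_cube a by move=> i; rewrite tnth_mktuple lexx ltr01.
have := multiplier_parts mphi ua; rewrite translate0 => -[/Lp2P[tf l1 l2] H1 H2].
have [M1 h1] := ae_bounded l1 H1; have [M2 h2] := ae_bounded l2 H2.
apply/LpooP; split=> //; exists (M1 + M2); apply: filterS2 h1 h2 => x a1 a2.
by apply: le_trans (cabs_le _) _; exact: lerD.
Qed.

Lemma haar_proj_sum (j : N.-tuple nat) (c : dyadic_rect N -> R[i]) F (l : 'I_N) : uniq F ->
  exists F', [/\ uniq F', (forall Q, Q \in F' -> (tnth j l <= tag (tnth Q l))%N), {subset F' <= F} &
    \sum_(Q <- F) cabs (haar_proj j c Q) ^+ 2 = \sum_(Q <- F') cabs (c Q) ^+ 2].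
Proof.
move=> uF; pose p Q := [forall l, dlen R (tnth Q l) <= 2^-1 ^+ tnth j l].
exists [seq Q <- F | p Q]; split; first exact: filter_uniq.
- move=> Q; rewrite mem_filter => /andP[/forallP /(_ l) h _]; move: h.
  by rewrite /dlen !exprVn lef_pV2 ?posrE ?exprn_gt0// ler_eXn2l ?ltr1n.
- by move=> Q; rewrite mem_filter => /andP[].
rewrite big_filter [RHS]big_mkcond; apply: eq_bigr => Q _; rewrite /haar_proj /p.
by case: ifP => // _; rewrite cabsE /= expr0n addr0 sqrtr0 expr0n.
Qed.

Lemma multiplier_LMO phi : (0 < N)%N -> multipliers (little_bmo R N) (product_BMO R N) phi -> LMO R N phi.
Proof.
move=> N0 mphi a ua; rewrite /=; have [lpsi H1 H2] := multiplier_parts mphi ua.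
set psi := translate a phi in lpsi H1 H2 *.
have /Lp2P[tf l1 l2] := lpsi.
have [K1 K10 HK1] := level_carleson l1 H1; have [K2 K20 HK2] := level_carleson l2 H2.
have NR : 0 < N%:R :> R by rewrite ltr0n.
have K0 : 0 < K1 + K2 + 1 by rewrite ltr_wpDl// addr_ge0.
(* The 1 ensures positivity and K1 + K2 <= (K1 + K2 + 1)^2, a substitute for the square root. *)
split=> //; exists (N%:R * (K1 + K2 + 1)); first exact: mulr_gt0.
move=> j.
(* One side suffices: for the largest index n = j_l, the sum of all j's plus N is at most N (n +
   1). *)
have [l lmax] : exists l : 'I_N, forall l', (tnth j l' <= tnth j l)%N.
  by case: (@arg_maxnP _ (Ordinal N0) xpredT (tnth j) isT) => l _ h; exists l => l'; exact: h.
set n := tnth j l in lmax; set S := (\sum_(l0 < N) tnth j l0 + N)%N.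
have SN : (S <= N * n.+1)%N.
  rewrite mulnS addnC leq_add2r -[X in (_ <= X * _)%N](card_ord N) -sum_nat_const.
  by apply: leq_sum => l' _; exact: lmax.
have S0 : 0 < S%:R :> R by rewrite ltr0n addn_gt0 N0 orbT.
apply: BMOd_norm_le => [|F uF]; first by rewrite divr_ge0 ?mulr_ge0// ltW.
have [F' [uF' F'l sF ->]] := haar_proj_sum j (haar_coef psi) l uF.
have n0 : 0 < n.+1%:R :> R by rewrite ltr0n.
apply: (@le_trans _ _ (((K1 + K2 + 1) / n.+1%:R) ^+ 2 * fine (mu (runion F')))).
  rewrite (eq_bigr (fun Q => hc (fun x => complex.Re (psi x)) Q ^+ 2 + hc (fun x => complex.Im (psi x)) Q ^+ 2)); last first.
    by move=> Q _; rewrite cabs_sqr Re_haar_coef Im_haar_coef.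
  rewrite big_split /=; apply: le_trans (lerD (HK1 l n F' uF' F'l) (HK2 l n F' uF' F'l)) _.
  rewrite -mulrDl ler_wpM2r ?fine_ge0// -mulrDl expr_div_n ler_wpM2r ?invr_ge0 ?exprn_ge0//.
  by rewrite expr2; nra.
apply: ler_pM; rewrite ?sqr_ge0 ?fine_ge0//.
  apply: lerXn2r; rewrite ?nnegrE ?divr_ge0 ?mulr_ge0 ?(ltW K0)//.
  rewrite ler_pdivrMr// mulrAC ler_pdivlMr// [N%:R * _]mulrC -mulrA ler_pM2l//.
  by rewrite -natrM ler_nat.
apply: fine_le; [exact: fin_num_measure (measurable_runion F')|exact: fin_num_measure (measurable_runion F)|].
apply: le_measure; rewrite ?inE; [exact: measurable_runion|exact: measurable_runion|].
by move=> x [Q QF Qx]; exists Q => //; exact: sF.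
Qed.

End subset.

Theorem theorem2p4 (R : realType) (N : nat) (hN : (1 <= N)%N) :
  multipliers (little_bmo R N) (product_BMO R N) =
  Lp_torus R N +oo%E `&` LMO R N.
Proof.
rewrite predeqE => phi; split=> [mphi|[bphi lphi]].
  by split; [exact: multiplier_bounded|exact: multiplier_LMO].
exact: bounded_LMO_multiplier.
Qed.
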